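(* Let $m\ge1$, let $n_1,\dots,n_m$ be integers, and put $|\mathbf n|=n_1+\dots+n_m$. Assume that $w_1,\dots,w_m\in\mathbb C$ satisfy $|\mathrm{Im}\,w_i|<\pi$ and $\mathrm{Re}\,w_i<0$ for all $i=1,\dots,m$. Then $$\mathrm{Li}_{n_1,\dots,n_m}(e^{w_1},\dots,e^{w_{m-1}},-e^{w_m})=i^{|\mathbf n|-m}\int_{(\mathbb R+i0)^m}\frac{e^{-ip_1w_1}}{\mathfrak{sh}(\pi p_1)}\frac{dp_1}{p_1^{n_1}}\wedge\dots\wedge\frac{e^{-i(p_1+\dots+p_m)w_m}}{\mathfrak{sh}(\pi p_m)}\frac{dp_m}{(p_1+\dots+p_m)^{n_m}},$$ where the $k$-th factor of the integrand is $\dfrac{e^{-i(p_1+\dots+p_k)w_k}}{\mathfrak{sh}(\pi p_k)}\dfrac{dp_k}{(p_1+\dots+p_k)^{n_k}}$.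
   Context: $\mathfrak{sh}(x)=e^{x}-e^{-x}$. The multiple polylogarithm is the power series, convergent for $|z_i|<1$, $$\mathrm{Li}_{n_1,\dots,n_m}(z_1,\dots,z_m)=\sum_{0<k_1<k_2<\dots<k_m}\frac{z_1^{k_1}\cdots z_m^{k_m}}{k_1^{n_1}\cdots k_m^{n_m}}.$$ The contour $\mathbb R+i0$ is the limit of the contour $\mathbb R+i\varepsilon$, $\varepsilon>0$, as $\varepsilon\to0$, and $(\mathbb R+i0)^m$ is its $m$-fold product.
   Formalization: For m ≥ 2 the integral can diverge under the stated hypotheses (e.g. m=2, Im w_1 = Im w_2 = 0.9π); the identity is proved whenever the integral converges absolutely for small ε, and this is proved when |Im(w_k+…+w_m)| < π for all k (automatic for m=1). *)

(* Defs.v *)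
From HB Require Import structures.
From mathcomp Require Import all_boot all_order all_algebra.
From mathcomp Require Import complex.
From mathcomp Require Import all_classical all_reals all_analysis.

Set Implicit Arguments.
Unset Strict Implicit.
Unset Printing Implicit Defensive.

Import Order.TTheory GRing.Theory Num.Theory.
Import numFieldNormedType.Exports.

Local Open Scope classical_set_scope.
Local Open Scope ring_scope.

(* Lebesgue measure on R^n, carried by n.-tuple R with its product
   sigma-algebra: the image of the n-fold product measure
   lebesgue \x (lebesgue \x ...) under the consing of coordinates. *)
Section measure_cons.
Local Open Scope ereal_scope.
Context d (T : measurableType d) (R : realType) (n : nat).
Variable m1 : {sigma_finite_measure set T -> \bar R}.
Variable m2 : {sigma_finite_measure set (n.-tuple T) -> \bar R}.

Definition cons_pair (x : T * n.-tuple T) : n.+1.-tuple T :=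
  [tuple of x.1 :: x.2].

Lemma measurable_cons_pair : measurable_fun [set: T * n.-tuple T] cons_pair.
Proof. exact: measurable_cons. Qed.

Definition measure_cons : set (n.+1.-tuple T) -> \bar R :=
  pushforward (m1 \x m2) cons_pair.

Let measure_cons0 : measure_cons set0 = 0.
Proof. by rewrite /measure_cons /pushforward preimage_set0 measure0. Qed.

Let measure_cons_ge0 A : 0 <= measure_cons A.
Proof. exact: (measure_ge0 (m1 \x m2)). Qed.

Let measure_cons_sigma_additive : semi_sigma_additive measure_cons.
Proof.
move=> F mF tF mUF; rewrite /measure_cons /pushforward preimage_bigcup.
apply: (measure_semi_sigma_additive (fun i => cons_pair @^-1` F i)).
- by move=> i; rewrite -[X in measurable X]setTI; exact: measurable_cons_pair.
- apply/trivIsetP => /= i j _ _ ij; rewrite -preimage_setI.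
  by move/trivIsetP : tF => /(_ _ _ _ _ ij) ->//; rewrite preimage_set0.
- rewrite -preimage_bigcup -[X in measurable X]setTI.
  exact: measurable_cons_pair.
Qed.

HB.instance Definition _ := isMeasure.Build _ _ _ measure_cons
  measure_cons0 measure_cons_ge0 measure_cons_sigma_additive.

Let measure_cons_sigma_finite : sigma_finite setT measure_cons.
Proof.
have /sigma_finiteP[F [TF ndF Foo]] := sigma_finiteT m1.
have /sigma_finiteP[G [TG ndG Goo]] := sigma_finiteT m2.
pose u (t : n.+1.-tuple T) : T * n.-tuple T := (thead t, [tuple of behead t]).
have uK : cancel cons_pair u.
  by case=> x t; rewrite /u /cons_pair/= theadE; congr pair; exact/val_inj.
have mu : measurable_fun setT u.
  apply/measurable_fun_pairP; split; last exact: measurable_behead.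
  exact: (@measurable_tnth _ _ _ ord0).
exists (fun i => u @^-1` (F i `*` G i)).
  apply/esym/seteqP; split=> // t _.
  have [a _ Fa] : (\bigcup_i F i) (u t).1 by rewrite -TF.
  have [b _ Gb] : (\bigcup_i G i) (u t).2 by rewrite -TG.
  exists (maxn a b) => //; split.
  - by move: Fa; exact/subsetPset/ndF/leq_maxl.
  - by move: Gb; exact/subsetPset/ndG/leq_maxr.
move=> i; have [mF Fioo] := Foo i; have [mG Gioo] := Goo i; split.
  by rewrite -[X in measurable X]setTI; apply: mu => //; exact: measurableX.
rewrite /measure_cons /pushforward -comp_preimage.
rewrite (_ : u \o cons_pair = id) ?preimage_id; last exact/funext.
by rewrite product_measure1E// lte_mul_pinfty// ge0_fin_numE.
Qed.

HB.instance Definition _ := Measure_isSigmaFinite.Build _ _ _ measure_cons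
  measure_cons_sigma_finite.

End measure_cons.

Fixpoint lebesgue_tuple (R : realType) (n : nat) :
    {sigma_finite_measure set (n.-tuple (measurableTypeR R)) -> \bar R} :=
  match n with
  | 0 => dirac [tuple]
  | k.+1 => measure_cons lebesgue_measure (lebesgue_tuple R k)
  end.

Section complex_integral.
Context d (T : measurableType d) (R : realType).
Variable mu : {measure set T -> \bar R}.
Implicit Type f : T -> R[i].

Definition cintegrable f : Prop :=
  mu.-integrable setT (fun x => (complex.Re (f x))%:E) /\
  mu.-integrable setT (fun x => (complex.Im (f x))%:E).

Definition cintegral f : R[i] :=
  Complex (\int[mu]_x complex.Re (f x)) (\int[mu]_x complex.Im (f x)).

End complex_integral.

(* Integration of f(p_1, ..., p_m) dp_1 /\ ... /\ dp_m over (R + i0)^m.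
   Limits of complex quantities are taken in (R[i])^o, the copy of R[i] on
   which the library puts the topology of the norm. *)
Section contour.
Variables (R : realType) (m : nat).
Implicit Types (f : ('I_m -> R[i]) -> R[i]) (e : R).

Definition on_contour f e (t : m.-tuple (measurableTypeR R)) : R[i] :=
  f (fun j => Complex (tnth t j) e).

Definition contour_integral_eps f e : (R[i])^o :=
  cintegral (lebesgue_tuple R m) (on_contour f e).

Definition contour_integrable f : Prop :=
  \forall e \near 0^'+, cintegrable (lebesgue_tuple R m) (on_contour f e).

Definition contour_integral f : R[i] :=
  lim (contour_integral_eps f e @[e --> 0^'+]).

End contour.

Section polylogarithm.
Variable R : realType.

Definition cexp (z : R[i]) : R[i] :=
  Complex (expR (complex.Re z) * cos (complex.Im z))
          (expR (complex.Re z) * sin (complex.Im z)).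

(* Twice the hyperbolic sine. *)
Definition sh (z : R[i]) : R[i] := cexp z - cexp (- z).

(* The finite part 0 < k_1 < ... < k_m < N of the multiple series; as the
   series converges absolutely for |z_i| < 1, the order of summation does not
   matter and [multi_li] takes the limit over N. *)
Definition multi_li_sum m (n : 'I_m -> int) (z : 'I_m -> R[i]) (N : nat) :
    (R[i])^o :=
  \sum_(k : {ffun 'I_m -> 'I_N} |
        [forall i : 'I_m, (0 < k i)%N] &&
        [forall i : 'I_m, forall j : 'I_m, (i < j)%N ==> (k i < k j)%N])
    \prod_(i < m) (z i ^+ k i / (k i)%:R ^ n i).

Definition multi_li m (n : 'I_m -> int) (z : 'I_m -> R[i]) : R[i] :=
  limn (multi_li_sum n z).

Definition partial_sum m (p : 'I_m -> R[i]) (k : 'I_m) : R[i] :=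
  \sum_(j < m | (j <= k)%N) p j.

Definition li_integrand m (n : 'I_m -> int) (w p : 'I_m -> R[i]) : R[i] :=
  \prod_(k < m)
    (cexp (- ('i%C * partial_sum p k * w k)) / sh ((pi : R)%:C%C * p k)
     / partial_sum p k ^ n k).

(* (e^{w_1}, ..., e^{w_{m-1}}, - e^{w_m}) *)
Definition li_arg m (w : 'I_m -> R[i]) (i : 'I_m) : R[i] :=
  if i.+1 == m then - cexp (w i) else cexp (w i).

End polylogarithm.

(* Main.v *)
Require Import Defs.
From HB Require Import structures.
From mathcomp Require Import all_boot all_order all_algebra.
From mathcomp Require Import complex.
From mathcomp Require Import all_classical all_reals all_analysis.
From mathcomp Require Import measurable_realfun gauss_integral ring lra.

(** Expanding every [1 / sh (pi p_k)] by residues in the upper half plane is what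
    makes the theorem true: the poles are [p_k = i l_k] with [l_k >= 1], the
    residue there is [(-1)^(l_k) / (2 pi)], and with [k_j = l_1 + ... + l_j] the
    residues of the integrand are, up to the power of [i] in the statement, the
    terms of the polylogarithm.

    The residues are taken one at a time. Since [sh (pi (p + i)) = - sh (pi p)],
    for [G] holomorphic of exponential rate less than [pi] the contour can be
    raised from [Im p = e] to [Im p = 1 + e], across the single pole [i], which
    gives
      [int G(p) / sh (pi p) + int G(p + i) / sh (pi p) = - i G(i)]
    ([admissible_residue]). To avoid small circles, [G(i)] is subtracted from
    [G], so that the quotient stays bounded near [i] and its integral over
    [Im p = y] is a continuous function of [y] with zero derivative for [y <> 1]
    ([contour_shift]); the constant [G(i)] contributes the integral of
    [1 / sh (pi p)], computed at height [1/2] ([cintegral_inv_sh]).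

    Let [I_m(c)] be the [m]-fold integral in which every partial sum
    [p_1 + ... + p_k] is translated by [i c], with [c] a natural number. The
    residue step in the first variable and Fubini express [I_m(c) + I_m(c + 1)]
    through the [(m-1)]-fold integral at [c + 1] ([li_int_rec]). The tails
    [c < k_1 < ... < k_m < N] of the truncated series satisfy the same recursion,
    and [I_m(c)] decreases exponentially in [c], the real parts of the [w_k]
    being negative. Hence the truncated series differs from the integral by
    [O(r^N)] with [r < 1] ([li_int_norm_sum]). This holds at every small height
    [e], so the limit [e -> 0] is that of a constant.

    The residue step requires [|Im (w_k + ... + w_m)| < pi] for all [k]; up to
    powers, the modulus of the integrand is a product of functions
    [exp (x Im (w_k + ... + w_m) - pi |x|)] of the real parts [x] of the [p_k]
    ([li_off_size]), so this condition implies absolute convergence. Conversely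
    absolute convergence implies the weak inequalities ([tail_Im_le]). In the
    boundary case the imaginary parts of the [w_k] are multiplied by [t < 1] and
    [t] tends to 1: by convexity of the exponential the integrands are dominated
    by the sum of those at [t = 0] and [t = 1] ([normc_li_off_flatten]), and the
    convergence of the truncated series is uniform in [t] because the moduli of
    its terms do not depend on [t] ([li_sum_cauchy]). *)

Set Implicit Arguments.
Unset Strict Implicit.
Unset Printing Implicit Defensive.

Import Order.TTheory GRing.Theory Num.Theory.
Import numFieldNormedType.Exports.
Import Normc.

Local Open Scope classical_set_scope.
Local Open Scope ring_scope.

Local Notation Re := complex.Re.
Local Notation Im := complex.Im.

(** * Complex arithmetic and the exponential *)

Section complex_numbers.
Context {R : realType}.
Implicit Types (x y t : R) (z w p : R[i]).

Lemma complexP z w : Re z = Re w -> Im z = Im w -> z = w.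
Proof. by case: z => a b; case: w => c d /= -> ->. Qed.

Lemma ReD z w : Re (z + w) = Re z + Re w.
Proof. by case: z; case: w. Qed.

Lemma ImD z w : Im (z + w) = Im z + Im w.
Proof. by case: z; case: w. Qed.

Lemma ReN z : Re (- z) = - Re z.
Proof. by case: z. Qed.

Lemma ImN z : Im (- z) = - Im z.
Proof. by case: z. Qed.

Lemma ReM z w : Re (z * w) = Re z * Re w - Im z * Im w.
Proof. by case: z; case: w. Qed.

Lemma ImM z w : Im (z * w) = Re z * Im w + Im z * Re w.
Proof. by case: z => a b; case: w => c d /=; rewrite [b * c]mulrC. Qed.

Lemma ReV z : Re z^-1 = Re z / (Re z ^+ 2 + Im z ^+ 2).
Proof. by case: z. Qed.

Lemma ImV z : Im z^-1 = - (Im z / (Re z ^+ 2 + Im z ^+ 2)).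
Proof. by case: z. Qed.

Lemma Re0 : Re (0 : R[i]) = 0. Proof. by []. Qed.
Lemma Im0 : Im (0 : R[i]) = 0. Proof. by []. Qed.
Lemma Re1 : Re (1 : R[i]) = 1. Proof. by []. Qed.
Lemma Im1 : Im (1 : R[i]) = 0. Proof. by []. Qed.

Lemma ReR x : Re x%:C%C = x. Proof. by []. Qed.
Lemma ImR x : Im x%:C%C = 0. Proof. by []. Qed.
Lemma Rei : Re ('i%C : R[i]) = 0. Proof. by []. Qed.
Lemma Imi : Im ('i%C : R[i]) = 1. Proof. by []. Qed.

Definition ReIm := (ReD, ImD, ReN, ImN, ReM, ImM, Re0, Im0, Re1, Im1, ReR, ImR,
  Rei, Imi).

Lemma Re_natr n : Re (n%:R : R[i]) = n%:R.
Proof. by elim: n => // n IH; rewrite !mulrS ReD IH. Qed.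

Lemma Im_natr n : Im (n%:R : R[i]) = 0.
Proof. by elim: n => // n IH; rewrite !mulrS ImD IH addr0. Qed.

Lemma Re_sum I (r : seq I) (P : pred I) (F : I -> R[i]) :
  Re (\sum_(i <- r | P i) F i) = \sum_(i <- r | P i) Re (F i).
Proof. by elim/big_rec2: _ => // i a b _ <-; rewrite ReD. Qed.

Lemma Im_sum I (r : seq I) (P : pred I) (F : I -> R[i]) :
  Im (\sum_(i <- r | P i) F i) = \sum_(i <- r | P i) Im (F i).
Proof. by elim/big_rec2: _ => // i a b _ <-; rewrite ImD. Qed.

Lemma normcE z : normc z = Num.sqrt (Re z ^+ 2 + Im z ^+ 2).
Proof. by case: z. Qed.

Lemma normcE_norm z : `|z| = (normc z)%:C%C.
Proof. by rewrite normc_def normcE. Qed.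

Lemma normc_ge0 z : 0 <= normc z.
Proof. by rewrite normcE sqrtr_ge0. Qed.

Lemma sqr_normc z : normc z ^+ 2 = Re z ^+ 2 + Im z ^+ 2.
Proof. by rewrite normcE sqr_sqrtr// addr_ge0 ?sqr_ge0. Qed.

Lemma normc_eq0 z : (normc z == 0) = (z == 0).
Proof. by apply/eqP/eqP => [/eq0_normc|->] //; rewrite normc0. Qed.

Lemma normc_gt0 z : z != 0 -> 0 < normc z.
Proof. by rewrite lt_def normc_ge0 normc_eq0 => ->. Qed.

Lemma Re_le_normc z : `|Re z| <= normc z.
Proof.
by rewrite -(@ler_sqr _ `|_|) ?nnegrE ?normc_ge0// sqr_normc real_normK ?num_real// lerDl sqr_ge0.
Qed.

Lemma Im_le_normc z : `|Im z| <= normc z.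
Proof.
by rewrite -(@ler_sqr _ `|_|) ?nnegrE ?normc_ge0// sqr_normc real_normK ?num_real// lerDr sqr_ge0.
Qed.

Lemma normcR x : normc x%:C%C = `|x|.
Proof. by rewrite normcE /= expr0n addr0 sqrtr_sqr. Qed.

Lemma normci : normc ('i%C : R[i]) = 1.
Proof. by rewrite normcE /= expr0n add0r expr1n sqrtr1. Qed.

Lemma ler_normcD z w : normc (z + w) <= normc z + normc w.
Proof. exact: le_normcD. Qed.

Lemma ler_normcB z w : normc (z - w) <= normc z + normc w.
Proof. by rewrite -[normc w]normcN ler_normcD. Qed.

Lemma normc_le_ReIm z : normc z <= `|Re z| + `|Im z|.
Proof.
by rewrite {1}[z]complexE (le_trans (ler_normcD _ _))// normcM normci mul1r !normcR.
Qed.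

Lemma normcX z n : normc (z ^+ n) = normc z ^+ n.
Proof. by elim: n => [|n IH]; rewrite ?normc1// !exprS normcM IH. Qed.

Lemma normcXz z (n : int) : normc (z ^ n) = normc z ^ n.
Proof.
by case: n => n; rewrite ?NegzE -?exprnP -?exprnN ?normcV ?normcX.
Qed.

Lemma normc_prod I (r : seq I) (P : pred I) (F : I -> R[i]) :
  normc (\prod_(i <- r | P i) F i) = \prod_(i <- r | P i) normc (F i).
Proof. by elim/big_rec2: _ => [|i a b _ <-]; rewrite ?normc1// normcM. Qed.

Lemma normc_sum I (r : seq I) (P : pred I) (F : I -> R[i]) :
  normc (\sum_(i <- r | P i) F i) <= \sum_(i <- r | P i) normc (F i).
Proof.
elim/big_rec2: _ => [|i a b _ h]; first by rewrite normc0.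
by rewrite (le_trans (ler_normcD _ _))// lerD2l.
Qed.

Lemma normcn n : normc (n%:R : R[i]) = n%:R.
Proof.
by rewrite normcE Re_natr Im_natr expr0n addr0 sqrtr_sqr normr_nat.
Qed.

Lemma Re_cexp z : Re (cexp z) = expR (Re z) * cos (Im z). Proof. by []. Qed.
Lemma Im_cexp z : Im (cexp z) = expR (Re z) * sin (Im z). Proof. by []. Qed.

Lemma cexpD z w : cexp (z + w) = cexp z * cexp w.
Proof.
apply: complexP; rewrite !(Re_cexp, Im_cexp, ReIm) expRD ?cosD ?sinD; ring.
Qed.

Lemma cexp0 : cexp (0 : R[i]) = 1.
Proof. by apply: complexP; rewrite !(Re_cexp, Im_cexp, ReIm) expR0 ?cos0 ?sin0 mul1r. Qed.

Lemma normc_cexp z : normc (cexp z) = expR (Re z).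
Proof.
rewrite normcE Re_cexp Im_cexp !exprMn -mulrDr cos2Dsin2 mulr1 sqrtr_sqr.
by rewrite ger0_norm// expR_ge0.
Qed.

Lemma cexp_neq0 z : cexp z != 0.
Proof. by rewrite -normc_eq0 normc_cexp expR_eq0. Qed.

Lemma cexpN z : cexp (- z) = (cexp z)^-1.
Proof.
apply: (mulfI (cexp_neq0 z)).
by rewrite -cexpD subrr cexp0 divff// cexp_neq0.
Qed.

Lemma cexpMn n z : cexp (n%:R * z) = cexp z ^+ n.
Proof.
elim: n => [|n IH]; first by rewrite mul0r cexp0.
by rewrite mulrS mulrDl mul1r cexpD IH exprS.
Qed.

Lemma cexp_pi_i : cexp (pi%:C%C * 'i%C : R[i]) = -1.
Proof.
apply: complexP; rewrite !(Re_cexp, Im_cexp, ReIm)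
  !(mul0r, mulr0, mulr1, subr0, oppr0, addr0, add0r).
  by rewrite expR0 mul1r cospi.
by rewrite expR0 mul1r sinpi.
Qed.

Lemma sh_piDi p : sh (pi%:C%C * (p + 'i%C)) = - sh (pi%:C%C * p).
Proof.
by rewrite /sh mulrDr opprD !cexpD cexp_pi_i [cexp (- (_ * 'i%C))]cexpN cexp_pi_i; field.
Qed.

Definition ch z := cexp z + cexp (- z).

(** Since [sh] is twice the hyperbolic sine, this is the classical
    [|sinh (a + ib)|^2 = sinh^2 a + sin^2 b]; all bounds on [1 / sh] rest on it. *)
Lemma sqr_normc_sh z :
  normc (sh z) ^+ 2 = (expR (Re z) - expR (- Re z)) ^+ 2 + 4 * sin (Im z) ^+ 2.
Proof.
rewrite sqr_normc /sh !(Re_cexp, Im_cexp, ReIm) cosN sinN.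
have := cos2Dsin2 (Im z); have := expRxMexpNx_1 (Re z).
set a := expR _; set b := expR _; set c := cos _; set s := sin _ => ab cs.
transitivity ((a - b) ^+ 2 * (c ^+ 2 + s ^+ 2) + 4 * (a * b) * s ^+ 2); first ring.
by rewrite ab cs; ring.
Qed.
End complex_numbers.

(** * The size of sh *)

Section bounds.
Context {R : realType}.
Implicit Types (x y t : R) (z w p : R[i]).

Lemma pi_lt4 : (pi : R) < 4.
Proof. have := @pihalf_lt2 R; lra. Qed.

(** Absorbs polynomial factors into an arbitrarily small exponential rate; from
    the Taylor bound [expR y >= y^(N+1) / (N+1)!]. *)
Lemma poly_le_expR (N : nat) (d : R) : 0 < d ->
  exists2 C : R, 0 < C & forall t, 0 <= t -> (1 + t) ^+ N <= C * expR (d * t).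
Proof.
move=> d0; exists (N.+1`!%:R * d ^- N.+1 * expR d) => [|t t0].
  by rewrite !mulr_gt0// ?expR_gt0// ?ltr0n ?fact_gt0// invr_gt0 exprn_gt0.
have t1 : 0 <= 1 + t by rewrite addr_ge0.
have dt0 : 0 <= d * (1 + t) by rewrite mulr_ge0 // ltW.
have := expR_ge1Dxn N dt0; rewrite mulrDr mulr1 expRD => h.
rewrite (@le_trans _ _ ((1 + t) ^+ N.+1))//.
  by rewrite ler_weXn2l// lerDl.
have {}h : (d + d * t) ^+ N.+1 / N.+1`!%:R <= expR d * expR (d * t).
  by rewrite (le_trans _ h)// lerDr.
move: h; rewrite ler_pdivrMr ?ltr0n ?fact_gt0//.
rewrite -{1}[d]mulr1 -mulrDr exprMn => h.
rewrite -(ler_pM2l (exprn_gt0 N.+1 d0)) (le_trans h)// le_eqVlt.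
apply/orP; left; apply/eqP; move: (d ^+ N.+1) (exprn_gt0 N.+1 d0) => D D0.
by field; rewrite gt_eqF.
Qed.

Lemma expR_le_abs x : expR x <= expR `|x|.
Proof. by rewrite ler_expR ler_norm. Qed.

Lemma expRN_le_abs x : expR (- x) <= expR `|x|.
Proof. by rewrite ler_expR -normrN ler_norm. Qed.

Lemma expR_abs_le x : expR `|x| <= expR x + expR (- x).
Proof.
case: (lerP 0 x) => x0.
  by rewrite ger0_norm// lerDl expR_ge0.
by rewrite ltr0_norm// lerDr expR_ge0.
Qed.

Lemma normc_sh_le z : normc (sh z) <= 2 * expR `|Re z|.
Proof.
rewrite (le_trans (ler_normcB _ _))// !normc_cexp ReN.
by have := expR_le_abs (Re z); have := expRN_le_abs (Re z); lra.
Qed.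

Lemma normc_ch_le z : normc (ch z) <= 2 * expR `|Re z|.
Proof.
rewrite (le_trans (ler_normcD _ _))// !normc_cexp ReN.
by have := expR_le_abs (Re z); have := expRN_le_abs (Re z); lra.
Qed.

(** With [s <= 1], [sinh^2 + s^2 >= s^2 cosh^2]. *)
Lemma normc_sh_ge_sin (s : R) z : 0 <= s <= 1 -> s <= `|sin (Im z)| ->
  s * expR `|Re z| <= normc (sh z).
Proof.
move=> /andP[s0 s1] ss.
rewrite -(@ler_sqr _ _ (normc _)) ?nnegrE ?normc_ge0 ?mulr_ge0 ?expR_ge0//.
rewrite sqr_normc_sh exprMn.
have ss2 : s ^+ 2 <= sin (Im z) ^+ 2.
  by rewrite -[sin _ ^+ 2]real_normK ?num_real// ler_sqr ?nnegrE.
have s2 : s ^+ 2 <= 1 by rewrite expr_le1.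
have h : expR `|Re z| ^+ 2 <= (expR (Re z) - expR (- Re z)) ^+ 2 + 4.
  rewrite (@le_trans _ _ ((expR (Re z) + expR (- Re z)) ^+ 2))//.
    by rewrite ler_sqr ?nnegrE ?addr_ge0 ?expR_ge0// expR_abs_le.
  by have := expRxMexpNx_1 (Re z); move: (expR _) (expR _) => a b ab; nra.
rewrite (le_trans (ler_wpM2l (sqr_ge0 s) h))//.
have := sqr_ge0 (expR (Re z) - expR (- Re z)).
by move: ((expR _ - _) ^+ 2) => u u0; nra.
Qed.

Lemma normc_sh_ge_Re z : `|expR (Re z) - expR (- Re z)| <= normc (sh z).
Proof.
rewrite -(@ler_sqr _ `|_|) ?nnegrE ?normc_ge0// sqr_normc_sh.
by rewrite real_normK ?num_real// lerDl mulr_ge0// sqr_ge0.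
Qed.

Lemma normc_sh_ge_far z : 1 <= `|Re z| -> expR `|Re z| / 2 <= normc (sh z).
Proof.
move=> x1; apply: le_trans (normc_sh_ge_Re z).
wlog x0 : z x1 / 0 <= Re z => [hw|].
  case: (lerP 0 (Re z)) => [/hw|/ltW x0]; first by apply.
  by have := hw (- z); rewrite ReN normrN opprK distrC oppr_ge0; apply.
rewrite ger0_norm// in x1 *.
have h : expR (- Re z) <= expR (Re z) / 2.
  rewrite ler_pdivlMr// mulrC.
  rewrite -(ler_pM2l (expR_gt0 (Re z))) mulrCA expRxMexpNx_1 mulr1.
  by have := expR_ge1Dx (Re z) => h; nra.
by rewrite (le_trans _ (ler_norm _))//; lra.
Qed.

Lemma sin_ge_near y : `|y| <= 1 -> cos 1 * `|y| <= `|sin y|.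
Proof.
wlog y0 : y / 0 <= y => [hw|].
  case: (leP 0 y) => [/hw//|/ltW y0 y1].
  by have := hw (- y); rewrite sinN !normrN oppr_ge0; apply.
rewrite ger0_norm// => y1.
move: y0; rewrite le_eqVlt => /predU1P[<-|y0]; first by rewrite mulr0.
have [|c cy] := @MVT _ (@sin R) (@cos R) 0 y y0.
  by apply: continuous_subspaceT => ?; exact: continuous_sin.
rewrite sin0 !subr0 => ->.
rewrite (le_trans _ (ler_norm _))// ler_wpM2r// ?ltW//.
move: cy; rewrite in_itv/= => /andP[c0 cy].
have := @pi_ge2 R => ?.
rewrite ltr_cos ?in_itv/= ?(lt_le_trans cy y1)//; apply/andP; split; lra.
Qed.

(** The zero of [sh] at the origin is simple: this is what a quotient with a
    numerator vanishing at the pole can absorb. *)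
Lemma normc_sh_ge_near : exists2 C : R, 0 < C &
  forall z, `|Im z| <= 1 -> normc z <= C * normc (sh z).
Proof.
have c0 := @cos1_gt0 R.
exists (1 + (2 * cos 1)^-1) => [|z z1].
  by rewrite addr_gt0// invr_gt0 mulr_gt0.
rewrite (le_trans (normc_le_ReIm z))// mulrDl mul1r lerD//.
  apply: le_trans (normc_sh_ge_Re z).
  wlog x0 : z z1 / 0 <= Re z => [hw|].
    case: (lerP 0 (Re z)) => [/hw|/ltW x0]; first by apply.
    by have := hw (- z); rewrite ReN ImN !normrN opprK distrC oppr_ge0; apply.
  rewrite ger0_norm// (le_trans _ (ler_norm _))//.
  have := expR_ge1Dx (Re z).
  have : expR (- Re z) <= 1 by rewrite expR_le1 oppr_le0.
  lra.
rewrite ler_pdivlMl ?mulr_gt0//.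
apply: (@le_trans _ _ (2 * `|sin (Im z)|)).
  by rewrite -mulrA ler_pM2l// sin_ge_near.
rewrite -(@ler_sqr _ _ (normc _)) ?nnegrE ?normc_ge0 ?mulr_ge0// sqr_normc_sh.
by rewrite exprMn real_normK ?num_real// -natrX lerDr sqr_ge0.
Qed.

End bounds.

(** * Derivatives of complex curves *)

Section curves.
Context {R : realType}.
Implicit Types (f g : R -> R[i]) (t : R) (a d v : R[i]).

(** Holomorphy is only ever used along real curves, so the derivative is that of
    the two real components along a parameter. *)
Definition cderiv f t d : Prop :=
  is_derive t 1 (fun u => Re (f u)) (Re d) /\
  is_derive t 1 (fun u => Im (f u)) (Im d).

Lemma cderiv_eq f t d d' : cderiv f t d -> d = d' -> cderiv f t d'.
Proof. by move=> h <-. Qed.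

Lemma cderiv_ext f g t d : f =1 g -> cderiv f t d -> cderiv g t d.
Proof. by move/funext => ->. Qed.

Lemma cderiv_cst a t : cderiv (fun=> a) t 0.
Proof. by split; exact: is_derive_cst. Qed.

Lemma cderiv_line a v t : cderiv (fun u => a + u%:C%C * v) t v.
Proof.
split.
  have -> : (fun u : R => Re (a + u%:C%C * v)) = (cst (Re a) + Re v *: id).
    by apply/funext => u; rewrite !ReIm mul0r subr0 /= mulrC.
  have h := is_deriveD (is_derive_cst (Re a) t 1) (is_deriveZ (Re v) (is_derive_id t 1)).
  by apply: (is_derive_eq h); rewrite add0r /GRing.scale/= mulr1.
have -> : (fun u : R => Im (a + u%:C%C * v)) = (cst (Im a) + Im v *: id).
  by apply/funext => u; rewrite !ReIm mul0r addr0 /= mulrC.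
have h := is_deriveD (is_derive_cst (Im a) t 1) (is_deriveZ (Im v) (is_derive_id t 1)).
by apply: (is_derive_eq h); rewrite add0r /GRing.scale/= mulr1.
Qed.

Lemma cderivD f g t df dg : cderiv f t df -> cderiv g t dg ->
  cderiv (fun u => f u + g u) t (df + dg).
Proof.
move=> [f1 f2] [g1 g2]; split.
  rewrite (_ : (fun u => _) = (fun u => Re (f u)) + (fun u => Re (g u))); last first.
    by apply/funext => u; rewrite ReD.
  by rewrite ReD; exact: is_deriveD.
rewrite (_ : (fun u => _) = (fun u => Im (f u)) + (fun u => Im (g u))); last first.
  by apply/funext => u; rewrite ImD.
by rewrite ImD; exact: is_deriveD.
Qed.

Lemma cderivM f g t df dg : cderiv f t df -> cderiv g t dg ->
  cderiv (fun u => f u * g u) t (df * g t + f t * dg).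
Proof.
move=> [f1 f2] [g1 g2]; split.
  rewrite (_ : (fun u => _) = (fun u => Re (f u)) * (fun u => Re (g u))
     - (fun u => Im (f u)) * (fun u => Im (g u))); last first.
    by apply/funext => u; rewrite ReM.
  apply: (is_derive_eq (is_deriveB (is_deriveM f1 g1) (is_deriveM f2 g2))).
  by rewrite !ReIm /GRing.scale/=; ring.
rewrite (_ : (fun u => _) = (fun u => Re (f u)) * (fun u => Im (g u))
     + (fun u => Im (f u)) * (fun u => Re (g u))); last first.
  by apply/funext => u; rewrite ImM.
apply: (is_derive_eq (is_deriveD (is_deriveM f1 g2) (is_deriveM f2 g1))).
by rewrite !ReIm /GRing.scale/=; ring.
Qed.

Lemma cderivZ a f t df : cderiv f t df -> cderiv (fun u => a * f u) t (a * df).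
Proof.
by move=> h; apply: cderiv_eq (cderivM (cderiv_cst a t) h) _; rewrite mul0r add0r.
Qed.

Lemma cderivN f t df : cderiv f t df -> cderiv (fun u => - f u) t (- df).
Proof.
move=> h; apply: (cderiv_ext (f := fun u => -1 * f u)) => [u|].
  by rewrite mulN1r.
by apply: cderiv_eq (cderivZ (-1) h) _; rewrite mulN1r.
Qed.

Lemma cderivB f g t df dg : cderiv f t df -> cderiv g t dg ->
  cderiv (fun u => f u - g u) t (df - dg).
Proof. by move=> hf hg; apply: cderivD => //; exact: cderivN. Qed.

Lemma Re2Im2_neq0 (z : R[i]) : z != 0 -> Re z ^+ 2 + Im z ^+ 2 != 0.
Proof. by move=> z0; rewrite -sqr_normc expf_neq0// normc_eq0. Qed.

Lemma cderivV f t df : f t != 0 -> cderiv f t df ->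
  cderiv (fun u => (f u)^-1) t (- (df / f t ^+ 2)).
Proof.
move=> /Re2Im2_neq0 n0 [f1 f2].
pose n u := Re (f u) ^+ 2 + Im (f u) ^+ 2.
have hn : is_derive t 1 (fun u => (n u)^-1)
    (- (n t) ^- 2 *: (2 * (Re (f t) * Re df + Im (f t) * Im df))).
  apply: is_deriveV => //.
  rewrite (_ : n = (fun u => Re (f u)) * (fun u => Re (f u)) +
    (fun u => Im (f u)) * (fun u => Im (f u))); last first.
    by apply/funext => u; rewrite /n !expr2.
  apply: (is_derive_eq (is_deriveD (is_deriveM f1 f1) (is_deriveM f2 f2))).
  by rewrite /GRing.scale/=; ring.
have -> : df / f t ^+ 2 = df * (f t)^-1 * (f t)^-1.
  by rewrite expr2 invfM mulrA.
split.
  rewrite (_ : (fun u => _) = (fun u => Re (f u)) * (fun u => (n u)^-1)); last first.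
    by apply/funext => u; rewrite ReV.
  apply: is_derive_eq; rewrite !(ReIm, ReV, ImV) /GRing.scale/=.
  by rewrite /n; field.
rewrite (_ : (fun u => _) = - ((fun u => Im (f u)) * (fun u => (n u)^-1))); last first.
  by apply/funext => u; rewrite ImV.
apply: is_derive_eq; rewrite !(ReIm, ReV, ImV) /GRing.scale/=.
by rewrite /n; field.
Qed.

Lemma cderiv_cexp f t df : cderiv f t df ->
  cderiv (fun u => cexp (f u)) t (df * cexp (f t)).
Proof.
move=> [f1 f2]; split.
  rewrite (_ : (fun u => _) = (expR \o (fun u => Re (f u))) *
    (cos \o (fun u => Im (f u)))); last by apply/funext.
  by apply: is_derive_eq; rewrite !(Re_cexp, Im_cexp, ReIm) /GRing.scale/=; ring.
rewrite (_ : (fun u => _) = (expR \o (fun u => Re (f u))) *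
  (sin \o (fun u => Im (f u)))); last by apply/funext.
by apply: is_derive_eq; rewrite !(Re_cexp, Im_cexp, ReIm) /GRing.scale/=; ring.
Qed.

Lemma cderiv_sh f t df : cderiv f t df ->
  cderiv (fun u => sh (f u)) t (df * ch (f t)).
Proof.
move=> h; apply: cderiv_eq (cderivB (cderiv_cexp h) (cderiv_cexp (cderivN h))) _.
by rewrite mulNr opprK -mulrDr.
Qed.

Lemma cderivX f t df n : cderiv f t df ->
  cderiv (fun u => f u ^+ n) t (n%:R * f t ^+ n.-1 * df).
Proof.
move=> h; elim: n => [|n IH].
  by rewrite !mul0r; apply: cderiv_ext (cderiv_cst 1 t) => u.
apply: (cderiv_ext (f := fun u => f u * f u ^+ n)) => [u|]; first by rewrite exprS.
apply: cderiv_eq (cderivM h IH) _.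
case: n {IH} => [|n] /=; first by rewrite expr0; ring.
by rewrite exprS -[n.+2%:R]natr1; ring.
Qed.

Lemma cderivXz f t df (n : int) : f t != 0 -> cderiv f t df ->
  cderiv (fun u => f u ^ n) t (f t ^ n * (n%:~R * (df / f t))).
Proof.
move=> f0 h; case: n => n.
  apply: cderiv_eq (cderivX n h) _; rewrite -exprnP -pmulrn.
  case: n => [|n]; first by rewrite !mul0r mulr0.
  by rewrite exprS /=; field.
apply: (cderiv_ext (f := fun u => (f u ^+ n.+1)^-1)) => [u|].
  by rewrite NegzE -exprnN.
apply: cderiv_eq (cderivV _ (cderivX n.+1 h)) _; first by rewrite expf_neq0.
rewrite NegzE -exprnN mulrNz -pmulrn /= (exprS (f t) n).
have fn0 : f t ^+ n != 0 by rewrite expf_neq0.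
by move: (f t ^+ n) fn0 => F F0; field; rewrite f0 F0.
Qed.

Lemma cderiv_Re_continuous f t d : cderiv f t d ->
  {for t, continuous (fun u => Re (f u))}.
Proof.
by move=> [h _]; apply/differentiable_continuous/derivable1_diffP; case: h.
Qed.

Lemma cderiv_Im_continuous f t d : cderiv f t d ->
  {for t, continuous (fun u => Im (f u))}.
Proof.
by move=> [_ h]; apply/differentiable_continuous/derivable1_diffP; case: h.
Qed.

Lemma real_MVT_le (f df : R -> R) (K : R) :
  (forall s : R, 0 <= s <= 1 -> is_derive s 1 f (df s)) ->
  (forall s : R, 0 <= s <= 1 -> `|df s| <= K) -> `|f 1 - f 0| <= K.
Proof.
move=> hf hK.
have h (x : R) : x \in `]0, 1[ -> is_derive x 1 f (df x).
  by rewrite in_itv/= => /andP[/ltW x0 /ltW x1]; apply: hf; rewrite x0.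
have [|c] := MVT_segment ler01 h.
  apply: derivable_within_continuous => s; rewrite in_itv/= => s01.
  by have [] := hf _ s01.
by rewrite in_itv/= => c01 ->; rewrite subr0 mulr1 hK.
Qed.

(** The mean value theorem fails for complex values; applying it to both
    components costs the factor 2. *)
Lemma cderiv_le f (df : R -> R[i]) K :
  (forall s : R, 0 <= s <= 1 -> cderiv f s (df s)) ->
  (forall s : R, 0 <= s <= 1 -> normc (df s) <= K) -> normc (f 1 - f 0) <= 2 * K.
Proof.
move=> hf hK; rewrite (le_trans (normc_le_ReIm _))// mulr_natl mulr2n !ReIm lerD//.
  apply: (@real_MVT_le (fun u => Re (f u)) (fun u => Re (df u))) => s s01.
    by have [] := hf _ s01.
  by rewrite (le_trans (Re_le_normc _))// hK.
apply: (@real_MVT_le (fun u => Im (f u)) (fun u => Im (df u))) => s s01.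
  by have [] := hf _ s01.
by rewrite (le_trans (Im_le_normc _))// hK.
Qed.

End curves.

(** * Complex-valued integrals *)

Section complex_measurable.
Context d (T : measurableType d) {R : realType}.
Implicit Types (f g : T -> R[i]) (h : T -> R).

Definition cmeasurable f : Prop :=
  measurable_fun setT (fun x => Re (f x)) /\
  measurable_fun setT (fun x => Im (f x)).

Lemma cmeasurable_cst a : cmeasurable (fun=> a).
Proof. by split; exact: measurable_cst. Qed.

Lemma cmeasurableD f g : cmeasurable f -> cmeasurable g ->
  cmeasurable (fun x => f x + g x).
Proof.
move=> [f1 f2] [g1 g2]; split.
  by under eq_fun do rewrite ReD; exact: measurable_funD.
by under eq_fun do rewrite ImD; exact: measurable_funD.
Qed.

Lemma cmeasurableM f g : cmeasurable f -> cmeasurable g ->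
  cmeasurable (fun x => f x * g x).
Proof.
move=> [f1 f2] [g1 g2]; split.
  under eq_fun do rewrite ReM.
  by apply: measurable_funB; exact: measurable_funM.
under eq_fun do rewrite ImM.
by apply: measurable_funD; exact: measurable_funM.
Qed.

Lemma cmeasurableN f : cmeasurable f -> cmeasurable (fun x => - f x).
Proof.
move=> mf; rewrite (_ : (fun _ => _) = fun x => -1 * f x).
  by apply: cmeasurableM => //; exact: cmeasurable_cst.
by apply/funext => x; rewrite mulN1r.
Qed.

(** The components are quotients by [|f|^2 >= 0], and [x |-> x `^ -1] is measurable
    and agrees with the inverse on nonnegative reals, [0] included. *)
Lemma cmeasurableV f : cmeasurable f -> cmeasurable (fun x => (f x)^-1).
Proof.
move=> [f1 f2].
have mn : measurable_fun setT (fun x => (Re (f x) ^+ 2 + Im (f x) ^+ 2)^-1).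
  rewrite (_ : (fun _ => _) =
    (@powR R ^~ (-1)) \o (fun x => Re (f x) ^+ 2 + Im (f x) ^+ 2)).
    apply: measurableT_comp; first exact: measurable_powR.
    by apply: measurable_funD; exact: measurable_funX.
  by apply/funext => x /=; rewrite powR_inv1// addr_ge0// sqr_ge0.
split.
  by under eq_fun do rewrite ReV; exact: measurable_funM.
under eq_fun do rewrite ImV.
by apply: measurable_funN; exact: measurable_funM.
Qed.

Lemma cmeasurableX f n : cmeasurable f -> cmeasurable (fun x => f x ^+ n).
Proof.
move=> mf; elim: n => [|n IH].
  by under eq_fun do rewrite expr0; exact: cmeasurable_cst.
by under eq_fun do rewrite exprS; exact: cmeasurableM.
Qed.

Lemma cmeasurableXz f (n : int) : cmeasurable f ->
  cmeasurable (fun x => f x ^ n).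
Proof.
move=> mf; case: n => n; first exact: cmeasurableX.
by apply: cmeasurableV; exact: cmeasurableX.
Qed.

Lemma cmeasurable_cexp f : cmeasurable f -> cmeasurable (fun x => cexp (f x)).
Proof.
move=> [f1 f2]; split.
  rewrite (_ : (fun _ => _) = fun x => expR (Re (f x)) * cos (Im (f x)))//.
  apply: measurable_funM; first exact: measurableT_comp.
  apply: measurableT_comp f2.
  by apply: continuous_measurable_fun; exact: continuous_cos.
rewrite (_ : (fun _ => _) = fun x => expR (Re (f x)) * sin (Im (f x)))//.
apply: measurable_funM; first exact: measurableT_comp.
apply: measurableT_comp f2.
by apply: continuous_measurable_fun; exact: continuous_sin.
Qed.

Lemma cmeasurable_sh f : cmeasurable f -> cmeasurable (fun x => sh (f x)).
Proof.
move=> mf; apply: cmeasurableD; first exact: cmeasurable_cexp.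
by apply: cmeasurableN; apply: cmeasurable_cexp; exact: cmeasurableN.
Qed.

Lemma cmeasurable_prod (I : Type) (r : seq I) (P : pred I) (F : I -> T -> R[i]) :
  (forall i, cmeasurable (F i)) ->
  cmeasurable (fun x => \prod_(i <- r | P i) F i x).
Proof.
move=> mF; elim: r => [|i r IH].
  by under eq_fun do rewrite big_nil; exact: cmeasurable_cst.
under eq_fun do rewrite big_cons.
by case: (P i) => //; exact: cmeasurableM.
Qed.

Lemma cmeasurable_sum (I : Type) (r : seq I) (P : pred I) (F : I -> T -> R[i]) :
  (forall i, cmeasurable (F i)) ->
  cmeasurable (fun x => \sum_(i <- r | P i) F i x).
Proof.
move=> mF; elim: r => [|i r IH].
  by under eq_fun do rewrite big_nil; exact: cmeasurable_cst.
under eq_fun do rewrite big_cons.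
by case: (P i) => //; exact: cmeasurableD.
Qed.

Lemma cmeasurable_Complex h (y : R) : measurable_fun setT h ->
  cmeasurable (fun x => Complex (h x) y).
Proof. by move=> mh; split => //=; exact: measurable_cst. Qed.

End complex_measurable.

Section complex_integral_theory.
Context d (T : measurableType d) {R : realType}.
Variable mu : {measure set T -> \bar R}.
Implicit Types (f : T -> R[i]) (g : T -> R).

Lemma integrable_dominated g h : measurable_fun setT g ->
  (forall x, `|g x| <= h x) -> mu.-integrable setT (EFin \o h) ->
  mu.-integrable setT (EFin \o g).
Proof.
move=> mg gh; apply: le_integrable => //; first exact/measurable_EFinP.
by move=> x _ /=; rewrite lee_fin (le_trans (gh x))// ler_norm.
Qed.

Lemma cintegrable_dominated f g : cmeasurable f ->
  (forall x, normc (f x) <= g x) -> mu.-integrable setT (EFin \o g) ->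
  cintegrable mu f.
Proof.
move=> [f1 f2] fg ig; split.
  apply: (integrable_dominated (g := fun x => Re (f x))) ig => // x.
  exact: le_trans (Re_le_normc _) (fg x).
apply: (integrable_dominated (g := fun x => Im (f x))) ig => // x.
exact: le_trans (Im_le_normc _) (fg x).
Qed.

Lemma cintegrable_abs f : cintegrable mu f ->
  mu.-integrable setT (EFin \o (fun x => `|Re (f x)| + `|Im (f x)|)).
Proof.
move=> [i1 i2].
rewrite (_ : _ \o _ = (fun x => `|(Re (f x))%:E|) \+ (fun x => `|(Im (f x))%:E|))%E.
  by apply: integrableD => //; exact: integrable_abse.
by apply/funext => x /=; rewrite EFinD.
Qed.

Lemma integrable_of_cintegrable f g : cintegrable mu f -> measurable_fun setT g ->
  (forall x, `|g x| <= normc (f x)) -> mu.-integrable setT (EFin \o g).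
Proof.
move=> /cintegrable_abs fi mg gf; apply: integrable_dominated fi => // x.
exact: le_trans (gf x) (normc_le_ReIm _).
Qed.

Lemma integrableZ_EFin (k : R) g : mu.-integrable setT (EFin \o g) ->
  mu.-integrable setT (EFin \o (fun x => k * g x)).
Proof.
move=> ig; rewrite (_ : _ \o _ = fun x => (k%:E * (EFin \o g) x)%E).
  exact: integrableZl.
by apply/funext => x /=; rewrite EFinM.
Qed.

Lemma cintegrableZ (a : R[i]) f : cintegrable mu f ->
  cintegrable mu (fun x => a * f x).
Proof.
move=> [r i]; split.
  under eq_fun do rewrite ReM EFinB !EFinM.
  by apply: integrableB => //; exact: integrableZl.
under eq_fun do rewrite ImM EFinD !EFinM.
by apply: integrableD => //; exact: integrableZl.
Qed.

Lemma eq_cintegral f1 f2 : f1 =1 f2 -> cintegral mu f1 = cintegral mu f2.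
Proof. by move=> /funext ->. Qed.

Lemma cintegralD f1 f2 : cintegrable mu f1 -> cintegrable mu f2 ->
  cintegral mu (fun x => f1 x + f2 x) = cintegral mu f1 + cintegral mu f2.
Proof.
move=> [r1 i1] [r2 i2]; apply: complexP => /=.
  by under eq_Rintegral do rewrite ReD; exact: RintegralD.
by under eq_Rintegral do rewrite ImD; exact: RintegralD.
Qed.

Lemma cintegralZ (a : R[i]) f : cintegrable mu f ->
  cintegral mu (fun x => a * f x) = a * cintegral mu f.
Proof.
move=> [r i]; apply: complexP; rewrite ?(ReM, ImM).
  rewrite /cintegral /=; under eq_Rintegral do rewrite ReM.
  by rewrite RintegralB ?RintegralZl//; exact: integrableZ_EFin.
rewrite /cintegral /=; under eq_Rintegral do rewrite ImM.
by rewrite RintegralD ?RintegralZl//; exact: integrableZ_EFin.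
Qed.

Lemma cintegralB f1 f2 : cintegrable mu f1 -> cintegrable mu f2 ->
  cintegral mu (fun x => f1 x - f2 x) = cintegral mu f1 - cintegral mu f2.
Proof.
move=> i1 i2; rewrite -mulN1r -cintegralZ// -cintegralD//; last exact: cintegrableZ.
by congr cintegral; apply/funext => x; rewrite mulN1r.
Qed.

Lemma normc_cintegral_le f g : cintegrable mu f ->
  (forall x, normc (f x) <= g x) -> mu.-integrable setT (EFin \o g) ->
  normc (cintegral mu f) <= 2 * \int[mu]_x g x.
Proof.
move=> [fr fi] fg ig; rewrite (le_trans (normc_le_ReIm _))// mulr_natl mulr2n.
have h (u : T -> R) : mu.-integrable setT (EFin \o u) ->
    (forall x, `|u x| <= g x) -> `|\int[mu]_x u x| <= \int[mu]_x g x.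
  move=> iu ug; apply: le_trans (le_normr_Rintegral _ iu) _ => //.
  by apply: le_Rintegral => //; exact: (integrable_norm iu).
apply: lerD; apply: h => // x.
  exact: le_trans (Re_le_normc _) (fg x).
exact: le_trans (Im_le_normc _) (fg x).
Qed.

End complex_integral_theory.

(** * Integrals over the real line *)

Section real_line.
Context {R : realType}.
Local Notation mu := (@lebesgue_measure R).
Implicit Types (u : R -> R) (x : R).

(** Every domination on a line is by a multiple of this Cauchy density. *)
Definition kappa x : R := (1 + x ^+ 2)^-1.

Lemma kappa_gt0 x : 0 < kappa x.
Proof. by rewrite invr_gt0 ltr_pwDl// sqr_ge0. Qed.

Lemma kappa_ge0 x : 0 <= kappa x.
Proof. exact: ltW (kappa_gt0 x). Qed.

Lemma continuous_kappa : continuous kappa.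
Proof. exact: continuous_oneDsqrV. Qed.

Lemma measurable_kappa : measurable_fun setT kappa.
Proof. by apply: continuous_measurable_fun; exact: continuous_kappa. Qed.

Lemma integrable_kappa : mu.-integrable setT (EFin \o kappa).
Proof.
apply/integrableP; split; first by apply/measurable_EFinP; exact: measurable_kappa.
rewrite (eq_integral (fun x : measurableTypeR R => (kappa x)%:E)); last first.
  by move=> x _ /=; rewrite ger0_norm// kappa_ge0.
rewrite (ge0_symfun_integralT kappa_ge0 continuous_kappa); last first.
  by move=> x; rewrite /kappa /= sqrrN.
by rewrite -set_itvcy integral0y_oneDsqr -EFinM ltry.
Qed.

Lemma kappa_cvg0 : kappa n%:R @[n --> \oo] --> 0.
Proof.
apply: (@squeeze_cvgr _ _ _ _ (cst 0) (fun n => n.+1%:R^-1)) => //.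
- apply: nearW => n; rewrite kappa_ge0 /kappa /=.
  rewrite lef_pV2 ?posrE; last 2 first.
  - by apply: ltr_pwDl => //; exact: sqr_ge0.
  - by rewrite ltr0n.
  rewrite -natr1 addrC lerD2l -natrX ler_nat -mulnn.
  by case: n => // n; rewrite leq_pmulr.
- exact: cvg_cst.
- exact: cvg_harmonic.
Qed.

Lemma poly_expR_kappa (N : nat) (d : R) : 0 < d -> exists2 C : R, 0 < C &
  forall x, (1 + `|x|) ^+ N * expR (- (d * `|x|)) <= C * kappa x.
Proof.
move=> d0; have [C C0 hC] := poly_le_expR N.+2 d0; exists C => // x.
rewrite /kappa ler_pdivlMr ?ltr_pwDl ?sqr_ge0//.
rewrite expRN mulrAC ler_pdivrMr ?expR_gt0//.
apply: le_trans (hC `|x| (normr_ge0 _)).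
rewrite -[N.+2]addn2 exprD ler_wpM2l ?exprn_ge0 ?addr_ge0//.
by rewrite -[x ^+ 2]real_normK ?num_real//; have := normr_ge0 x; nra.
Qed.

(** The fundamental theorem on [[- n, n]] and dominated convergence as [n] tends
    to infinity. *)
Lemma integral_is_derive u (u' : R -> R) (l m : R) :
  (forall x, is_derive x 1 u (u' x)) -> continuous u' ->
  mu.-integrable setT (EFin \o u') ->
  u n%:R @[n --> \oo] --> l -> u (- n%:R) @[n --> \oo] --> m ->
  \int[mu]_x u' x = l - m.
Proof.
move=> du cu iu ul um.
pose D n : set (measurableTypeR R) := `[- n.+1%:R, n.+1%:R]%classic.
have mD n : measurable (D n) by exact: measurable_itv.
have hD n : (\int[mu]_(x in D n) (u' x)%:E = (u n.+1%:R - u (- n.+1%:R))%:E)%E.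
  rewrite EFinB; apply: (@continuous_FTC2 R u' u).
  - by rewrite gtrN// ltr0n.
  - exact: continuous_subspaceT.
  - have cont x : {for x, continuous u}.
      by apply/differentiable_continuous/derivable1_diffP; case: (du x).
    split; first by move=> x _; case: (du x).
      by apply: cvg_at_right_filter; exact: cont.
    by apply: cvg_at_left_filter; exact: cont.
  - by move=> x _; rewrite derive1E; case: (du x).
pose f_ n x := ((EFin \o u') \_ (D n)) x.
have mu' : measurable_fun setT (EFin \o u').
  by apply/measurable_EFinP; exact: continuous_measurable_fun.
have mf_ n : measurable_fun setT (f_ n).
  by apply/(measurable_restrictT _ (mD n)); exact: measurable_funTS.
have [|||_ _] := @dominated_convergence _ _ _ mu setT measurableT f_
  (EFin \o u') (fun x => `|(u' x)%:E|)%E mf_ mu'.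
- apply/aeW => x _; apply: cvg_near_cst.
  near=> n; rewrite /f_ patchE mem_set// /D /= in_itv/= -ler_norml.
  near: n; exists (Num.truncn `|x|) => // n /= xn.
  rewrite (le_trans (ltW (truncnS_gt _)))// ler_nat ltnS.
  exact: xn.
- exact: integrable_abse.
- apply/aeW => x n _; rewrite /f_ patchE; case: ifPn => // _.
  by rewrite abse0 abse_ge0.
rewrite (_ : [sequence _]_n = fun n => (u n.+1%:R - u (- n.+1%:R))%:E); last first.
  by apply/funext => n; rewrite -hD [RHS]integral_mkcond.
rewrite (_ : (\int[mu]_x _)%E = (\int[mu]_x u' x)%:E); last first.
  by rewrite /Rintegral fineK// integrable_fin_num.
move=> /fine_cvg /= h.
rewrite -(cvg_lim (@Rhausdorff R) h); apply: cvg_lim => //.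
by apply: cvgB; rewrite (cvg_shiftS (fun n => u _)).
Unshelve. all: by end_near. Qed.

End real_line.

(** * Moving a horizontal contour *)

Section contour_shift.
Context {R : realType}.
Local Notation mu := (@lebesgue_measure R).
Local Notation RR := (measurableTypeR R).

Lemma kappa_bounded_cvg0 (g : R -> R) (C : R) (s : nat -> R) :
  (forall x, `|g x| <= C * kappa x) -> (forall n, `|s n| = n%:R) ->
  g (s n) @[n --> \oo] --> 0.
Proof.
move=> gC sn; apply: norm_cvg0.
apply: (@squeeze_cvgr _ _ _ _ (cst 0) (fun n => C * kappa n%:R)).
- apply: nearW => n; rewrite normr_ge0 (le_trans (gC _))//.
  by rewrite /kappa -[s n ^+ 2]real_normK ?num_real// sn.
- exact: cvg_cst.
- by rewrite -[X in _ --> X](mulr0 C); apply: cvgMr; exact: kappa_cvg0.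
Qed.

Lemma integrable_kappa_bounded (g : RR -> R) (C : R) : measurable_fun setT g ->
  (forall x, `|g x| <= C * kappa x) -> mu.-integrable setT (EFin \o g).
Proof.
move=> mg gC; apply: integrable_dominated gC _ => //.
exact/integrableZ_EFin/integrable_kappa.
Qed.

Section real_part.
Variables (f g h : R -> R -> R) (u v y0 C : R).
Hypothesis mf : forall y, u < y < v -> measurable_fun setT (f y : RR -> R).
Hypothesis f_le : forall x y, u < y < v -> `|f y x| <= C * kappa x.
Hypothesis g_le : forall x y, u < y < v -> `|g y x| <= C * kappa x.
Hypothesis f_cont : forall x y : R, u < y < v -> x != 0 ->
  {for y, continuous (f ^~ x)}.
Hypothesis f_y : forall x y : R, u < y < v -> y != y0 ->
  is_derive y 1 (f ^~ x) (h y x).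
Hypothesis g_x : forall x y : R, u < y < v -> y != y0 ->
  is_derive x 1 (g y) (h y x).
Hypothesis h_cont : forall y, u < y < v -> y != y0 -> continuous (h y).
Hypothesis h_le : forall y, u < y < v -> y != y0 ->
  exists K, \forall z \near y, forall x, `|h z x| <= K * kappa x.

Let J y := \int[mu]_x f y x.

Let J_continuous y : u < y < v -> {for y, continuous J}.
Proof.
move=> yuv.
have intf z : `]u, v[%classic z -> mu.-integrable setT (EFin \o f z).
  rewrite /= in_itv/= => zuv.
  by apply: (@integrable_kappa_bounded _ C) => [|x]; [exact: mf|exact: f_le].
apply: (@continuity_under_integral R _ RR mu f setT measurableT u v intf _
  (fun x => C * kappa x)).
- exists [set 0]; split => //; first exact: lebesgue_measure_set1.
  move=> x /= nx; apply: contrapT => /eqP x0; apply: nx => _ z.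
  by rewrite inE/= in_itv/= => zuv; exact: f_cont.
- exact/integrableZ_EFin/integrable_kappa.
- move=> z; rewrite /= in_itv/= => zuv; apply/aeW => x _; exact: f_le.
- by rewrite inE/= in_itv.
Qed.

Let J_derive y : u < y < v -> y != y0 -> is_derive y 1 J 0.
Proof.
move=> yuv yy0; have [K hK] := h_le yuv yy0.
have {hK}[r r0 hr] : exists2 r : R, 0 < r &
    forall z, `|y - z| < r -> forall x, `|h z x| <= K * kappa x.
  by have /nbhs_ballP[r /= r0 hr] := hK; exists r.
have /andP[uy yv] := yuv.
(* a neighbourhood of [y] inside the strip, off [y0], with a common bound *)
pose e := Num.min r (Num.min (y - u) (Num.min (v - y) `|y - y0|)).
have e0 : 0 < e by rewrite /e !lt_min r0 !subr_gt0 uy yv normr_gt0 subr_eq0.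
have he z : `]y - e, y + e[%classic z ->
    [/\ u < z < v, z != y0 & forall x, `|h z x| <= K * kappa x].
  rewrite /= in_itv/= -ltr_distl distrC !lt_min => /and4P[zr zu zv zy0]; split.
  - by move: zu zv; rewrite !ltr_norml => /andP[a b] /andP[c d]; apply/andP; split; lra.
  - by apply: contraL zy0 => /eqP->; rewrite ltxx.
  - exact: hr.
have ye : `]y - e, y + e[%classic y by rewrite /= in_itv/= ltrBlDr !ltrDl e0.
have intf z : `]y - e, y + e[%classic z -> mu.-integrable setT (EFin \o f z).
  move=> /he[zuv _ _].
  by apply: (@integrable_kappa_bounded _ C) => [|x]; [exact: mf|exact: f_le].
have derf z (x : RR) : `]y - e, y + e[%classic z -> setT x ->
    derivable (f ^~ x) z 1.
  by move=> /he[zuv zy0 _] _; case: (f_y x zuv zy0).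
have d1 z x : `]y - e, y + e[%classic z -> partial1of2 f z x = h z x.
  by move=> /he[zuv zy0 _]; rewrite partial1of2E; case: (f_y x zuv zy0).
have K0 x : 0 <= K * kappa x.
  by have [_ _ /(_ x)] := he _ ye; apply: le_trans.
have iK : mu.-integrable setT (EFin \o (fun x => K * kappa x)).
  exact/integrableZ_EFin/integrable_kappa.
have hle z (x : RR) : `]y - e, y + e[%classic z -> setT x ->
    `|partial1of2 f z x| <= K * kappa x.
  by move=> ze _; rewrite d1//; have [_ _] := he _ ze.
have dJ := derivable_under_integral measurableT ye intf derf K0 iK hle.
apply: DeriveDef dJ _; rewrite -derive1E.
rewrite (differentiation_under_integral measurableT ye intf derf K0 iK hle).
under eq_Rintegral do rewrite d1//.
have hc := h_cont yuv yy0.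
have hy x : `|h y x| <= K * kappa x by have [_ _] := he _ ye.
have gy0 (s : nat -> R) : (forall n, `|s n| = n%:R) -> g y (s n) @[n --> \oo] --> 0.
  by apply: kappa_bounded_cvg0 => x; exact: g_le.
rewrite -[RHS](subr0 0); apply: (@integral_is_derive _ (g y)) => //.
- by move=> x; exact: g_x.
- by apply: (integrable_kappa_bounded _ hy); exact: continuous_measurable_fun.
- by apply: gy0 => n; rewrite normr_nat.
- by apply: (gy0 (fun n => - n%:R)) => n; rewrite normrN normr_nat.
Qed.

Let J_const a b : u < a -> a <= b -> b < v -> (y0 <= a) || (b <= y0) ->
  J a = J b.
Proof.
move=> ua ab bv y0ab.
have sub z : a <= z <= b -> u < z < v.
  by move=> /andP[az zb]; rewrite (lt_le_trans ua az) (le_lt_trans zb bv).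
have dJ (z : R) : z \in `]a, b[ -> is_derive z 1 J 0.
  rewrite in_itv/= => /andP[az zb]; apply: J_derive.
    by apply: sub; rewrite !ltW.
  by case/orP: y0ab => le0; [rewrite gt_eqF ?(le_lt_trans le0 az)
    |rewrite lt_eqF ?(lt_le_trans zb le0)].
have [|c _] := MVT_segment ab dJ; last first.
  by rewrite mul0r => /eqP; rewrite subr_eq0 => /eqP.
apply: continuous_in_subspaceT => z; rewrite inE/= in_itv/= => zab.
by apply: J_continuous; exact: sub.
Qed.

Lemma integral_shift y1 y2 : u < y1 < v -> u < y2 < v ->
  \int[mu]_x f y1 x = \int[mu]_x f y2 x.
Proof.
wlog y12 : y1 y2 / y1 <= y2 => [hw|].
  by case: (leP y1 y2) => [/hw//|/ltW /hw hw' ? ?]; apply/esym; exact: hw'.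
move=> /andP[uy1 y1v] /andP[uy2 y2v].
have [y01|y01] := leP y0 y1; first by apply: J_const => //; rewrite y01.
have [y02|y02] := leP y2 y0; first by apply: J_const => //; rewrite y02 orbT.
transitivity (J y0).
  apply: J_const => //; [exact: ltW|exact: lt_trans y02 y2v|].
  by rewrite lexx orbT.
apply: J_const => //; [exact: lt_trans uy1 y01|exact: ltW|].
by rewrite lexx.
Qed.

End real_part.

(** The Cauchy theorem on a strip. As a function of the height the integral is
    continuous by dominated convergence, and off [y0] its derivative is, by the
    Cauchy-Riemann equations, the integral of an [x]-derivative of a function
    vanishing at both ends, hence zero. The height [y0] is allowed to carry one
    removable singularity, at real part zero. *)
Lemma contour_shift (F D : R[i] -> R[i]) (u v y0 C : R) :
  (forall y, u < y < v -> cmeasurable (fun x : RR => F (Complex x y))) ->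
  (forall x y, u < y < v -> normc (F (Complex x y)) <= C * kappa x) ->
  (forall x y : R, u < y < v -> x != 0 ->
    {for y, continuous (fun z => Re (F (Complex x z)))} /\
    {for y, continuous (fun z => Im (F (Complex x z)))}) ->
  (forall x y, u < y < v -> y != y0 ->
    cderiv (fun t => F (Complex t y)) x (D (Complex x y)) /\
    cderiv (fun t => F (Complex x t)) y ('i%C * D (Complex x y))) ->
  (forall y, u < y < v -> y != y0 ->
    continuous (fun x => Re (D (Complex x y))) /\
    continuous (fun x => Im (D (Complex x y)))) ->
  (forall y, u < y < v -> y != y0 -> exists K,
    \forall z \near y, forall x, normc (D (Complex x z)) <= K * kappa x) ->
  forall y1 y2, u < y1 < v -> u < y2 < v ->
  cintegral mu (fun x : RR => F (Complex x y1)) =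
  cintegral mu (fun x : RR => F (Complex x y2)).
Proof.
move=> mF FC Fc FD Dc DK y1 y2 hy1 hy2; apply: complexP => /=.
  apply: (@integral_shift (fun y x => Re (F (Complex x y)))
    (fun y x => - Im (F (Complex x y))) (fun y x => - Im (D (Complex x y)))
    u v y0 C) => //.
  - by move=> y /mF[].
  - by move=> x y yuv; apply: le_trans (FC x y yuv); exact: Re_le_normc.
  - by move=> x y yuv; apply: le_trans (FC x y yuv); rewrite normrN Im_le_normc.
  - by move=> x y yuv x0; case: (Fc x y yuv x0).
  - move=> x y yuv yy0; case: (FD x y yuv yy0) => _ [+ _].
    by rewrite !ReIm mul0r mul1r sub0r.
  - move=> x y yuv yy0; case: (FD x y yuv yy0) => [[_ ?] _].
    exact: is_deriveN.
  - by move=> y yuv yy0 x; apply: cvgN; case: (Dc y yuv yy0) => _; exact.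
  - move=> y yuv yy0; have [K hK] := DK y yuv yy0; exists K.
    near=> z => x; rewrite normrN (le_trans (Im_le_normc _))//.
    by move: x; near: z.
apply: (@integral_shift (fun y x => Im (F (Complex x y)))
  (fun y x => Re (F (Complex x y))) (fun y x => Re (D (Complex x y)))
  u v y0 C) => //.
- by move=> y /mF[].
- by move=> x y yuv; apply: le_trans (FC x y yuv); exact: Im_le_normc.
- by move=> x y yuv; apply: le_trans (FC x y yuv); exact: Re_le_normc.
- by move=> x y yuv x0; case: (Fc x y yuv x0).
- move=> x y yuv yy0; case: (FD x y yuv yy0) => _ [_ +].
  by rewrite !ReIm mul0r mul1r add0r.
- by move=> x y yuv yy0; case: (FD x y yuv yy0) => [[]].
- by move=> y yuv yy0 x; case: (Dc y yuv yy0) => + _; exact.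
- move=> y yuv yy0; have [K hK] := DK y yuv yy0; exists K.
  near=> z => x; rewrite (le_trans (Re_le_normc _))//.
  by move: x; near: z.
Unshelve. all: by end_near. Qed.

End contour_shift.

(** * The kernel 1 / sh (pi p) *)

Section residue_kernel.
Context {R : realType}.
Local Notation mu := (@lebesgue_measure R).
Local Notation RR := (measurableTypeR R).
Implicit Types (x y e : R) (p : R[i]).

Lemma ComplexEy x y : Complex x y = Complex x 0 + y%:C%C * 'i%C.
Proof. by apply: complexP; rewrite !ReIm /=; ring. Qed.

Lemma ComplexEx x y : Complex x y = Complex 0 y + x%:C%C * 1.
Proof. by apply: complexP; rewrite !ReIm /=; ring. Qed.

Lemma Re_piM p : Re (pi%:C%C * p) = pi * Re p.
Proof. by rewrite !ReIm mul0r subr0. Qed.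

Lemma Im_piM p : Im (pi%:C%C * p) = pi * Im p.
Proof. by rewrite !ReIm mul0r addr0. Qed.

Lemma expR_pi_abs x : expR `|pi * x| = expR (pi * `|x|).
Proof. by rewrite normrM ger0_norm// pi_ge0. Qed.

Lemma sh_pi_ge_sin (s : R) p : 0 <= s <= 1 -> s <= `|sin (pi * Im p)| ->
  s * expR (pi * `|Re p|) <= normc (sh (pi%:C%C * p)).
Proof.
move=> s01 ss; have := @normc_sh_ge_sin _ s (pi%:C%C * p) s01.
by rewrite Im_piM Re_piM expR_pi_abs; exact.
Qed.

Lemma sh_pi_neq0 p : Re p != 0 \/ sin (pi * Im p) != 0 -> sh (pi%:C%C * p) != 0.
Proof.
rewrite -normc_eq0 => -[x0|s0]; rewrite gt_eqF//.
  apply: lt_le_trans (normc_sh_ge_Re _); rewrite normr_gt0 subr_eq0 Re_piM.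
  apply/eqP => /expR_inj /eqP; rewrite -subr_eq0 opprK -mulr2n mulrn_eq0/=.
  by rewrite mulf_eq0 (negbTE x0) gt_eqF// pi_gt0.
apply: lt_le_trans (sh_pi_ge_sin (s := `|sin (pi * Im p)|) _ (lexx _)).
  by rewrite mulr_gt0 ?expR_gt0 ?normr_gt0.
by rewrite normr_ge0 sin_max.
Qed.

Lemma sin_pi_ge (u t : R) : 0 < u -> u <= t <= 2^-1 ->
  sin (pi * u) <= `|sin (pi * t)|.
Proof.
move=> u0 /andP[ut t2]; apply: le_trans (ler_norm _).
have := @pi_gt0 R => p0.
have h (w : R) : 0 < w -> w <= 2^-1 -> pi * w \in `[(- (pi / 2)), pi / 2]%R.
  move=> w0 w2; rewrite in_itv/=.
  have h1 : pi * w <= pi / 2 by rewrite ler_pM2l ?pi_gt0.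
  have h2 : 0 < pi * w by rewrite mulr_gt0.
  by rewrite h1 andbT (le_trans _ (ltW h2))// oppr_le0 divr_ge0 ?ltW.
move: ut; rewrite le_eqVlt => /predU1P[->//|ut].
apply: ltW; rewrite ltr_sin ?h ?(lt_trans u0 ut)//; first by rewrite ltr_pM2l.
exact: ltW (lt_le_trans ut t2).
Qed.

Lemma sin_pi_1B t : sin (pi * (1 - t)) = sin (pi * t) :> R.
Proof. by rewrite mulrBr mulr1 sinB sinpi cospi mul0r sub0r mulN1r opprK. Qed.

Lemma sin_pi_B1 t : sin (pi * (t - 1)) = - sin (pi * t) :> R.
Proof. by rewrite -[in RHS]sin_pi_1B -sinN; congr sin; ring. Qed.

Lemma sin_pi_gt0 t : 0 < t < 1 -> 0 < sin (pi * t) :> R.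
Proof.
move=> /andP[t0 t1]; have := @pi_gt0 R => p0.
by apply: sin_gt0_pi; apply/andP; split; nra.
Qed.

Lemma cderiv_inv_sh (f : R -> R[i]) t d : sh (pi%:C%C * f t) != 0 ->
  cderiv f t d -> cderiv (fun s => (sh (pi%:C%C * f s))^-1) t
    (- (pi%:C%C * d * ch (pi%:C%C * f t) / sh (pi%:C%C * f t) ^+ 2)).
Proof.
by move=> n0 h; apply: cderivV => //; apply: cderiv_sh; exact: cderivZ.
Qed.

Lemma cderiv_ch (f : R -> R[i]) t d :
  cderiv f t d -> cderiv (fun s => ch (f s)) t (d * sh (f t)).
Proof.
move=> h; apply: cderiv_eq (cderivD (cderiv_cexp h) (cderiv_cexp (cderivN h))) _.
by rewrite mulNr -mulrBr.
Qed.

(** Measurability from differentiability, hence continuity, along the line. *)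
Lemma cmeasurable_line (F : R[i] -> R[i]) y :
  (forall x, exists d, cderiv (fun t => F (Complex t y)) x d) ->
  cmeasurable (fun x : RR => F (Complex x y)).
Proof.
move=> h; split; apply: continuous_measurable_fun => x.
  by have [d /cderiv_Re_continuous] := h x.
by have [d /cderiv_Im_continuous] := h x.
Qed.

Lemma cderiv_lineX y x : cderiv (fun t : R => Complex t y) x 1.
Proof.
apply: (cderiv_ext (f := fun t => Complex 0 y + t%:C%C * 1)); last exact: cderiv_line.
by move=> t; rewrite -ComplexEx.
Qed.

Lemma continuous_sech :
  continuous (fun x : R => (expR (pi * x) + expR (- (pi * x)))^-1).
Proof.
move=> x; apply: cvgV; first by rewrite gt_eqF// addr_gt0 ?expR_gt0.
by apply: cvgD; apply: continuous_comp; do ?[exact: continuous_expR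
  |apply: cvgN|exact: mulrl_continuous].
Qed.

Lemma integrable_sech : mu.-integrable setT
  (EFin \o (fun x => (expR (pi * x) + expR (- (pi * x)))^-1)).
Proof.
have [C C0 hC] := poly_expR_kappa 0 (@pi_gt0 R).
apply: (integrable_kappa_bounded _ (C := C)) => [|x].
  by apply: continuous_measurable_fun; exact: continuous_sech.
apply: le_trans (hC x); rewrite expr0 mul1r ger0_norm; last first.
  by rewrite invr_ge0 addr_ge0 ?expR_ge0.
rewrite [leRHS]expRN -expR_pi_abs.
rewrite lef_pV2 ?posrE ?addr_gt0 ?expR_gt0//.
exact: expR_abs_le.
Qed.

(** [atan (exp (pi x)) / pi] is an antiderivative of [1 / (2 cosh (pi x))]. *)
Lemma integral_sech : \int[mu]_x (expR (pi * x) + expR (- (pi * x)))^-1 = 2^-1.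
Proof.
pose A : R -> R := pi^-1 *: (@atan R \o (expR \o (pi *: id))).
have p0 := @pi_gt0 R.
have dA (x : R) : is_derive x 1 A (expR (pi * x) + expR (- (pi * x)))^-1.
  rewrite /A; apply: is_derive_eq; rewrite /GRing.scale/= mulr1 expRN.
  have := expR_gt0 (pi * x); move: (expR (pi * x)) => E E0.
  move: (pi : R) p0 => P P0.
  by field; rewrite !gt_eqF//= addr_gt0// mulr_gt0.
have lA (s : nat -> R) l : expR (pi * s n) @[n --> \oo] --> l ->
    A (s n) @[n --> \oo] --> pi^-1 * atan l.
  move=> sl; apply: cvgMr; apply: cvg_comp sl _; exact: continuous_atan.
have e0 : expR (pi * - n%:R) @[n --> \oo] --> (0 : R).
  apply: (@squeeze_cvgr _ _ _ _ (cst 0) (fun n => expR (- n%:R))).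
  - apply: nearW => n; rewrite expR_ge0/= ler_expR mulrN lerN2.
    by rewrite ler_peMl// (le_trans _ (@pi_ge2 R))// ler1n.
  - exact: cvg_cst.
  - by have := @cvgn_expR R.
rewrite (_ : 2^-1 = pi^-1 * (pi / 2) - pi^-1 * atan 0); last first.
  by rewrite atan0 mulr0 subr0 mulrA mulVf ?mul1r// gt_eqF.
apply: (integral_is_derive dA continuous_sech integrable_sech).
- apply: cvgMr; apply: (cvg_comp _ (@atan R) _ (@cvgy_atan R)).
  apply/cvgryPge => M; near=> n => /=; apply: le_trans (expR_ge1Dx _).
  rewrite (@le_trans _ _ (pi * n%:R))// ?lerDr//.
  rewrite (@le_trans _ _ n%:R)//; first by near: n; exact: nbhs_infty_ger.
  by rewrite ler_peMl// (le_trans _ (@pi_ge2 R))// ler1n.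
- exact: lA.
Unshelve. all: by end_near. Qed.

End residue_kernel.

(** * Quotients by sh (pi p) *)

Section quotient_by_sh.
Context {R : realType}.
Local Notation mu := (@lebesgue_measure R).
Local Notation RR := (measurableTypeR R).
Implicit Types (x y s t : R) (p a d : R[i]).

Variables (H DH : R[i] -> R[i]) (u v b K : R).
Hypothesis b_lt : 0 <= b < pi.
Hypothesis H_der : forall a d t, u < Im (a + t%:C%C * d) ->
  cderiv (fun s => H (a + s%:C%C * d)) t (d * DH (a + t%:C%C * d)).
Hypothesis DH_der : forall x y, u < y ->
  exists d, cderiv (fun t => DH (Complex t y)) x d.
Hypothesis H_le : forall p, u < Im p < v -> normc (H p) <= K * expR (b * `|Re p|).
Hypothesis DH_le : forall p, u < Im p < v -> normc (DH p) <= K * expR (b * `|Re p|).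

Definition over_sh p : R[i] := H p / sh (pi%:C%C * p).

Definition over_sh' p : R[i] := DH p / sh (pi%:C%C * p) -
  H p * (pi%:C%C * ch (pi%:C%C * p) / sh (pi%:C%C * p) ^+ 2).

Lemma numerator_derX x y : u < y -> cderiv (fun t => H (Complex t y)) x (DH (Complex x y)).
Proof.
move=> uy; have := @H_der (Complex 0 y) 1 x.
rewrite -ComplexEx mul1r => /(_ uy); apply: cderiv_ext => t.
by rewrite -ComplexEx.
Qed.

Lemma over_sh_der a d t : u < Im (a + t%:C%C * d) ->
  sh (pi%:C%C * (a + t%:C%C * d)) != 0 ->
  cderiv (fun s => over_sh (a + s%:C%C * d)) t (d * over_sh' (a + t%:C%C * d)).
Proof.
move=> ut n0.
apply: cderiv_eq (cderivM (H_der ut) (cderiv_inv_sh n0 (cderiv_line _ _ _))) _.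
by rewrite /over_sh'; ring.
Qed.

Lemma over_sh_derX x y : u < y -> sh (pi%:C%C * Complex x y) != 0 ->
  cderiv (fun t => over_sh (Complex t y)) x (over_sh' (Complex x y)).
Proof.
move=> uy n0; have := @over_sh_der (Complex 0 y) 1 x.
rewrite -ComplexEx mul1r => /(_ uy n0); apply: cderiv_ext => t.
by rewrite -ComplexEx.
Qed.

Lemma over_sh_derY x y : u < y -> sh (pi%:C%C * Complex x y) != 0 ->
  cderiv (fun t => over_sh (Complex x t)) y ('i%C * over_sh' (Complex x y)).
Proof.
move=> uy n0; have := @over_sh_der (Complex x 0) 'i%C y.
rewrite -ComplexEy => /(_ uy n0); apply: cderiv_ext => t.
by rewrite -ComplexEy.
Qed.

Lemma over_sh'_der x y : u < y -> sh (pi%:C%C * Complex x y) != 0 ->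
  exists d, cderiv (fun t => over_sh' (Complex t y)) x d.
Proof.
move=> uy n0; have [d hd] := DH_der x uy.
have hp := cderivZ (pi%:C%C) (cderiv_lineX y x).
have hs := cderiv_sh hp; have hc := cderiv_ch hp.
eexists; apply: cderivB; first by apply: cderivM hd _; exact: cderivV hs.
apply: cderivM; first exact: numerator_derX.
apply: cderivM; first by apply: cderivZ; exact: hc.
by apply: cderivV; [rewrite expf_neq0|exact: cderivX hs].
Qed.

Lemma numerator_bound_ge0 p : u < Im p < v -> 0 <= K.
Proof.
move=> /H_le h; have := le_trans (normc_ge0 _) h.
by rewrite pmulr_lge0 ?expR_gt0.
Qed.

Lemma over_sh_le_aux s p : u < Im p < v -> 0 < s ->
  s * expR (pi * `|Re p|) <= normc (sh (pi%:C%C * p)) ->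
  normc (over_sh p) <= K / s * expR (- ((pi - b) * `|Re p|)).
Proof.
move=> hp s0 hs; rewrite normcM normcV.
have sp : 0 < s * expR (pi * `|Re p|) by rewrite mulr_gt0 ?expR_gt0.
rewrite ler_pdivrMr ?(lt_le_trans sp hs)//.
apply: le_trans (H_le hp) _.
apply: le_trans (ler_wpM2l _ hs); last first.
  by rewrite mulr_ge0 ?expR_ge0// divr_ge0 ?(numerator_bound_ge0 hp)// ltW.
rewrite (_ : expR (b * _) = expR (- ((pi - b) * `|Re p|)) * expR (pi * `|Re p|)).
  rewrite le_eqVlt; apply/orP; left; apply/eqP.
  by field; rewrite gt_eqF.
by rewrite -expRD; congr expR; ring.
Qed.

Lemma over_sh'_le_aux s p : u < Im p < v -> 0 < s ->
  s * expR (pi * `|Re p|) <= normc (sh (pi%:C%C * p)) ->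
  normc (over_sh' p) <=
    (K / s + K * pi * 2 / s ^+ 2) * expR (- ((pi - b) * `|Re p|)).
Proof.
move=> hp s0 hs; rewrite (le_trans (ler_normcB _ _))// !normcM !normcV normcX.
have K0 := numerator_bound_ge0 hp; have p0 := @pi_gt0 R.
rewrite normcR gtr0_norm//.
have hc : normc (ch (pi%:C%C * p)) <= 2 * expR (pi * `|Re p|).
  by rewrite (le_trans (normc_ch_le _))// Re_piM expR_pi_abs.
have hH := H_le hp; have hD := DH_le hp.
have E : expR (b * `|Re p|) = expR (- ((pi - b) * `|Re p|)) * expR (pi * `|Re p|).
  by rewrite -expRD; congr expR; ring.
rewrite E in hH hD.
have e0 := expR_gt0 (- ((pi - b) * `|Re p|)).
have f0 := expR_gt0 (pi * `|Re p|).
move: (normc (ch _)) (normc (sh _)) (normc (H p)) (normc (DH p))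
  (normc_ge0 (ch (pi%:C%C * p))) (normc_ge0 (H p)) (normc_ge0 (DH p)) hs hc hH hD.
move: (expR (- _)) (expR (pi * _)) e0 f0 => e f e0 f0 c h g g' c0 g0 g'0 hs hc hH hD.
have sf : 0 < s * f by rewrite mulr_gt0.
have h0 : 0 < h := lt_le_trans sf hs.
rewrite [leRHS]mulrDl lerD//.
  rewrite ler_pdivrMr//; apply: le_trans hD _.
  rewrite (_ : K * (e * f) = K / s * e * (s * f)); last by field; rewrite gt_eqF.
  by rewrite ler_wpM2l// mulr_ge0 ?(ltW e0)// divr_ge0// ltW.
rewrite mulrA ler_pdivrMr ?exprn_gt0//.
apply: (@le_trans _ _ (K * (e * f) * (pi * (2 * f)))).
  by apply: ler_pM => //; [rewrite mulr_ge0 ?pi_ge0|rewrite ler_pM2l].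
rewrite (_ : _ * _ = K * pi * 2 / s ^+ 2 * e * (s * f) ^+ 2); last first.
  by move: (pi : R) => P; field; rewrite gt_eqF.
rewrite ler_wpM2l ?lerXn2r ?nnegrE ?(ltW sf) ?(ltW h0)//.
by rewrite !mulr_ge0 ?(ltW e0) ?invr_ge0 ?exprn_ge0 ?pi_ge0 ?(ltW s0).
Qed.

Lemma exp_kappa : exists2 C : R, 0 < C & forall x,
  expR (- ((pi - b) * `|x|)) <= C * kappa x.
Proof.
have /andP[_ bpi] := b_lt; have [|C C0 hC] := @poly_expR_kappa R 0 (pi - b).
  by rewrite subr_gt0.
by exists C => // x; have := hC x; rewrite expr0 mul1r.
Qed.

(** Wherever [sh] has the size [exp (pi |Re p|)] of its generic lower bound, the
    slower growth of the numerator leaves an exponential decay. *)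
Lemma over_sh_le s : 0 < s -> exists C, forall p, u < Im p < v ->
  s * expR (pi * `|Re p|) <= normc (sh (pi%:C%C * p)) ->
  normc (over_sh p) <= C * kappa (Re p).
Proof.
move=> s0; have [C C0 hC] := exp_kappa; exists (K / s * C) => p hp hs.
rewrite (le_trans (over_sh_le_aux hp s0 hs))// -[leRHS]mulrA ler_wpM2l//.
by rewrite divr_ge0 ?(numerator_bound_ge0 hp)// ltW.
Qed.

Lemma over_sh'_le s : 0 < s -> exists C, forall p, u < Im p < v ->
  s * expR (pi * `|Re p|) <= normc (sh (pi%:C%C * p)) ->
  normc (over_sh' p) <= C * kappa (Re p).
Proof.
move=> s0; have [C C0 hC] := exp_kappa.
exists ((K / s + K * pi * 2 / s ^+ 2) * C) => p hp hs.
rewrite (le_trans (over_sh'_le_aux hp s0 hs))// -[leRHS]mulrA ler_wpM2l//.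
have K0 := numerator_bound_ge0 hp; have p0 := @pi_ge0 R.
by rewrite addr_ge0// ?divr_ge0 ?mulr_ge0 ?exprn_ge0// ltW.
Qed.

Lemma cmeasurable_over_sh y : u < y ->
  cmeasurable (fun x : RR => over_sh (Complex x y)).
Proof.
move=> uy; apply: cmeasurableM.
  by apply: cmeasurable_line => x; exists (DH (Complex x y)); exact: numerator_derX.
apply: cmeasurableV; apply: cmeasurable_sh; apply: cmeasurableM.
  exact: cmeasurable_cst.
by apply: cmeasurable_Complex; exact: measurable_id.
Qed.

Lemma cintegrable_over_sh y : u < y < v -> sin (pi * y) != 0 ->
  cintegrable mu (fun x : RR => over_sh (Complex x y)).
Proof.
move=> uyv sy0; have sy : 0 < `|sin (pi * y)| by rewrite normr_gt0.
have [C hC] := over_sh_le sy.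
apply: (@cintegrable_dominated _ RR R mu _ (fun x : RR => C * kappa x)).
- by apply: cmeasurable_over_sh; case/andP: uyv.
- move=> x; apply: (hC (Complex x y)) => //.
  by apply: sh_pi_ge_sin => //=; rewrite normr_ge0 sin_max.
- exact/integrableZ_EFin/integrable_kappa.
Qed.

Lemma over_sh_shift w y0 C : w <= v ->
  (forall y, u < y < w -> y != y0 -> sin (pi * y) != 0) ->
  (forall p, u < Im p < w -> normc (over_sh p) <= C * kappa (Re p)) ->
  forall y1 y2, u < y1 < w -> u < y2 < w ->
  cintegral mu (fun x : RR => over_sh (Complex x y1)) =
  cintegral mu (fun x : RR => over_sh (Complex x y2)).
Proof.
move=> wv s0 hC.
apply: (@contour_shift R over_sh over_sh' u w y0 C).
- by move=> y /andP[uy _]; exact: cmeasurable_over_sh.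
- by move=> x y uyw; exact: (hC (Complex x y)).
- move=> x y /andP[uy _] x0.
  have hd : cderiv (fun t => over_sh (Complex x t)) y ('i%C * over_sh' (Complex x y)).
    by apply: over_sh_derY => //; apply: sh_pi_neq0; left.
  by split; [exact: cderiv_Re_continuous hd|exact: cderiv_Im_continuous hd].
- move=> x y uyw yy0; have n0 : sh (pi%:C%C * Complex x y) != 0.
    by apply: sh_pi_neq0; right; exact: s0.
  have /andP[uy _] := uyw.
  by split; [exact: over_sh_derX|exact: over_sh_derY].
- move=> y uyw yy0; have /andP[uy _] := uyw.
  have h x : exists d, cderiv (fun t => over_sh' (Complex t y)) x d.
    by apply: over_sh'_der => //; apply: sh_pi_neq0; right; exact: s0.
  by split=> x; have [d hd] := h x;
    [exact: cderiv_Re_continuous hd|exact: cderiv_Im_continuous hd].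
- move=> y uyw yy0.
  have sy : 0 < `|sin (pi * y)| / 2 by rewrite divr_gt0// normr_gt0 s0.
  have [D hD] := over_sh'_le sy; exists D.
  near=> z => x; apply: (hD (Complex x z)).
    have /andP[uz zw] : u < z < w.
      near: z; have : y \in `]u, w[ by rewrite in_itv.
      by move=> /near_in_itvoo; apply: filterS => z /=; rewrite in_itv.
    by rewrite /= uz (lt_le_trans zw).
  apply: sh_pi_ge_sin => /=.
    rewrite ltW//=; have := sin_max (pi * y); lra.
  apply: ltW; near: z.
  apply: (cvgr_gt (`|sin (pi * y)|)); last first.
    by rewrite ltr_pdivrMr// ltr_pMr ?normr_gt0 ?s0// ltr1n.
  apply: cvg_norm; apply: continuous_comp; last exact: continuous_sin.
  exact: mulrl_continuous.
Unshelve. all: by end_near. Qed.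

End quotient_by_sh.

Section residue.
Context {R : realType}.
Local Notation mu := (@lebesgue_measure R).
Local Notation RR := (measurableTypeR R).
Implicit Types (x y s t e : R) (p a d : R[i]).

Lemma sin_pi_ge_away (u y : R) : 0 < u <= 4^-1 -> u < y < 3 / 2 ->
  4^-1 <= `|y - 1| -> sin (pi * u) <= `|sin (pi * y)|.
Proof.
move=> /andP[u0 u4] /andP[uy y32] y1.
have [y12|y12] := leP y 2^-1; first by apply: sin_pi_ge; rewrite // ltW.
have [yl|/ltW yg] := leP y 1.
  have {}y1 : 4^-1 <= 1 - y by rewrite -opprB -ler0_norm// subr_le0.
  by rewrite -[sin (pi * y)]sin_pi_1B; apply: sin_pi_ge => //; apply/andP; split; lra.
have {}y1 : 4^-1 <= y - 1 by rewrite -[y - 1]ger0_norm// subr_ge0.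
by rewrite -normrN -sin_pi_B1; apply: sin_pi_ge => //; apply/andP; split; lra.
Qed.

(** Moving the line to height [1/2], where [sh (pi (x + i/2)) = 2 i cosh (pi x)]. *)
Lemma cintegral_inv_sh e : 0 < e < 2^-1 ->
  cintegral mu (fun x : RR => (sh (pi%:C%C * Complex x e))^-1) = - 'i%C / 2.
Proof.
move=> /andP[e0 e2]; pose u := e / 2.
have u0 : 0 < u by rewrite divr_gt0.
have hy y : u < y < 3 / 4 -> sin (pi * u) <= `|sin (pi * y)|.
  move=> /andP[uy y34]; apply: sin_pi_ge_away.
  - rewrite u0/= /u; lra.
  - rewrite uy/=; lra.
  - rewrite ler0_norm; lra.
have su : 0 < sin (pi * u) by rewrite sin_pi_gt0 ?u0//= /u; lra.
have p0 : 0 <= (0 : R) < pi by rewrite lexx pi_gt0.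
pose H (p : R[i]) : R[i] := 1; pose DH (p : R[i]) : R[i] := 0.
have h1 a d t : u < Im (a + t%:C%C * d) ->
    cderiv (fun s => H (a + s%:C%C * d)) t (d * DH (a + t%:C%C * d)).
  by move=> _; rewrite mulr0; exact: cderiv_cst.
have h2 x y : u < y -> exists d, cderiv (fun t => DH (Complex t y)) x d.
  by move=> _; exists 0; exact: cderiv_cst.
have h3 p : u < Im p < 3 / 4 -> normc (H p) <= 1 * expR (0 * `|Re p|).
  by move=> _; rewrite normc1 mul0r expR0 mulr1.
have h4 p : u < Im p < 3 / 4 -> normc (DH p) <= 1 * expR (0 * `|Re p|).
  by move=> _; rewrite normc0 mul0r expR0 mulr1.
have [C hC] := over_sh_le p0 h3 su.
have hle p : u < Im p < 3 / 4 -> normc (over_sh H p) <= C * kappa (Re p).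
  move=> hp; apply: hC => //; apply: sh_pi_ge_sin; last exact: hy.
  by rewrite (ltW su) sin_le1.
have hs y : u < y < 3 / 4 -> y != 2 -> sin (pi * y) != 0.
  by move=> /hy h _; rewrite -normr_gt0 (lt_le_trans su).
have ue : u < e < 3 / 4 by rewrite /u; apply/andP; split; lra.
have u2 : u < (2^-1 : R) < 3 / 4 by rewrite /u; apply/andP; split; lra.
have := over_sh_shift p0 h1 h2 h3 h4 (lexx _) hs hle ue u2.
rewrite /over_sh; under eq_fun do rewrite mul1r.
move=> ->; under eq_fun do rewrite mul1r.
have E x : (sh (pi%:C%C * Complex x 2^-1))^-1 =
    - 'i%C * ((expR (pi * x) + expR (- (pi * x)))^-1)%:C%C.
  have c2 : cos (pi * 2^-1) = 0 :> R by exact: cos_pihalf.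
  have s2 : sin (pi * 2^-1) = 1 :> R by exact: sin_pihalf.
  have -> : sh (pi%:C%C * Complex x 2^-1) =
      'i%C * (expR (pi * x) + expR (- (pi * x)))%:C%C.
    rewrite /sh; apply: complexP;
      rewrite !(ReD, ReN, ImD, ImN) !(Re_cexp, Im_cexp) !ReIm /=.
      by rewrite !(mul0r, subr0, addr0) cosN c2; ring.
    by rewrite !(mul0r, subr0, addr0) sinN s2; ring.
  rewrite invfM; congr (_ * _); last by rewrite fmorphV.
  by apply: complexP; rewrite ?ReV ?ImV /= ?oppr0 ?mul0r ?expr0n ?expr1n ?add0r ?divr1.
under eq_fun do rewrite E.
have ReE (r : R) : Re (- 'i%C * r%:C%C) = 0.
  by rewrite !ReIm oppr0 mul0r mulr0 subr0.
have ImE (r : R) : Im (- 'i%C * r%:C%C) = - r.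
  by rewrite !ReIm oppr0 mul0r add0r mulN1r.
have half : (2 : R[i])^-1 = (2^-1 : R)%:C%C by rewrite fmorphV rmorphMn.
rewrite half; apply: complexP; rewrite ?ReE ?ImE /cintegral.
  rewrite -[LHS]/(\int[mu]_x Re (- 'i%C * ((expR (pi * x) + expR (- (pi * x)))^-1)%:C%C)).
  under eq_Rintegral do rewrite ReE.
  by rewrite Rintegral_cst// mul0r.
rewrite -[LHS]/(\int[mu]_x Im (- 'i%C * ((expR (pi * x) + expR (- (pi * x)))^-1)%:C%C)).
rewrite -integral_sech -[RHS]mulN1r -RintegralZl//; last exact: integrable_sech.
by apply: eq_Rintegral => x _; rewrite ImE mulN1r.
Qed.

End residue.

(** * The residue at i *)

Section residue_step.
Context {R : realType}.
Local Notation mu := (@lebesgue_measure R).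
Local Notation RR := (measurableTypeR R).
Implicit Types (x y s t : R) (p a d : R[i]).

Variables (G DG : R[i] -> R[i]) (e b K : R).
Hypothesis e_lt : 0 < e < 2^-1.
Hypothesis b_lt : 0 <= b < pi.
Hypothesis G_der : forall a d t, e / 2 < Im (a + t%:C%C * d) ->
  cderiv (fun s => G (a + s%:C%C * d)) t (d * DG (a + t%:C%C * d)).
Hypothesis DG_der : forall x y, e / 2 < y ->
  exists d, cderiv (fun t => DG (Complex t y)) x d.
Hypothesis G_le : forall p, e / 2 < Im p < 3 / 2 ->
  normc (G p) <= K * expR (b * `|Re p|).
Hypothesis DG_le : forall p, e / 2 < Im p < 3 / 2 ->
  normc (DG p) <= K * expR (b * `|Re p|).

Let H p := G p - G 'i%C.

Let H_der a d t : e / 2 < Im (a + t%:C%C * d) ->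
  cderiv (fun s => H (a + s%:C%C * d)) t (d * DG (a + t%:C%C * d)).
Proof.
move=> ut; apply: cderiv_eq (cderivB (G_der ut) (cderiv_cst _ _)) _.
by rewrite subr0.
Qed.

Let K_ge0 : 0 <= K.
Proof.
have h : e / 2 < Im ('i%C : R[i]) < 3 / 2.
  by rewrite Imi; have /andP[? ?] := e_lt; apply/andP; split; lra.
have := le_trans (normc_ge0 _) (G_le h).
by rewrite pmulr_lge0 ?expR_gt0.
Qed.

Let M := K + normc (G 'i%C).

Let H_le p : e / 2 < Im p < 3 / 2 -> normc (H p) <= M * expR (b * `|Re p|).
Proof.
move=> /G_le hG; rewrite (le_trans (ler_normcB _ _))// mulrDl lerD//.
rewrite ler_peMr ?normc_ge0// -expR0 ler_expR mulr_ge0//.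
by case/andP: b_lt.
Qed.

Let DH_le p : e / 2 < Im p < 3 / 2 -> normc (DG p) <= M * expR (b * `|Re p|).
Proof.
move=> /DG_le h; apply: le_trans h _.
by rewrite ler_wpM2r ?expR_ge0// lerDl normc_ge0.
Qed.

(** Near its zero at [i] the numerator is Lipschitz, which beats the simple
    zero of the denominator. *)
Let over_sh_near : exists C, forall p, e / 2 < Im p < 3 / 2 ->
  `|Re p| <= 1 -> `|Im p - 1| <= 4^-1 ->
  normc (over_sh H p) <= C * kappa (Re p).
Proof.
have [C0 C0_gt0 hC0] := @normc_sh_ge_near R.
have /andP[e0 e2] := e_lt; have /andP[b0 bpi] := b_lt.
exists (2 * K * expR b * C0 / pi * 2) => p hp x1 y1.
pose q := p - 'i%C.
have iq : 'i%C + q = p by rewrite addrC subrK.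
have Hq : normc (H p) <= 2 * (normc q * (K * expR b)).
  have := @cderiv_le _ (fun s => G ('i%C + s%:C%C * q))
    (fun s => q * DG ('i%C + s%:C%C * q)) (normc q * (K * expR b)).
  rewrite /= !mul0r !addr0 mul1r iq.
  have Imq s : Im ('i%C + s%:C%C * q) = 1 + s * (Im p - 1).
    by rewrite /q !ReIm mul0r addr0.
  have strip s : 0 <= s <= 1 -> e / 2 < Im ('i%C + s%:C%C * q) < 3 / 2.
    move=> /andP[s0 s1]; rewrite Imq.
    move: y1; rewrite ler_norml => /andP[ya yb].
    by apply/andP; split; nra.
  apply=> s s01.
    by apply: G_der; case/andP: (strip _ s01).
  rewrite normcM ler_wpM2l ?normc_ge0// (le_trans (DG_le (strip _ s01)))//.
  rewrite ler_wpM2l ?K_ge0// ler_expR ler_piMr//.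
  rewrite /q !ReIm mul0r !subr0 add0r; case/andP: s01 => s0 s1.
  rewrite normrM (ger0_norm s0); have := normr_ge0 (Re p); nra.
have hsh : pi * normc q <= C0 * normc (sh (pi%:C%C * p)).
  have shE : normc (sh (pi%:C%C * p)) = normc (sh (pi%:C%C * q)).
    by rewrite -[RHS]normcN -sh_piDi /q subrK.
  have := hC0 (pi%:C%C * q).
  rewrite shE normcM normcR [`|pi|]ger0_norm ?pi_ge0//; apply.
  rewrite Im_piM /q !ReIm normrM ger0_norm ?pi_ge0//.
  have := @pi_lt4 R; have := @pi_gt0 R; have := normr_ge0 (Im p - 1); nra.
have k2 : 1 <= 2 * kappa (Re p).
  rewrite /kappa ler_pdivlMr ?ltr_pwDl ?sqr_ge0// mul1r.
  rewrite -[Re p ^+ 2]real_normK ?num_real//; have := normr_ge0 (Re p); nra.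
have CC : 0 <= 2 * K * expR b * C0 / pi.
  by rewrite divr_ge0 ?pi_ge0// !mulr_ge0 ?expR_ge0 ?K_ge0// ltW.
rewrite -[leRHS]mulrA (@le_trans _ _ (2 * K * expR b * C0 / pi))//; last first.
  by rewrite ler_peMr.
rewrite /over_sh normcM normcV.
have := normc_ge0 (sh (pi%:C%C * p)); rewrite le_eqVlt => /predU1P[<-|s0].
  by rewrite invr0 mulr0.
rewrite ler_pdivrMr// (le_trans Hq)//.
have -> : 2 * (normc q * (K * expR b)) = 2 * K * expR b / pi * (pi * normc q).
  by move: (pi : R) (@pi_gt0 R) => P P0; field; rewrite gt_eqF.
have -> : 2 * K * expR b * C0 / pi * normc (sh (pi%:C%C * p)) =
    2 * K * expR b / pi * (C0 * normc (sh (pi%:C%C * p))) by ring.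
by rewrite ler_wpM2l// divr_ge0 ?pi_ge0// !mulr_ge0 ?expR_ge0 ?K_ge0.
Qed.

(** Three regions: near the pole, at height at least [1/4] away from it, and at
    real part at least 1, where the height does not matter. *)
Let over_sh_strip : exists C, forall p, e / 2 < Im p < 3 / 2 ->
  normc (over_sh H p) <= C * kappa (Re p).
Proof.
have /andP[e0 e2] := e_lt.
have su : 0 < sin (pi * (e / 2)).
  by rewrite sin_pi_gt0// divr_gt0//=; lra.
have h2 : (0 : R) < 2^-1 by rewrite invr_gt0.
have [C1 hC1] := over_sh_near.
have [C2 hC2] := over_sh_le b_lt H_le su.
have [C3 hC3] := over_sh_le b_lt H_le h2.
have mono C p : C <= Num.max C1 (Num.max C2 C3) ->
    normc (over_sh H p) <= C * kappa (Re p) ->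
    normc (over_sh H p) <= Num.max C1 (Num.max C2 C3) * kappa (Re p).
  by move=> h /le_trans; apply; rewrite ler_wpM2r ?kappa_ge0.
exists (Num.max C1 (Num.max C2 C3)) => p hp.
have [x1|x1] := leP `|Re p| 1; last first.
  apply: (mono C3); first by rewrite !le_max lexx !orbT.
  apply: hC3 => //; have := @normc_sh_ge_far _ (pi%:C%C * p).
  rewrite Re_piM expR_pi_abs [_ / 2]mulrC; apply.
  rewrite normrM ger0_norm ?pi_ge0//; have := @pi_ge2 R; nra.
have [y1|y1] := leP `|Im p - 1| 4^-1.
  by apply: (mono C1); [rewrite !le_max lexx|exact: hC1].
apply: (mono C2); first by rewrite !le_max lexx !orbT.
apply: hC2 => //; apply: sh_pi_ge_sin; first by rewrite (ltW su) sin_le1.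
apply: sin_pi_ge_away => //; last exact: ltW.
by apply/andP; split; lra.
Qed.

(** The strip [e <= Im p <= 1 + e] contains the single pole [i] of
    [1 / sh (pi p)], and [sh (pi (p + i)) = - sh (pi p)]. *)
Lemma cintegral_over_sh_shift :
  cintegral mu (fun x : RR => G (Complex x e) / sh (pi%:C%C * Complex x e)) +
  cintegral mu (fun x : RR => G (Complex x e + 'i%C) / sh (pi%:C%C * Complex x e))
  = - 'i%C * G 'i%C.
Proof.
have /andP[e0 e2] := e_lt.
have [C hC] := over_sh_strip.
have hs y : e / 2 < y < 3 / 2 -> y != 1 -> sin (pi * y) != 0.
  move=> /andP[ya yb] y1.
  have [y_lt|y_ge] := ltP y 1.
    by rewrite gt_eqF// sin_pi_gt0// y_lt (lt_trans _ ya)// divr_gt0.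
  rewrite -oppr_eq0 -sin_pi_B1 gt_eqF// sin_pi_gt0//.
  by rewrite subr_gt0 lt_neqAle eq_sym y1 y_ge; lra.
have he : e / 2 < e < 3 / 2 by apply/andP; split; lra.
have he1 : e / 2 < 1 + e < 3 / 2 by apply/andP; split; lra.
have e_n : sin (pi * e) != 0 by apply: hs => //; rewrite lt_eqF//; lra.
have e1_n : sin (pi * (1 + e)) != 0 by apply: hs => //; rewrite gt_eqF//; lra.
have := over_sh_shift b_lt H_der DG_der H_le DH_le (lexx _) hs hC he he1.
have iG := cintegrable_over_sh b_lt G_der G_le he e_n.
have iG1 := cintegrable_over_sh b_lt G_der G_le he1 e1_n.
have p0 : 0 <= (0 : R) < pi by rewrite lexx pi_gt0.
have i1 : cintegrable mu (fun x : RR => (sh (pi%:C%C * Complex x e))^-1).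
  rewrite (_ : (fun x : RR => _) = (fun x : RR => over_sh (fun=> 1) (Complex x e))).
    apply: (@cintegrable_over_sh _ (fun=> 1) (fun=> 0) (e / 2) (3 / 2) 0 1 p0) => //.
    - by move=> a d t _; rewrite mulr0; exact: cderiv_cst.
    - by move=> p _; rewrite normc1 mul0r expR0 mulr1.
  by apply/funext => x; rewrite /over_sh mul1r.
(* the constant [G i] integrates against [1 / sh] to a known value *)
have E x : over_sh H (Complex x e) =
    over_sh G (Complex x e) - G 'i%C * (sh (pi%:C%C * Complex x e))^-1.
  by rewrite /over_sh /H mulrBl.
have S x : Complex x (1 + e) = Complex x e + 'i%C.
  by apply: complexP; rewrite !ReIm /= ?addr0// addrC.
have E1 x : over_sh H (Complex x (1 + e)) =
    over_sh G (Complex x (1 + e)) + G 'i%C * (sh (pi%:C%C * Complex x e))^-1.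
  by rewrite /over_sh /H S sh_piDi invrN; ring.
have F1 : cintegral mu (fun x : RR => G (Complex x e + 'i%C) / sh (pi%:C%C * Complex x e))
    = - cintegral mu (fun x : RR => over_sh G (Complex x (1 + e))).
  rewrite -mulN1r -cintegralZ//; congr cintegral; apply/funext => x.
  by rewrite /over_sh S sh_piDi invrN; ring.
rewrite F1; under eq_fun do rewrite E.
rewrite cintegralB//; last exact: cintegrableZ.
under [in X in _ = X -> _]eq_fun do rewrite E1.
rewrite cintegralD//; last exact: cintegrableZ.
rewrite !cintegralZ// cintegral_inv_sh// => /eqP.
rewrite -subr_eq0 => /eqP h.
rewrite -[X in X - _]/(cintegral mu (fun x : RR => over_sh G (Complex x e))).
apply/eqP; rewrite -subr_eq0; apply/eqP; rewrite -[RHS]h.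
by field.
Qed.

End residue_step.

(** * The factors of the integrand *)

Section factors.
Context {R : realType}.
Local Notation mu := (@lebesgue_measure R).
Local Notation RR := (measurableTypeR R).
Implicit Types (x y s t u V : R) (p q a d w z : R[i]) (G L : R[i] -> R[i]).

Definition li_factor w (n : int) z : R[i] := cexp (- ('i%C * z * w)) / z ^ n.

(** Both signs of the exponent at once: a negative power is bounded by its value
    at [u], a positive one by a power of [1 + r]. *)
Lemma expz_le u (n : int) : 0 < u -> exists2 K : R, 0 < K &
  forall r, u <= r -> r ^ n <= K * (1 + r) ^+ `|n|%N.
Proof.
move=> u0; case: n => n.
  exists 1 => // r ur; rewrite mul1r -exprnP absz_nat lerXn2r ?nnegrE ?lerDr//.
    by rewrite (le_trans (ltW u0)).
  by rewrite addr_ge0// (le_trans (ltW u0)).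
exists (u ^- n.+1) => [|r ur]; first by rewrite invr_gt0 exprn_gt0.
have r0 := lt_le_trans u0 ur.
rewrite NegzE -exprnN abszN absz_nat (@le_trans _ _ (u ^- n.+1))//.
  by rewrite lef_pV2 ?posrE ?exprn_gt0// lerXn2r ?nnegrE// ltW.
by rewrite ler_peMr ?invr_ge0 ?exprn_ge0 ?(ltW u0)// exprn_ege1// lerDl ltW.
Qed.

Lemma Re_expo z w : Re (- ('i%C * z * w)) = Re z * Im w + Im z * Re w.
Proof. by rewrite !ReIm; ring. Qed.

Lemma normc_li_factor w n z :
  normc (li_factor w n z) = expR (Re z * Im w + Im z * Re w) * normc z ^ (- n).
Proof. by rewrite normcM normcV normcXz normc_cexp Re_expo invr_expz. Qed.

Lemma normc_ge_Im u z : u < Im z -> u <= normc z.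
Proof.
by move=> uz; rewrite (le_trans (ltW uz))// (le_trans (ler_norm _))// Im_le_normc.
Qed.

Lemma Im_neq0 z : 0 < Im z -> z != 0.
Proof. by apply: contraTneq => ->; rewrite Im0 ltxx. Qed.

(** Holomorphic functions on a half plane with bounded logarithmic derivative
    and growth at most [exp (V Re p)] up to powers: the class is stable under
    products, [V] being additive. *)
Definition admissible u V G : Prop := exists L,
  [/\ forall a d t, u < Im (a + t%:C%C * d) ->
        cderiv (fun s => G (a + s%:C%C * d)) t
          (d * (G (a + t%:C%C * d) * L (a + t%:C%C * d))),
      forall a d t, u < Im (a + t%:C%C * d) ->
        exists d', cderiv (fun s => L (a + s%:C%C * d)) t d',
      exists2 K, 0 <= K & forall p, u < Im p -> normc (L p) <= K &
      exists K N, 0 <= K /\ forall p, u < Im p < 3 / 2 ->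
        normc (G p) <= K * (1 + `|Re p|) ^+ N * expR (V * Re p)].

Lemma admissible_cst u c : admissible u 0 (fun=> c).
Proof.
exists (fun=> 0); split.
- by move=> a d t _; rewrite !mulr0; exact: cderiv_cst.
- by move=> a d t _; exists 0; exact: cderiv_cst.
- by exists 0 => // p _; rewrite normc0.
- exists (normc c), 0%N; split=> [|p _]; first exact: normc_ge0.
  by rewrite mul0r expR0 expr0 !mulr1.
Qed.

Lemma admissibleM u V V' G G' : admissible u V G -> admissible u V' G' ->
  admissible u (V + V') (fun p => G p * G' p).
Proof.
move=> [L [Ga La [K K0 LK] [M [N [M0 GM]]]]] [L' [Ga' La' [K' K'0 LK'] [M' [N' [M'0 GM']]]]].
exists (fun p => L p + L' p); split.
- move=> a d t ut.
  by apply: cderiv_eq (cderivM (Ga _ _ _ ut) (Ga' _ _ _ ut)) _; ring.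
- move=> a d t ut; have [l hl] := La _ _ _ ut; have [l' hl'] := La' _ _ _ ut.
  by exists (l + l'); exact: cderivD.
- exists (K + K'); first exact: addr_ge0.
  move=> p up; rewrite (le_trans (ler_normcD _ _))// lerD//; [exact: LK|exact: LK'].
- exists (M * M'), (N + N')%N; split; first exact: mulr_ge0.
  move=> p up; rewrite normcM mulrDl expRD exprD.
  rewrite (_ : M * M' * _ * _ = (M * (1 + `|Re p|) ^+ N * expR (V * Re p)) *
    (M' * (1 + `|Re p|) ^+ N' * expR (V' * Re p))); last by ring.
  by apply: ler_pM; rewrite ?normc_ge0//; [exact: GM|exact: GM'].
Qed.

Lemma admissible_prod u m (V : 'I_m -> R) (G : 'I_m -> R[i] -> R[i]) :
  (forall k, admissible u (V k) (G k)) ->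
  admissible u (\sum_(k < m) V k) (fun p => \prod_(k < m) G k p).
Proof.
elim: m V G => [|m IH] V G h.
  rewrite big_ord0 (_ : (fun p => _) = fun=> 1); first exact: admissible_cst.
  by apply/funext => p; rewrite big_ord0.
rewrite big_ord_recl (_ : (fun p => _) =
  fun p => G ord0 p * \prod_(k < m) G (lift ord0 k) p).
  by apply: admissibleM => //; apply: IH => k.
by apply/funext => p; rewrite big_ord_recl.
Qed.

Lemma admissible_li_factor u w n q : 0 < u -> 0 <= Im q ->
  admissible u (Im w) (fun p => li_factor w n (p + q)).
Proof.
move=> u0 q0.
have pq p : u < Im p -> u < Im (p + q).
  by move=> up; rewrite ImD (lt_le_trans up)// lerDl.
have n0 p : u < Im p -> p + q != 0.
  by move=> /pq /(lt_trans u0); exact: Im_neq0.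
exists (fun p => - ('i%C * w) - n%:~R / (p + q)); split.
- move=> a d t ut; have h0 := n0 _ ut.
  have hl : cderiv (fun s => a + s%:C%C * d + q) t d.
    by apply: cderiv_eq (cderivD (cderiv_line a d t) (cderiv_cst q t)) _; rewrite addr0.
  have hz := cderivXz (- n) h0 hl.
  have he : cderiv (fun s => cexp (- ('i%C * w) * (a + s%:C%C * d + q))) t _ :=
    cderiv_cexp (cderivZ (- ('i%C * w)) hl).
  apply: (cderiv_ext (f := fun s => cexp (- ('i%C * w) * (a + s%:C%C * d + q)) *
    (a + s%:C%C * d + q) ^ (- n))) => [s|].
    by rewrite /li_factor invr_expz; congr (cexp _ * _); ring.
  apply: cderiv_eq (cderivM he hz) _.
  rewrite /li_factor -invr_expz mulrNz.
  rewrite (_ : - ('i%C * (_ + q) * w) = - ('i%C * w) * (a + t%:C%C * d + q)); last by ring.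
  move: (cexp _) => E; move: (_ ^ n)^-1 => F.
  by field.
- move=> a d t ut; eexists; apply: cderivB; first exact: cderiv_cst.
  apply: cderivZ; apply: cderivV; first exact: n0.
  by apply: cderivD; [exact: cderiv_line|exact: cderiv_cst].
- exists (normc w + normc (n%:~R : R[i]) / u).
    by rewrite addr_ge0 ?divr_ge0 ?normc_ge0// ltW.
  move=> p up; rewrite (le_trans (ler_normcB _ _))// normcN !normcM normci mul1r lerD2l.
  rewrite ler_wpM2l ?normc_ge0// normcV lef_pV2 ?posrE//.
    exact/normc_ge_Im/pq.
  by rewrite normc_gt0// n0.
have [K K0 hK] := expz_le (- n) u0.
exists (expR (`|Re q * Im w| + (3 / 2 + Im q) * `|Re w|) * K *
  (5 / 2 + normc q) ^+ `|n|%N), `|n|%N; split.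
  by rewrite !mulr_ge0 ?exprn_ge0 ?expR_ge0 ?(ltW K0)// addr_ge0 ?normc_ge0.
move=> p /andP[up p3]; rewrite normc_li_factor.
set A := expR (_ + _ * `|Re w|).
have h1 : expR (Re (p + q) * Im w + Im (p + q) * Re w) <= A * expR (Im w * Re p).
  rewrite -expRD ler_expR !ReIm.
  have := ler_norm (Re q * Im w).
  have : (Im p + Im q) * Re w <= (3 / 2 + Im q) * `|Re w|.
    rewrite (le_trans (ler_norm _))// normrM ler_wpM2r// ger0_norm ?lerD2r ?(ltW p3)//.
    by rewrite addr_ge0// ltW// (lt_trans u0).
  lra.
have h2 : normc (p + q) ^ (- n) <= K * (5 / 2 + normc q) ^+ `|n|%N * (1 + `|Re p|) ^+ `|n|%N.
  apply: le_trans (hK _ _) _; first exact/normc_ge_Im/pq.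
  rewrite abszN -mulrA ler_pM2l// -exprMn lerXn2r ?nnegrE ?addr_ge0 ?mulr_ge0
    ?normc_ge0 ?addr_ge0 ?normc_ge0//.
  have : normc (p + q) <= `|Re p| + `|Im p| + normc q.
    by rewrite (le_trans (ler_normcD _ _))// lerD2r normc_le_ReIm.
  have -> : `|Im p| = Im p by rewrite gtr0_norm// (lt_trans u0).
  have := normc_ge0 q; have := normr_ge0 (Re p); nra.
apply: le_trans (ler_pM _ _ h1 h2) _; rewrite ?expR_ge0 ?exprz_ge0 ?normc_ge0//.
by rewrite le_eqVlt; apply/orP; left; apply/eqP; ring.
Qed.

(** The bound [exp (V Re p)] times powers is at most [exp (b |Re p|)] for any
    [b] strictly between [|V|] and [pi]; the middle point is taken. *)
Lemma admissible_residue G e V : 0 < e < 2^-1 -> `|V| < pi ->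
  admissible (e / 2) V G ->
  cintegral mu (fun x : RR => G (Complex x e) / sh (pi%:C%C * Complex x e)) +
  cintegral mu (fun x : RR => G (Complex x e + 'i%C) / sh (pi%:C%C * Complex x e))
  = - 'i%C * G 'i%C.
Proof.
move=> e2 Vpi [L [Ga La [K K0 LK] [M [N [M0 GM]]]]].
pose b := (`|V| + pi) / 2.
have bV : 0 < b - `|V| by rewrite /b; lra.
have b0 : 0 <= b < pi.
  by have := normr_ge0 V; rewrite /b => ?; apply/andP; split; lra.
have [C C0 hC] := poly_le_expR N bV.
have GC p : e / 2 < Im p < 3 / 2 -> normc (G p) <= M * C * expR (b * `|Re p|).
  move=> /GM h; apply: le_trans h _.
  rewrite -mulrA -[M * C * _]mulrA ler_wpM2l//.
  apply: (@le_trans _ _ (C * expR ((b - `|V|) * `|Re p|) * expR (`|V| * `|Re p|))).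
    apply: ler_pM; rewrite ?exprn_ge0 ?expR_ge0 ?addr_ge0//; first exact: hC.
    by rewrite ler_expR -normrM ler_norm.
  by rewrite -mulrA -expRD -mulrDl subrK.
have MC : 0 <= M * C by rewrite mulr_ge0// ltW.
apply: (@cintegral_over_sh_shift _ G (fun p => G p * L p) e b (M * C + M * C * K)) => //.
- move=> x y ey; have := Ga (Complex 0 y) 1 x; have := La (Complex 0 y) 1 x.
  rewrite -ComplexEx => /(_ ey)[l hl] /(_ ey) hg; eexists.
  apply: (cderiv_ext (f := fun t => G (Complex 0 y + t%:C%C * 1) * L (Complex 0 y + t%:C%C * 1))).
    by move=> t; rewrite -ComplexEx.
  exact: cderivM hg hl.
- move=> p hp; rewrite (le_trans (GC _ hp))// ler_wpM2r ?expR_ge0// lerDl.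
  by rewrite mulr_ge0.
- move=> p hp; have /andP[ep _] := hp.
  rewrite normcM mulrDl (@le_trans _ _ (M * C * K * expR (b * `|Re p|)))//; last first.
    by rewrite lerDr mulr_ge0 ?expR_ge0.
  rewrite mulrAC; apply: ler_pM; rewrite ?normc_ge0//; [exact: GC|exact: LK].
Qed.

End factors.

(** * Lebesgue measure on tuples *)

Section tuple_measure.
Context {R : realType}.
Local Notation mu := (@lebesgue_measure R).
Local Notation RR := (measurableTypeR R).
Local Notation mut := (lebesgue_tuple R).

Definition tcons m (x : RR) (t : m.-tuple RR) : m.+1.-tuple RR :=
  @cons_pair _ RR m (x, t).

Lemma tnth_tcons0 m x (t : m.-tuple RR) : tnth (tcons x t) ord0 = x.
Proof. exact: tnth0. Qed.

Lemma tnth_tconsS m x (t : m.-tuple RR) j :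
  tnth (tcons x t) (lift ord0 j) = tnth t j.
Proof. exact: tnthS. Qed.

Lemma ge0_integral_tuple m (f : m.+1.-tuple RR -> \bar R) :
  measurable_fun setT f -> (forall t, 0 <= f t)%E ->
  (\int[mut m.+1]_t f t = \int[mut m]_t \int[mu]_x f (tcons x t))%E.
Proof.
move=> mf f0.
have mc := @measurable_cons_pair _ RR m.
rewrite [LHS](@ge0_integral_pushforward _ _ _ _ R (@cons_pair _ RR m) mc
  (mu \x mut m)%E setT f)//.
rewrite preimage_setT (fubini_tonelli2 (f \o @cons_pair _ RR m))//.
  exact: measurableT_comp.
by move=> x; exact: f0.
Qed.

(** The measure on tuples is an image of a product measure, so this is Fubini
    transported along the consing of a coordinate. *)
Lemma integral_tuple m (f : m.+1.-tuple RR -> \bar R) :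
  (mut m.+1).-integrable setT f ->
  (\int[mut m.+1]_t f t = \int[mut m]_t \int[mu]_x f (tcons x t))%E /\
  (mut m).-integrable setT (fun t => \int[mu]_x f (tcons x t))%E.
Proof.
move=> fi; have mf := measurable_int _ fi.
have mc := @measurable_cons_pair _ RR m.
have mfc : measurable_fun setT (f \o @cons_pair _ RR m) by exact: measurableT_comp.
have fci : (mu \x mut m)%E.-integrable setT (f \o @cons_pair _ RR m).
  apply/integrableP; split => //.
  have /integrableP[_] := fi.
  rewrite [X in (X < _)%E -> _](@ge0_integral_pushforward _ _ _ _ R
    (@cons_pair _ RR m) mc (mu \x mut m)%E setT (fun t => `|f t|%E))//.
  exact: measurableT_comp.
split.
  rewrite [LHS](@integral_pushforward _ _ _ _ R (@cons_pair _ RR m) mc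
    (mu \x mut m)%E setT f)//.
  by rewrite preimage_setT -integral21_prod_meas1.
apply/integrableP; split; first exact: measurable_fubini_G fci.
apply: le_lt_trans ((@integrable21ltyP _ _ _ _ R mu (mut m) _ mfc).1 fci).
apply: ge0_le_integral => //.
- by apply: measurableT_comp => //; exact: measurable_fubini_G fci.
- apply: (measurable_fun_fubini_tonelli_G (abse \o (f \o @cons_pair _ RR m))) => [|t] /=.
    exact: measurableT_comp.
  exact: abse_ge0.
- move=> t _; apply: le_abse_integral => //.
  exact: (measurableT_comp mfc (measurable_pair2 t)).
Qed.

Lemma Rintegral_tuple m (f : m.+1.-tuple RR -> R) :
  (mut m.+1).-integrable setT (EFin \o f) ->
  (forall t, mu.-integrable setT (fun x => (f (tcons x t))%:E)) ->
  (\int[mut m.+1]_t f t = \int[mut m]_t \int[mu]_x f (tcons x t))%R /\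
  (mut m).-integrable setT (fun t => (\int[mu]_x f (tcons x t))%:E).
Proof.
move=> fi si; have [E I] := integral_tuple fi.
have S : (fun t => \int[mu]_x (EFin \o f) (tcons x t))%E =
    (fun t => (\int[mu]_x f (tcons x t))%:E).
  by apply/funext => t; rewrite /Rintegral fineK// integrable_fin_num.
by split; [rewrite /Rintegral E S|rewrite -S].
Qed.

Lemma cintegral_tuple m (f : m.+1.-tuple RR -> R[i]) :
  cintegrable (mut m.+1) f ->
  (forall t, cintegrable mu (fun x : RR => f (tcons x t))) ->
  cintegral (mut m.+1) f =
    cintegral (mut m) (fun t => cintegral mu (fun x : RR => f (tcons x t))) /\
  cintegrable (mut m) (fun t => cintegral mu (fun x : RR => f (tcons x t))).
Proof.
move=> [fr fi] si.
have [Er Ir] := Rintegral_tuple fr (fun t => (si t).1).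
have [Ei Ii] := Rintegral_tuple fi (fun t => (si t).2).
by split=> //; apply: complexP.
Qed.

Lemma measurable_tuple_prod m (g : 'I_m -> R -> R) :
  (forall j, measurable_fun setT (g j : RR -> R)) ->
  measurable_fun setT (fun t : m.-tuple RR => \prod_(j < m) g j (tnth t j)).
Proof.
move=> mg; elim: (index_enum _) => [|j r IH].
  by under eq_fun do rewrite big_nil; exact: measurable_cst.
under eq_fun do rewrite big_cons.
apply: measurable_funM => //; apply: (measurableT_comp (mg j)).
exact: measurable_tnth.
Qed.

(** Tonelli, peeling off the first coordinate. Stated in extended reals so that
    it serves both to prove integrability and to exploit it. *)
Lemma integral_tuple_prod m (g : 'I_m -> R -> R) :
  (forall j, measurable_fun setT (g j : RR -> R)) -> (forall j x, 0 <= g j x) ->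
  (\int[mut m]_t (\prod_(j < m) g j (tnth t j))%:E =
   \prod_(j < m) \int[mu]_x (g j x)%:E)%E.
Proof.
elim: m g => [|m IH] g mg g0.
  rewrite big_ord0 (_ : (fun t => _) = cst 1%E); last first.
    by apply/funext => t; rewrite big_ord0.
  by rewrite integral_cst// mul1e /= diracT.
have mp n (h : 'I_n -> R -> R) := @measurable_tuple_prod n h.
rewrite ge0_integral_tuple; last 2 first.
- by apply/measurable_EFinP; exact: mp.
- by move=> t; rewrite lee_fin prodr_ge0.
have E (t : m.-tuple RR) :
    (\int[mu]_x (\prod_(j < m.+1) g j (tnth (tcons x t) j))%:E =
    \int[mu]_x (g ord0 x)%:E * (\prod_(j < m) g (lift ord0 j) (tnth t j))%:E)%E.
  rewrite muleC -ge0_integralZl_EFin//; last 3 first.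
  - by move=> x _; rewrite lee_fin.
  - by apply/measurable_EFinP; exact: mg.
  - by rewrite prodr_ge0.
  apply: eq_integral => x _; rewrite big_ord_recl mulrC EFinM tnth_tcons0.
  by congr (_%:E * _)%E; apply: eq_bigr => j _; rewrite tnth_tconsS.
under eq_integral do rewrite E.
rewrite ge0_integralZl//; last 3 first.
- apply/measurable_EFinP; apply: (mp _ (fun j => g (lift ord0 j))) => j.
  exact: mg.
- by move=> t _; rewrite lee_fin prodr_ge0.
- by apply: integral_ge0 => x _; rewrite lee_fin.
by rewrite (IH (fun j => g (lift ord0 j)))// big_ord_recl.
Qed.

Lemma integrable_tuple_prod m (g : 'I_m -> R -> R) :
  (forall j, measurable_fun setT (g j : RR -> R)) -> (forall j x, 0 <= g j x) ->
  (forall j, mu.-integrable setT (EFin \o g j)) ->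
  (mut m).-integrable setT (fun t => (\prod_(j < m) g j (tnth t j))%:E).
Proof.
move=> mg g0 ig; apply/integrableP; split.
  by apply/measurable_EFinP; exact: measurable_tuple_prod.
under eq_integral do rewrite gee0_abs ?lee_fin ?prodr_ge0//.
rewrite integral_tuple_prod// -ge0_fin_numE; last first.
  by apply: prode_ge0 => j _; apply: integral_ge0 => x _; rewrite lee_fin.
elim/big_ind: _ => // [x y|j _]; [exact: fin_numM|exact: (integrable_fin_num measurableT (ig j))].
Qed.

(** A product of nonzero factors in [[0, +oo]] is finite only if each factor is. *)
Lemma integrable_of_tuple_prod m (g : 'I_m -> R -> R) :
  (forall j, measurable_fun setT (g j : RR -> R)) -> (forall j x, 0 <= g j x) ->
  (forall j, (0 < \int[mu]_x (g j x)%:E)%E) ->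
  (mut m).-integrable setT (fun t => (\prod_(j < m) g j (tnth t j))%:E) ->
  forall j, mu.-integrable setT (EFin \o g j).
Proof.
move=> mg g0 gp /integrableP[_].
under eq_integral do rewrite gee0_abs ?lee_fin ?prodr_ge0//.
rewrite integral_tuple_prod// => lt j.
apply/integrableP; split; first by apply/measurable_EFinP; exact: mg.
rewrite (eq_integral (fun x : RR => (g j x)%:E)); last first.
  by move=> x _ /=; rewrite ger0_norm.
rewrite ltey; apply/eqP => E; move: lt; rewrite (bigD1 j)//= E gt0_mulye ?ltxx//.
by elim/big_ind: _ => // x y; exact: mule_gt0.
Qed.

End tuple_measure.

(** * The translated integrand *)

Section offset_integrand.
Context {R : realType}.
Local Notation mu := (@lebesgue_measure R).
Local Notation RR := (measurableTypeR R).
Local Notation mut := (lebesgue_tuple R).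
Implicit Types (a z : R[i]) (e c x : R).

Definition shift_fun T m (f : 'I_m.+1 -> T) : 'I_m -> T :=
  fun j => f (lift ord0 j).

Definition li_num m (n : 'I_m -> int) (w : 'I_m -> R[i]) a (p : 'I_m -> R[i]) :=
  \prod_(k < m) li_factor (w k) (n k) (a + partial_sum p k).

Definition li_den m (p : 'I_m -> R[i]) : R[i] :=
  \prod_(k < m) sh (pi%:C%C * p k).

(** The integrand with all partial sums translated by [a]. Fixing the first
    variable translates the partial sums of the others, so this family, unlike
    the original integrand, is closed under integration of one variable. *)
Definition li_off m (n : 'I_m -> int) (w : 'I_m -> R[i]) a (p : 'I_m -> R[i]) :=
  li_num n w a p / li_den p.

Lemma li_integrandE m (n : 'I_m -> int) (w p : 'I_m -> R[i]) :
  li_integrand n w p = li_off n w 0 p.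
Proof.
rewrite /li_integrand /li_off /li_num /li_den -prodf_div.
by apply: eq_bigr => k _; rewrite add0r /li_factor mulrAC.
Qed.

Lemma partial_sum0 m (p : 'I_m.+1 -> R[i]) : partial_sum p ord0 = p ord0.
Proof.
rewrite /partial_sum (bigD1 ord0)//= big1 ?addr0// => j /andP[j0 /negP[]].
by apply/eqP/val_inj; move: j0; rewrite leqn0 => /eqP.
Qed.

Lemma partial_sumS m (p : 'I_m.+1 -> R[i]) k :
  partial_sum p (lift ord0 k) = p ord0 + partial_sum (shift_fun p) k.
Proof.
rewrite /partial_sum big_mkcond big_ord_recl/=; congr (_ + _).
by rewrite [RHS]big_mkcond.
Qed.

Lemma li_numS m (n : 'I_m.+1 -> int) w a p :
  li_num n w a p = li_factor (w ord0) (n ord0) (a + p ord0) *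
    li_num (shift_fun n) (shift_fun w) (a + p ord0) (shift_fun p).
Proof.
rewrite /li_num big_ord_recl partial_sum0; congr (_ * _).
by apply: eq_bigr => k _; rewrite partial_sumS addrA.
Qed.

Lemma li_denS m (p : 'I_m.+1 -> R[i]) :
  li_den p = sh (pi%:C%C * p ord0) * li_den (shift_fun p).
Proof. exact: big_ord_recl. Qed.

Lemma li_offS m (n : 'I_m.+1 -> int) w a p :
  li_off n w a p = li_factor (w ord0) (n ord0) (a + p ord0) /
    sh (pi%:C%C * p ord0) *
    li_off (shift_fun n) (shift_fun w) (a + p ord0) (shift_fun p).
Proof. by rewrite /li_off li_numS li_denS invfM mulrACA. Qed.

Definition contour_pt e m (t : m.-tuple RR) : 'I_m -> R[i] :=
  fun j => Complex (tnth t j) e.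

Lemma contour_pt0 e m x (t : m.-tuple RR) :
  contour_pt e (tcons x t) ord0 = Complex x e.
Proof. by rewrite /contour_pt tnth_tcons0. Qed.

Lemma shift_contour_pt e m x (t : m.-tuple RR) :
  shift_fun (contour_pt e (tcons x t)) = contour_pt e t.
Proof. by apply/funext => j; rewrite /shift_fun /contour_pt tnth_tconsS. Qed.

Lemma on_contourE m (n : 'I_m -> int) w e :
  on_contour (li_integrand n w) e = fun t => li_off n w 0 (contour_pt e t).
Proof. by apply/funext => t; rewrite /on_contour li_integrandE. Qed.

Lemma cmeasurable_li_off m (n : 'I_m -> int) w a e :
  cmeasurable (fun t : m.-tuple RR => li_off n w a (contour_pt e t)).
Proof.
have mpt j : cmeasurable (fun t : m.-tuple RR => contour_pt e t j).
  by apply: cmeasurable_Complex; exact: measurable_tnth.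
apply: cmeasurableM.
  apply: cmeasurable_prod => k.
  have mz : cmeasurable (fun t : m.-tuple RR => a + partial_sum (contour_pt e t) k).
    by apply: cmeasurableD; [exact: cmeasurable_cst|exact: cmeasurable_sum].
  apply: cmeasurableM; last by apply: cmeasurableV; exact: cmeasurableXz.
  apply: cmeasurable_cexp; apply: cmeasurableN.
  apply: cmeasurableM; last exact: cmeasurable_cst.
  by apply: cmeasurableM => //; exact: cmeasurable_cst.
apply: cmeasurableV; apply: cmeasurable_prod => k; apply: cmeasurable_sh.
by apply: cmeasurableM => //; exact: cmeasurable_cst.
Qed.

(** [tail_Im w k] is the exponential rate in [p_k]: the variable [p_k] enters
    exactly the partial sums of index at least [k]. *)
Definition tail_Im m (w : 'I_m -> R[i]) (k : 'I_m) : R :=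
  \sum_(j < m | (k <= j)%N) Im (w j).

Lemma tail_Im0 m (w : 'I_m.+1 -> R[i]) : tail_Im w ord0 = Im (\sum_(j < m.+1) w j).
Proof. by rewrite Im_sum; apply: eq_bigl => j; rewrite leq0n. Qed.

Lemma tail_ImS m (w : 'I_m.+1 -> R[i]) k :
  tail_Im w (lift ord0 k) = tail_Im (shift_fun w) k.
Proof. by rewrite /tail_Im big_mkcond big_ord_recl/= add0r [RHS]big_mkcond. Qed.

(** The exponential part of the modulus of [li_off] ([a] enters through the sum
    of all the [w_k]). *)
Definition li_size m (w : 'I_m -> R[i]) a (t : m.-tuple RR) : R :=
  expR (Re (- ('i%C * a * \sum_(j < m) w j))) *
  \prod_(j < m) expR (tnth t j * tail_Im w j - pi * `|tnth t j|).

Definition li_pol m a (t : m.-tuple RR) : R :=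
  (1 + normc a) * \prod_(j < m) (1 + `|tnth t j|).

Lemma li_pol_ge m a (t : m.-tuple RR) : 1 + normc a <= li_pol a t.
Proof.
rewrite ler_peMr ?addr_ge0 ?normc_ge0//.
elim/big_ind: _ => // [x y x1 y1|j _]; last by rewrite lerDl.
by rewrite -[1]mulr1 ler_pM.
Qed.

Lemma li_pol_ge0 m a (t : m.-tuple RR) : 0 <= li_pol a t.
Proof. by rewrite (le_trans _ (li_pol_ge a t))// addr_ge0 ?normc_ge0. Qed.

Lemma li_size_ge0 m w a (t : m.-tuple RR) : 0 <= li_size w a t.
Proof. by rewrite mulr_ge0 ?expR_ge0// prodr_ge0// => j _; rewrite expR_ge0. Qed.

(** With [li_sizeS], the induction step of the comparison of the integrand with
    [li_size]. *)
Lemma li_polS m a e x (t : m.-tuple RR) : 0 < e < 1 ->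
  li_pol (a + Complex x e) t <= 2 * li_pol a (tcons x t).
Proof.
move=> /andP[e0 e1]; rewrite /li_pol big_ord_recl tnth_tcons0.
under [in leRHS]eq_bigr do rewrite tnth_tconsS.
rewrite !mulrA; apply: ler_wpM2r.
  by apply: prodr_ge0 => j _; rewrite addr_ge0.
have : normc (a + Complex x e) <= normc a + (`|x| + e).
  rewrite (le_trans (ler_normcD _ _))// lerD2l (le_trans (normc_le_ReIm _))//=.
  by rewrite lerD2l ger0_norm// ltW.
have := normc_ge0 a; have := normr_ge0 x; nra.
Qed.

Lemma li_sizeS m (w : 'I_m.+1 -> R[i]) a e x (t : m.-tuple RR) :
  expR (Re (- ('i%C * (a + Complex x e) * w ord0))) * expR (- (pi * `|x|)) *
    li_size (shift_fun w) (a + Complex x e) t =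
  expR (e * Re (\sum_(j < m.+1) w j)) * li_size w a (tcons x t).
Proof.
rewrite /li_size [in RHS]big_ord_recl tnth_tcons0 tail_Im0.
have -> : \prod_(j < m) expR (tnth (tcons x t) (lift ord0 j) *
    tail_Im w (lift ord0 j) - pi * `|tnth (tcons x t) (lift ord0 j)|) =
    \prod_(j < m) expR (tnth t j * tail_Im (shift_fun w) j - pi * `|tnth t j|).
  by apply: eq_bigr => j _; rewrite tnth_tconsS tail_ImS.
rewrite !mulrA; congr (_ * _); rewrite -!expRD; congr expR.
rewrite [in RHS]big_ord_recl.
rewrite -[in RHS]/(\sum_(j < m) shift_fun w j).
move: (\sum_(j < m) _) => W.
by rewrite !ReIm /=; ring.
Qed.

End offset_integrand.

Section offset_bounds.
Context {R : realType}.
Local Notation mu := (@lebesgue_measure R).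
Local Notation RR := (measurableTypeR R).
Local Notation mut := (lebesgue_tuple R).
Implicit Types (a z : R[i]) (e c x : R).

Lemma tconsP m (t : m.+1.-tuple RR) : exists x t', t = tcons x t'.
Proof. by exists (thead t), [tuple of behead t]; rewrite [LHS]tuple_eta. Qed.

(** Summation by parts turns [sum_k P_k w_k] into [sum_k p_k (w_k + ... + w_m)],
    so each variable contributes [exp (x V - pi |x|)], up to powers of [1 + |x|].
    The upper bound gives convergence, the lower one its necessary condition. *)
Lemma li_off_size m (n : 'I_m -> int) (w : 'I_m -> R[i]) e : 0 < e < 1 ->
  exists C N, 0 < C /\ forall a t, 0 <= Im a ->
    normc (li_off n w a (contour_pt e t)) <= C * li_pol a t ^+ N * li_size w a t /\
    li_size w a t <= C * li_pol a t ^+ N * normc (li_off n w a (contour_pt e t)).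
Proof.
move=> e01; elim: m n w => [|m IH] n w.
  exists 1, 0%N; split=> // a t _; rewrite !expr0 !mulr1 !mul1r.
  rewrite /li_off /li_num /li_den /li_size !big_ord0 invr1 !mulr1 mulr0.
  by rewrite oppr0 Re0 expR0 normc1.
have [C [N [C0 hC]]] := IH (shift_fun n) (shift_fun w).
have /andP[e0 e1] := e01.
have [K1 K10 hK1] := expz_le (- n ord0) e0.
have [K2 K20 hK2] := expz_le (n ord0) e0.
pose K := K1 + K2; pose M := (N + `|n ord0|%N)%N.
have K0 : 0 < K by rewrite addr_gt0.
pose s := sin (pi * e); have s0 : 0 < s by rewrite sin_pi_gt0.
pose k := expR (e * Re (\sum_(j < m.+1) w j)).
have k0 : 0 < k by exact: expR_gt0.
exists ((K * C * k / s + 2 * K * C / k) * 2 ^+ M), M.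
split.
  by rewrite mulr_gt0 ?exprn_gt0// addr_gt0 ?divr_gt0 ?mulr_gt0.
move=> a t a0; have [x [t' ->{t}]] := tconsP t.
have := li_sizeS w a e x t'; have := li_polS a x t' e01.
rewrite li_offS contour_pt0 shift_contour_pt.
set z := a + Complex x e.
have ze : e <= Im z by rewrite ImD lerDr.
have z0 : 0 <= Im z by rewrite (le_trans (ltW e0)).
have ez : e <= normc z.
  by rewrite (le_trans ze)// (le_trans (ler_norm _))// Im_le_normc.
have nz : 0 < normc z := lt_le_trans e0 ez.
have := hC z t' z0; move: (li_off _ _ z _) => L [].
rewrite !normcM !normcV; have := li_pol_ge z t'.
rewrite normc_cexp normcXz invr_expz.
have r1 : normc z ^ (- n ord0) <= K * (1 + normc z) ^+ `|n ord0|%N.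
  rewrite (le_trans (hK1 _ ez))// abszN ler_wpM2r ?exprn_ge0 ?addr_ge0 ?normc_ge0//.
  by rewrite lerDl ltW.
have r2 : 1 <= K * (1 + normc z) ^+ `|n ord0|%N * normc z ^ (- n ord0).
  rewrite -invr_expz ler_pdivlMr ?exprz_gt0// mul1r.
  rewrite (le_trans (hK2 _ ez))// ler_wpM2r ?exprn_ge0 ?addr_ge0 ?normc_ge0//.
  by rewrite lerDr ltW.
have r0 : 0 < normc z ^ (- n ord0) by rewrite exprz_gt0.
have S1 : s <= normc (sh (pi%:C%C * Complex x e)) * expR (- (pi * `|x|)).
  rewrite expRN ler_pdivlMr ?expR_gt0//.
  apply: (@sh_pi_ge_sin _ s (Complex x e)); last exact: ler_norm.
  by rewrite (ltW s0) sin_le1.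
have S2 : normc (sh (pi%:C%C * Complex x e)) * expR (- (pi * `|x|)) <= 2.
  rewrite expRN ler_pdivrMr ?expR_gt0// (le_trans (normc_sh_le _))//.
  by rewrite Re_piM expR_pi_abs.
have Ep0 := expR_gt0 (- (pi * `|x|)).
have E00 := expR_gt0 (Re (- ('i%C * z * w ord0))).
have S0 : 0 < normc (sh (pi%:C%C * Complex x e)).
  by rewrite -(pmulr_lgt0 _ Ep0) (lt_le_trans s0).
have P0 := li_pol_ge0 z t'; have Q0 := li_pol_ge0 a (tcons x t').
have A0 := normc_ge0 L.
have B0 := li_size_ge0 (shift_fun w) z t'; have B10 := li_size_ge0 w a (tcons x t').
have zz := normc_ge0 z.
move: (li_size w a _) B10 => B B10; move: (li_size _ _ _) B0 => B' B'0.
move: (normc L) A0 => A' A'0.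
move: (li_pol a _) Q0 => P P0'; move: (li_pol _ _) P0 => P' P'0.
move: (expR (Re _)) E00 => E0 E00; move: (expR (- _)) Ep0 S1 S2 => Ep Ep0 S1 S2.
move: (normc (sh _)) S0 S1 S2 => S S0 S1 S2.
move: (_ ^ _) r0 r1 r2 => r r0 r1 r2.
move: (1 + _) r1 r2 (addr_ge0 ler01 zz) => Z r1 r2 Z0 ZP hA hB PP kB.
rewrite -/k in kB.
have ZM : Z ^+ `|n ord0|%N * P' ^+ N <= (2 * P) ^+ M.
  rewrite /M addnC exprD.
  apply: ler_pM; rewrite ?exprn_ge0// lerXn2r ?nnegrE ?mulr_ge0//.
  exact: le_trans ZP PP.
rewrite exprMn in ZM.
have Pm0 : 0 <= P ^+ M by rewrite exprn_ge0.
have PN0 : 0 <= P' ^+ N by rewrite exprn_ge0.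
have Zn0 : 0 <= Z ^+ `|n ord0|%N by rewrite exprn_ge0.
have u1 : 0 <= K * C * k / s by rewrite divr_ge0 ?mulr_ge0 ?ltW.
have u2 : 0 <= 2 * K * C / k by rewrite divr_ge0 ?mulr_ge0 ?ltW.
move: (2 ^+ M) (exprn_gt0 M (ltr0n R 2)) (P ^+ M) (P' ^+ N) (Z ^+ _) hA hB ZM Pm0 PN0 Zn0 r1 r2.
move=> T T0 PM PN Zn hA hB ZM Pm0 PN0 Zn0 r1 r2.
have Si : S^-1 <= Ep / s.
  by rewrite ler_pdivlMr// mulrC ler_pdivrMr// mulrC.
split.
  apply: (@le_trans _ _ (E0 * (K * Zn) * (Ep / s) * (C * PN * B'))).
    apply: ler_pM => //; first by rewrite !mulr_ge0 ?invr_ge0// ltW.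
    apply: ler_pM => //; first by rewrite mulr_ge0 ?ltW.
      by rewrite invr_ge0 ltW.
    by rewrite ler_pM2l.
  rewrite [leLHS](_ : _ = K * C / s * (Zn * PN) * (E0 * Ep * B')); last by ring.
  rewrite kB [leLHS](_ : _ = K * C * k / s * (Zn * PN) * B); last by ring.
  rewrite ler_wpM2r// -[leRHS]mulrA; apply: ler_pM => //; first exact: mulr_ge0.
  by rewrite lerDl.
rewrite -(ler_pM2l k0) -kB.
apply: (@le_trans _ _ (E0 * Ep * (C * PN * A') * (K * Zn * r))).
  rewrite -[leLHS]mulr1; apply: ler_pM => //.
    by rewrite !mulr_ge0// ltW.
  by rewrite ler_pM2l// mulr_gt0.
rewrite [leLHS](_ : _ = S * Ep * (K * C * (Zn * PN) * (E0 * r / S * A'))); last first.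
  by field; rewrite gt_eqF.
have AA : 0 <= E0 * r / S * A' by rewrite !mulr_ge0 ?invr_ge0// ltW.
apply: (@le_trans _ _ (2 * (K * C * (T * PM) * (E0 * r / S * A')))).
  apply: ler_pM => //; first by rewrite mulr_ge0// ltW.
    by rewrite !mulr_ge0// ?invr_ge0// ltW.
  by rewrite ler_wpM2r// ler_pM2l// mulr_gt0.
rewrite [leLHS](_ : _ = k * (2 * K * C / k * (T * PM) * (E0 * r / S * A'))); last first.
  by field; rewrite !gt_eqF.
rewrite ler_pM2l//; apply: ler_wpM2r => //; rewrite -[leRHS]mulrA.
by apply: ler_wpM2r; [rewrite mulr_ge0// ltW|rewrite lerDr].
Qed.

(** The factor of one variable in the upper bound. *)
Definition weight V (N : nat) x : R := (1 + `|x|) ^+ N * expR (x * V - pi * `|x|).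

End offset_bounds.

(** * Integrals under strict bounds on the rates *)

Section strict_case.
Context {R : realType}.
Local Notation mu := (@lebesgue_measure R).
Local Notation RR := (measurableTypeR R).
Local Notation mut := (lebesgue_tuple R).
Implicit Types (a z : R[i]) (e x V : R).

Lemma weight_ge0 V N x : 0 <= weight V N x.
Proof. by rewrite mulr_ge0 ?expR_ge0 ?exprn_ge0 ?addr_ge0. Qed.

Lemma measurable_weight V N : measurable_fun setT (weight V N : RR -> R).
Proof.
have mabs : measurable_fun setT (fun x : RR => `|x|) by exact: normr_measurable.
apply: measurable_funM.
  apply: measurable_funX; apply: measurable_funD => //; exact: measurable_cst.
apply: (measurableT_comp (@measurable_expR R)); apply: measurable_funB.
  by apply: measurable_funM => //; exact: measurable_cst.
by apply: measurable_funM => //; exact: measurable_cst.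
Qed.

Lemma integrable_weight V N : `|V| < pi ->
  mu.-integrable setT (EFin \o (weight V N : RR -> R)).
Proof.
move=> Vpi; have d0 : 0 < pi - `|V| by rewrite subr_gt0.
have [C C0 hC] := poly_expR_kappa N d0.
apply: (integrable_kappa_bounded (measurable_weight V N) (C := C)) => x.
rewrite ger0_norm ?weight_ge0// (le_trans _ (hC x))// ler_wpM2l ?exprn_ge0 ?addr_ge0//.
rewrite ler_expR; have := ler_norm (x * V); rewrite normrM; lra.
Qed.

Lemma li_weightE m (w : 'I_m -> R[i]) a N (t : m.-tuple RR) :
  li_pol a t ^+ N * li_size w a t =
  (1 + normc a) ^+ N * expR (Re (- ('i%C * a * \sum_(j < m) w j))) *
    \prod_(j < m) weight (tail_Im w j) N (tnth t j).
Proof.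
rewrite /li_pol /li_size exprMn -prodrXl /weight big_split/=; ring.
Qed.

Definition strict m (w : 'I_m -> R[i]) : Prop := forall k, `|tail_Im w k| < pi.

Lemma strict_shift m (w : 'I_m.+1 -> R[i]) : strict w -> strict (shift_fun w).
Proof. by move=> h k; rewrite -tail_ImS. Qed.

(** The dependence on the offset is kept explicit, for the decay of the integrals
    along offsets tending to infinity. *)
Lemma li_off_dominated m (n : 'I_m -> int) (w : 'I_m -> R[i]) e :
  0 < e < 1 -> strict w -> exists (g : m.-tuple RR -> R) N,
  [/\ (mut m).-integrable setT (EFin \o g),
      forall t, 0 <= g t &
      forall a t, 0 <= Im a -> normc (li_off n w a (contour_pt e t)) <=
        (1 + normc a) ^+ N * expR (Re (- ('i%C * a * \sum_(j < m) w j))) * g t].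
Proof.
move=> e01 ws; have [C [N [C0 hC]]] := li_off_size n w e01.
exists (fun t => C * \prod_(j < m) weight (tail_Im w j) N (tnth t j)), N; split.
- apply: integrableZ_EFin.
  apply: (integrable_tuple_prod (g := fun j => weight (tail_Im w j) N)) => j.
  + exact: measurable_weight.
  + exact: weight_ge0.
  + exact: integrable_weight.
- by move=> t; rewrite mulr_ge0 ?(ltW C0)// prodr_ge0// => j _; exact: weight_ge0.
- move=> a t /(hC a t)[h _]; rewrite (le_trans h)// -mulrA li_weightE.
  by rewrite mulrCA.
Qed.

Lemma cintegrable_li_off m (n : 'I_m -> int) (w : 'I_m -> R[i]) e a :
  0 < e < 1 -> strict w -> 0 <= Im a ->
  cintegrable (mut m) (fun t => li_off n w a (contour_pt e t)).
Proof.
move=> e01 ws a0; have [g [N [ig g0 hg]]] := li_off_dominated n e01 ws.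
apply: cintegrable_dominated (cmeasurable_li_off n w a e) (fun t => hg a t a0) _.
exact: integrableZ_EFin.
Qed.

Lemma measurable_tcons m (t : m.-tuple RR) :
  measurable_fun setT (fun x : RR => tcons x t).
Proof. exact: (measurableT_comp (@measurable_cons_pair _ RR m) (measurable_pair2 t)). Qed.

Lemma cintegrable_li_off_slice m (n : 'I_m.+1 -> int) (w : 'I_m.+1 -> R[i]) e a t :
  0 < e < 1 -> strict w -> 0 <= Im a ->
  cintegrable mu (fun x : RR => li_off n w a (contour_pt e (tcons x t))).
Proof.
move=> e01 ws a0; have [C [N [C0 hC]]] := li_off_size n w e01.
have [mr mi] := cmeasurable_li_off n w a e.
pose K := C * ((1 + normc a) ^+ N * expR (Re (- ('i%C * a * \sum_(j < m.+1) w j)))) *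
  \prod_(j < m) weight (tail_Im w (lift ord0 j)) N (tnth t j).
apply: (cintegrable_dominated (g := fun x : RR => K * weight (tail_Im w ord0) N x)).
- split.
    exact: (measurableT_comp mr (measurable_tcons t)).
  exact: (measurableT_comp mi (measurable_tcons t)).
- move=> x; have [h _] := hC a (tcons x t) a0; rewrite (le_trans h)//.
  rewrite -mulrA li_weightE big_ord_recl tnth_tcons0.
  have -> : \prod_(j < m) weight (tail_Im w (lift ord0 j)) N
      (tnth (tcons x t) (lift ord0 j)) =
      \prod_(j < m) weight (tail_Im w (lift ord0 j)) N (tnth t j).
    by apply: eq_bigr => j _; rewrite tnth_tconsS.
  by rewrite le_eqVlt; apply/orP; left; apply/eqP; rewrite /K; ring.
- exact/integrableZ_EFin/integrable_weight.
Qed.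

Definition li_int m (n : 'I_m -> int) (w : 'I_m -> R[i]) e (c : nat) : R[i] :=
  cintegral (mut m) (fun t => li_off n w ('i%C * c%:R) (contour_pt e t)).

Lemma Im_i_nat (c : nat) : Im ('i%C * c%:R : R[i]) = c%:R.
Proof. by rewrite !ReIm Re_natr mul0r add0r mul1r. Qed.

(** The residue step in the first variable: raising [p_1] by [i] is the same as
    raising the offset by [i], and all other [sh] factors are constants. *)
Lemma li_slice_step m (n : 'I_m.+1 -> int) (w : 'I_m.+1 -> R[i]) e (c : nat) t :
  0 < e < 2^-1 -> strict w ->
  cintegral mu (fun x : RR => li_off n w ('i%C * c%:R) (contour_pt e (tcons x t))) +
  cintegral mu (fun x : RR => li_off n w ('i%C * c.+1%:R) (contour_pt e (tcons x t)))
  = - 'i%C * li_factor (w ord0) (n ord0) ('i%C * c.+1%:R) *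
    li_off (shift_fun n) (shift_fun w) ('i%C * c.+1%:R) (contour_pt e t).
Proof.
move=> e02 ws; have /andP[e0 e2] := e02.
have e01 : 0 < e < 1 by rewrite e0; lra.
pose a : R[i] := 'i%C * c%:R.
(* [q k]: the part of the k-th partial sum that does not involve the first
   variable *)
pose q (k : 'I_m.+1) : R[i] := if unlift ord0 k is Some j
  then a + partial_sum (contour_pt e t) j else a.
pose G p := \prod_(k < m.+1) li_factor (w k) (n k) (p + q k).
have numE (b p : R[i]) (P : 'I_m.+1 -> R[i]) : P ord0 = p ->
    shift_fun P = contour_pt e t ->
    li_num n w (a + b) P = G (p + b).
  move=> P0 PS; rewrite /li_num /G; apply: eq_bigr => k _; congr li_factor.
  rewrite /q; case: unliftP => [j ->|->].
    by rewrite partial_sumS P0 PS; ring.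
  by rewrite partial_sum0 P0; ring.
have q0 k : 0 <= Im (q k).
  rewrite /q; case: unliftP => [j _|_]; rewrite ?ImD Im_i_nat//.
  by rewrite addr_ge0// /partial_sum Im_sum sumr_ge0// => i _; exact: ltW.
have Gadm : admissible (e / 2) (tail_Im w ord0) G.
  rewrite tail_Im0 Im_sum; apply: admissible_prod => k.
  by apply: admissible_li_factor => //; rewrite divr_gt0.
have offE b x : li_off n w (a + b) (contour_pt e (tcons x t)) =
    (li_den (contour_pt e t))^-1 * (G (Complex x e + b) / sh (pi%:C%C * Complex x e)).
  rewrite /li_off li_denS contour_pt0 shift_contour_pt invfM.
  rewrite (numE b (Complex x e)) ?contour_pt0 ?shift_contour_pt//.
  by rewrite mulrA mulrC.
have a1 : 'i%C * c.+1%:R = a + 'i%C by rewrite -natr1 mulrDr mulr1.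
have a00 : 0 <= Im a by rewrite Im_i_nat.
have aa1 : 0 <= Im (a + 'i%C) by rewrite -a1 Im_i_nat.
have D0 : li_den (contour_pt e t) != 0.
  apply/prodf_neq0 => k _; apply: sh_pi_neq0; right => /=.
  by rewrite gt_eqF// sin_pi_gt0.
have res := admissible_residue e02 (ws ord0) Gadm.
have i0 := cintegrable_li_off_slice n t e01 ws a00.
have i1 := cintegrable_li_off_slice n t e01 ws aa1.
rewrite a1 -/a.
have offE0 x : li_off n w a (contour_pt e (tcons x t)) =
    (li_den (contour_pt e t))^-1 * (G (Complex x e) / sh (pi%:C%C * Complex x e)).
  by rewrite -[a]addr0 offE !addr0.
pose D := li_den (contour_pt e t).
pose A := cintegral mu (fun x : RR => li_off n w a (contour_pt e (tcons x t))).
pose B := cintegral mu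
  (fun x : RR => li_off n w (a + 'i%C) (contour_pt e (tcons x t))).
have F0 : cintegral mu (fun x : RR => G (Complex x e) / sh (pi%:C%C * Complex x e)) = D * A.
  apply: etrans _ (cintegralZ D i0); apply: eq_cintegral => x.
  by rewrite offE0 mulVKf.
have F1 : cintegral mu (fun x : RR => G (Complex x e + 'i%C) / sh (pi%:C%C * Complex x e)) = D * B.
  apply: etrans _ (cintegralZ D i1); apply: eq_cintegral => x.
  by rewrite offE mulVKf.
have key : D * A + D * B = - 'i%C * G 'i%C.
  exact: etrans (f_equal2 _ (esym F0) (esym F1)) res.
have GE : G 'i%C = li_factor (w ord0) (n ord0) (a + 'i%C) *
    li_num (shift_fun n) (shift_fun w) (a + 'i%C) (contour_pt e t).
  rewrite /G big_ord_recl /q unlift_none addrC; congr (_ * _).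
  by apply: eq_bigr => k _; rewrite liftK; congr li_factor; ring.
rewrite -/A -/B /li_off -/D in key *.
have D0' : D != 0 := D0.
clear F0 F1.
clearbody A B D; apply: (mulfI D0'); rewrite mulrDr key GE.
move: (li_factor _ _ _) (li_num _ _ _ _) => X Y.
by field.
Qed.

Lemma li_int_rec m (n : 'I_m.+1 -> int) (w : 'I_m.+1 -> R[i]) e (c : nat) :
  0 < e < 2^-1 -> strict w ->
  li_int n w e c + li_int n w e c.+1 =
  - 'i%C * li_factor (w ord0) (n ord0) ('i%C * c.+1%:R) *
    li_int (shift_fun n) (shift_fun w) e c.+1.
Proof.
move=> e02 ws; have /andP[e0 e2] := e02.
have e01 : 0 < e < 1 by rewrite e0; lra.
have a0 k : 0 <= Im ('i%C * k%:R : R[i]) by rewrite Im_i_nat.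
have ii k := cintegrable_li_off n e01 ws (a0 k).
have isl k t := cintegrable_li_off_slice n t e01 ws (a0 k).
have [E0 I0] := cintegral_tuple (ii c) (isl c).
have [E1 I1] := cintegral_tuple (ii c.+1) (isl c.+1).
rewrite /li_int E0 E1 -cintegralD// -cintegralZ; last first.
  exact: (cintegrable_li_off _ e01 (strict_shift ws) (a0 _)).
by apply: eq_cintegral => t; exact: li_slice_step.
Qed.

Lemma li_int0 (n : 'I_0 -> int) w e c : li_int n w e c = 1.
Proof.
rewrite /li_int (_ : (fun t => _) = fun=> 1); last first.
  by apply/funext => t; rewrite /li_off /li_num /li_den !big_ord0 divr1.
have M0 : (mut 0 setT = 1)%E by rewrite /= diracT.
have M : fine (mut 0 setT) = 1 by rewrite M0.
apply: complexP.
  by rewrite -[LHS]/(\int[mut 0]_t (1 : R)) Rintegral_cst// M mulr1.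
by rewrite -[LHS]/(\int[mut 0]_t (0 : R)) Rintegral_cst// mul0r.
Qed.

(** At offset [i c] the integrand carries the factor [exp (c (w_1 + ... + w_m))],
    whose modulus decays in [c]. *)
Lemma li_int_le m (n : 'I_m -> int) (w : 'I_m -> R[i]) e :
  0 < e < 1 -> strict w -> exists K N, 0 <= K /\ forall c,
  normc (li_int n w e c) <=
    K * (1 + c%:R) ^+ N * expR (c%:R * Re (\sum_(j < m) w j)).
Proof.
move=> e01 ws; have [g [N [ig g0 hg]]] := li_off_dominated n e01 ws.
exists (2 * \int[mut m]_t g t), N; split.
  by rewrite mulr_ge0// Rintegral_ge0.
move=> c; have a0 : 0 <= Im ('i%C * c%:R : R[i]) by rewrite Im_i_nat.
have ii := cintegrable_li_off n e01 ws a0.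
apply: le_trans (normc_cintegral_le ii (fun t => hg _ t a0) _) _.
  exact: integrableZ_EFin.
rewrite RintegralZl// normcM normci mul1r normcn.
rewrite (_ : Re (- _) = c%:R * Re (\sum_(j < m) w j)); last first.
  by rewrite !ReIm Re_natr Im_natr; ring.
by rewrite le_eqVlt; apply/orP; left; apply/eqP; ring.
Qed.

End strict_case.

(** * Necessary bounds on the rates *)

Section necessity.
Context {R : realType}.
Local Notation mu := (@lebesgue_measure R).
Local Notation RR := (measurableTypeR R).
Local Notation mut := (lebesgue_tuple R).
Implicit Types (a z : R[i]) (e x V c : R).

(** The factor of one variable in the lower bound. *)
Definition coweight V (N : nat) x : R :=
  (1 + `|x|) ^- N * expR (x * V - pi * `|x|).

Lemma coweight_gt0 V N x : 0 < coweight V N x.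
Proof. by rewrite mulr_gt0 ?expR_gt0// invr_gt0 exprn_gt0// ltr_pwDl. Qed.

Lemma measurable_coweight V N : measurable_fun setT (coweight V N : RR -> R).
Proof.
have mabs : measurable_fun setT (fun x : RR => `|x|) by exact: normr_measurable.
apply: measurable_funM; last first.
  apply: (measurableT_comp (@measurable_expR R)); apply: measurable_funB.
    by apply: measurable_funM => //; exact: measurable_cst.
  by apply: measurable_funM => //; exact: measurable_cst.
rewrite (_ : (fun x : RR => _) = (@powR R ^~ (-1)) \o (fun x : RR => (1 + `|x|) ^+ N)).
  apply: measurableT_comp; first exact: measurable_powR.
  apply: measurable_funX; apply: measurable_funD => //; exact: measurable_cst.
by apply/funext => x /=; rewrite powR_inv1// exprn_ge0// addr_ge0.
Qed.

Lemma integral_ge_on (g : RR -> R) c (D : set RR) : measurable D ->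
  measurable_fun setT g -> (forall x, 0 <= g x) -> 0 <= c ->
  (forall x, D x -> c <= g x) -> (c%:E * mu D <= \int[mu]_x (g x)%:E)%E.
Proof.
move=> mD mg g0 c0 cg; rewrite -integral_cst//.
apply: (@le_trans _ _ (\int[mu]_(x in D) (g x)%:E)%E).
  apply: ge0_le_integral => //.
  by apply/measurable_EFinP; exact: measurable_funTS.
apply: ge0_subset_integral => //.
  by apply/measurable_EFinP.
by move=> x _; rewrite lee_fin.
Qed.

Lemma integral_coweight_gt0 V N : (0 < \int[mu]_x (coweight V N x)%:E)%E.
Proof.
pose c : R := 2 ^- N * expR (- `|V| - pi).
have c0 : 0 < c by rewrite mulr_gt0 ?expR_gt0// invr_gt0 exprn_gt0.
have := @integral_ge_on (coweight V N) c `[0, 1]%classic (measurable_itv _)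
  (measurable_coweight V N) (fun x => ltW (coweight_gt0 V N x)) (ltW c0).
rewrite lebesgue_measure_itv/= lte_fin ltr01 oppr0 adde0 mule1 => h.
apply: lt_le_trans (h _); first by rewrite lte_fin.
move=> x; rewrite /= in_itv/= => /andP[x0 x1]; rewrite /c /coweight (ger0_norm x0).
apply: ler_pM; rewrite ?expR_ge0 ?invr_ge0 ?exprn_ge0//.
  rewrite lef_pV2 ?posrE ?exprn_gt0 ?ltr_pwDl// lerXn2r ?nnegrE ?addr_ge0//.
  lra.
rewrite ler_expR lerB//; last by rewrite ler_piMr// pi_ge0.
rewrite lerNl (le_trans (ler_norm _))// normrN normrM (ger0_norm x0).
by rewrite ler_piMl.
Qed.

(** On a half line the rate is [|V| - pi], whose sign decides integrability. *)
Lemma coweight_integrable_le V N :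
  mu.-integrable setT (EFin \o (coweight V N : RR -> R)) -> `|V| <= pi.
Proof.
move=> /integrableP[_]; apply: contraTT; rewrite -!ltNge => Vpi.
have d0 : 0 < `|V| - pi by rewrite subr_gt0.
have [C C0 hC] := poly_le_expR N d0.
(* the half line on which [x V] is positive *)
have [D [mD muD xD]] : exists D : set RR, [/\ measurable D, mu D = +oo%E &
    forall x, D x -> x * V = `|x| * `|V|].
  have [V0|V0] := leP 0 V.
    exists `[0, +oo[%classic; split; first exact: measurable_itv.
      by rewrite lebesgue_measure_itv/= ltry.
    by move=> x; rewrite /= in_itv/= andbT => x0; rewrite !ger0_norm.
  exists `]-oo, 0]%classic; split; first exact: measurable_itv.
    by rewrite lebesgue_measure_itv/= ltNyr.
  move=> x; rewrite /= in_itv/= => x0.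
  by rewrite ler0_norm// ltr0_norm// mulrNN.
have Ci : 0 <= C^-1 by rewrite invr_ge0 ltW.
have := integral_ge_on mD (measurable_coweight V N)
  (fun x => ltW (coweight_gt0 V N x)) Ci.
rewrite muD gt0_muley ?lte_fin ?invr_gt0// => h.
have {}h : (+oo <= \int[mu]_x (coweight V N x)%:E)%E.
  apply: h => x Dx; rewrite /coweight xD// mulrC.
  rewrite ler_pdivlMr ?exprn_gt0 ?ltr_pwDl// mulrC ler_pdivrMr// mulrC.
  rewrite (le_trans (hC _ (normr_ge0 x)))// ler_pM2l// ler_expR; lra.
under eq_integral do rewrite gee0_abs ?lee_fin ?(ltW (coweight_gt0 _ _ _))//.
by move: h; rewrite leye_eq => /eqP ->; rewrite ltxx.
Qed.

(** Integrability passes to the lower bound, which has separated variables. *)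
Lemma tail_Im_le m (n : 'I_m -> int) (w : 'I_m -> R[i]) e : 0 < e < 1 ->
  cintegrable (mut m) (fun t => li_off n w 0 (contour_pt e t)) ->
  forall j, `|tail_Im w j| <= pi.
Proof.
move=> e01 iw j; have [C [N [C0 hC]]] := li_off_size n w e01.
apply: (@coweight_integrable_le _ N).
pose g (j : 'I_m) := coweight (tail_Im w j) N.
have mg k : measurable_fun setT (g k : RR -> R) by exact: measurable_coweight.
have g0 k x : 0 <= g k x by exact/ltW/coweight_gt0.
apply: (integrable_of_tuple_prod mg g0) => [k|]; first exact: integral_coweight_gt0.
apply: (integrable_of_cintegrable (cintegrableZ C%:C%C iw)).
  exact: measurable_tuple_prod.
move=> t; rewrite ger0_norm ?prodr_ge0// normcM normcR gtr0_norm//.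
have a0 : 0 <= Im (0 : R[i]) by rewrite Im0.
have [_] := hC 0 t a0.
rewrite /li_size /li_pol normc0 addr0 mul1r mulr0 mul0r oppr0 Re0 expR0 mul1r => h.
have P0 : 0 < (\prod_(j < m) (1 + `|tnth t j|)) ^+ N.
  by rewrite exprn_gt0// prodr_gt0// => k _; rewrite ltr_pwDl.
rewrite /g /coweight big_split/= prodfV prodrXl.
by rewrite mulrC ler_pdivrMr// mulrAC.
Qed.

End necessity.

(** * Truncated series and integrals *)

Section sums.
Context {R : realType}.
Implicit Types (d r : R) (a c k N M : nat).

Definition li_term (w : R[i]) (n : int) k : R[i] := cexp (k%:R * w) / k%:R ^ n.

(** The truncated series over [c < k_1 < ... < k_m < N]; the innermost sign
    [(-1)^c] puts [(-1)^{k_m}] on the last index. *)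
Fixpoint li_sum m : ('I_m -> int) -> ('I_m -> R[i]) -> nat -> nat -> R[i] :=
  match m with
  | 0 => fun _ _ c _ => (-1) ^+ c
  | m'.+1 => fun n w c N =>
      \sum_(c.+1 <= k < N) li_term (w ord0) (n ord0) k *
        li_sum (shift_fun n) (shift_fun w) k N
  end.

Lemma poly_geometric (N : nat) d : 0 < d -> exists2 C : R, 0 < C & forall k,
  (1 + k%:R) ^+ N * expR (- (2 * d * k%:R)) <= C * expR (- d) ^+ k.
Proof.
move=> d0; have [C C0 hC] := poly_le_expR N d0; exists C => // k.
have E : expR (- (2 * d * k%:R)) = expR (- (d * k%:R)) * expR (- d) ^+ k.
  by rewrite -expRM_natl -expRD; congr expR; ring.
rewrite E mulrA ler_pM2r ?exprn_gt0 ?expR_gt0//.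
by rewrite expRN ler_pdivrMr ?expR_gt0// hC.
Qed.

Lemma normc_li_term (w : R[i]) n k :
  normc (li_term w n k) = expR (k%:R * Re w) * k%:R ^ (- n).
Proof.
by rewrite normcM normcV normcXz normc_cexp normcn invr_expz ReM Re_natr Im_natr mul0r subr0.
Qed.

Lemma li_term_le (n : int) d : 0 < d -> exists2 B : R, 0 < B & forall (w : R[i]) k,
  Re w <= - (2 * d) -> (0 < k)%N -> normc (li_term w n k) <= B * expR (- d) ^+ k.
Proof.
move=> d0; have [K K0 hK] := expz_le (- n) (@ltr01 R).
have [C C0 hC] := poly_geometric `|n|%N d0.
exists (K * C) => [|w k wd k0]; first by rewrite mulr_gt0.
rewrite normc_li_term -mulrA mulrC.
apply: (@le_trans _ _ (K * (1 + k%:R) ^+ `|n|%N * expR (- (2 * d * k%:R)))).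
  apply: ler_pM; rewrite ?expR_ge0 ?exprz_ge0//.
    by rewrite -[in leRHS]abszN; apply: hK; rewrite ler1n.
  by rewrite ler_expR mulrC -mulNr ler_wpM2r.
by rewrite -mulrA ler_pM2l// hC.
Qed.

Lemma geometric_sum_le r a N : 0 <= r < 1 ->
  \sum_(a <= k < N) r ^+ k <= r ^+ a / (1 - r).
Proof.
move=> /andP[r0 r1]; have r1' : 0 < 1 - r by rewrite subr_gt0.
rewrite ler_pdivlMr//.
have [aN|Na] := leqP a N; last first.
  by rewrite big_geq ?mul0r ?exprn_ge0// ltnW.
have -> : (\sum_(a <= k < N) r ^+ k) * (1 - r) = r ^+ a - r ^+ N.
  rewrite mulr_suml (eq_bigr (fun k => - (r ^+ k.+1 - r ^+ k))).
    by rewrite sumrN telescope_sumr// opprB.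
  by move=> k _; rewrite exprS; ring.
by rewrite lerBlDr lerDl exprn_ge0.
Qed.

Lemma expRN01 d : 0 < d -> 0 <= expR (- d) < 1.
Proof. by move=> d0; rewrite expR_ge0 expR_lt1 oppr_lt0. Qed.

(** The constant depends on [w] only through an upper bound for its real parts,
    so it is uniform when the imaginary parts are varied. *)
Lemma li_sum_cauchy m (n : 'I_m -> int) d : 0 < d -> exists2 C : R, 0 < C &
  forall w : 'I_m -> R[i], (forall j, Re (w j) <= - (2 * d)) ->
    forall c N, (c < N)%N -> normc (li_sum n w c N) <= C /\
      forall M, (N <= M)%N ->
        normc (li_sum n w c M - li_sum n w c N) <= C * expR (- d) ^+ N.
Proof.
move=> d0; have r01 := expRN01 d0; set r := expR (- d) in r01 *.
have /andP[r0 r1] := r01.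
elim: m n => [|m IH] n.
  exists 1 => // w _ c N cN; split=> [|M NM] /=.
    by rewrite normcX normcN normc1 expr1n.
  by rewrite subrr normc0 mul1r exprn_ge0.
have [C C0 hC] := IH (shift_fun n).
have [B B0 hB] := li_term_le (n ord0) d0.
pose q := (1 - r)^-1; have q0 : 0 < q by rewrite invr_gt0 subr_gt0.
exists (2 * (B * q * C)) => [|w wd c N cN].
  by rewrite !mulr_gt0.
have ws j : Re (shift_fun w j) <= - (2 * d) by exact: wd.
have sum_le (F : nat -> R[i]) (K : R) a M : 0 <= K -> (0 < a)%N ->
    (forall k, (a <= k < M)%N -> normc (F k) <= K) ->
    normc (\sum_(a <= k < M) li_term (w ord0) (n ord0) k * F k) <=
    B * K * (r ^+ a * q).
  move=> K0 a0 hF; rewrite (le_trans (normc_sum _ _ _))//.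
  apply: (@le_trans _ _ (\sum_(a <= k < M) B * K * r ^+ k)).
    apply: ler_sum_nat => k /andP[ak kM]; rewrite normcM mulrAC.
    apply: ler_pM; rewrite ?normc_ge0//.
      by apply: hB => //; exact: leq_trans ak.
    by apply: hF; rewrite ak kM.
  by rewrite -mulr_sumr ler_wpM2l ?geometric_sum_le// mulr_ge0// ltW.
have ra a : r ^+ a <= 1 by rewrite exprn_ile1// ltW.
have half X Y : X <= B * q * C * Y -> 0 <= Y -> X <= 2 * (B * q * C) * Y.
  move=> h Y0; rewrite (le_trans h)// -[2 * _ * Y]mulrA ler_peMl ?ler1n//.
  by rewrite mulr_ge0// !mulr_ge0// ltW.
split=> [|M NM] /=.
  rewrite -[leRHS]mulr1; apply: half => //.
  apply: (le_trans (sum_le _ C _ _ (ltW C0) (ltn0Sn c) _)).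
    by move=> k /andP[_ kN]; have [] := hC _ ws k N kN.
  rewrite mulr1 [B * q * C]mulrAC ler_pM2l ?mulr_gt0//.
  by rewrite ler_piMl// ltW.
rewrite (big_cat_nat cN NM)/=.
rewrite addrAC -sumrB.
rewrite (eq_bigr (fun k => li_term (w ord0) (n ord0) k *
  (li_sum (shift_fun n) (shift_fun w) k M - li_sum (shift_fun n) (shift_fun w) k N))); last first.
  by move=> k _; rewrite mulrBr.
rewrite (le_trans (ler_normcD _ _))//.
rewrite -mulrA mulr_natl mulr2n; apply: lerD.
  apply: (le_trans (sum_le _ (C * r ^+ N) _ _ _ (ltn0Sn c) _)).
  - by rewrite mulr_ge0 ?exprn_ge0// ltW.
  - by move=> k /andP[_ kN]; have [_] := hC _ ws k N kN; apply.
  rewrite (_ : B * q * C * r ^+ N = B * (C * r ^+ N) * q); last by ring.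
  rewrite ler_wpM2l ?mulr_ge0 ?exprn_ge0 ?(ltW B0) ?(ltW C0)//.
  by rewrite ler_piMl// ltW.
apply: (le_trans (sum_le _ C _ _ (ltW C0) (leq_ltn_trans (leq0n c) cN) _)).
  by move=> k /andP[_ kM]; have [] := hC _ ws k M kM.
by rewrite le_eqVlt; apply/orP; left; apply/eqP; ring.
Qed.

End sums.

Section sum_integral.
Context {R : realType}.
Implicit Types (e d : R) (c k N M : nat).

(** The normalisation of the theorem; the sign turns the sum in [li_int_rec] into
    the difference of consecutive terms. *)
Definition li_int_norm m (n : 'I_m -> int) (w : 'I_m -> R[i]) e c : R[i] :=
  'i%C ^ (\sum_(j < m) n j - m%:Z) * (-1) ^+ c * li_int n w e c.

Lemma i_neq0 : 'i%C != 0 :> R[i].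
Proof. by rewrite -normc_eq0 normci oner_eq0. Qed.

Lemma li_factor_i w (n : int) c :
  li_factor w n ('i%C * c%:R : R[i]) = 'i%C ^ (- n) * li_term w n c.
Proof.
rewrite /li_factor /li_term expfzMl invfM invr_expz mulrCA; congr (_ * (cexp _ * _)).
by rewrite !mulrA -expr2 sqr_i mulN1r mulNr opprK.
Qed.

Lemma li_int_norm_rec m (n : 'I_m.+1 -> int) (w : 'I_m.+1 -> R[i]) e c :
  0 < e < 2^-1 -> strict w ->
  li_int_norm n w e c - li_int_norm n w e c.+1 =
  li_term (w ord0) (n ord0) c.+1 * li_int_norm (shift_fun n) (shift_fun w) e c.+1.
Proof.
move=> e02 ws; rewrite /li_int_norm exprS.
have alg (Y s I J : R[i]) : Y * s * I - Y * (-1 * s) * J = Y * s * (I + J).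
  by ring.
rewrite alg li_int_rec// li_factor_i big_ord_recl.
rewrite (_ : n ord0 + _ - _ = (\sum_(j < m) shift_fun n j - m%:Z) + n ord0 - 1); last first.
  rewrite /shift_fun intS; ring.
move: (_ - m%:Z) => Z; rewrite !expfzDr ?i_neq0//.
have -> : 'i%C ^ (-1) = - 'i%C :> R[i].
  apply: (mulfI i_neq0).
  by rewrite exprN1 mulfV ?i_neq0// mulrN -expr2 sqr_i opprK.
have -> : 'i%C ^ n ord0 = ('i%C ^ (- n ord0))^-1 :> R[i] by rewrite invr_expz opprK.
have : 'i%C ^ (- n ord0) != 0 :> R[i] by rewrite expfz_neq0// i_neq0.
have ii : 'i%C * 'i%C = -1 :> R[i] by rewrite -expr2 sqr_i.
move: ('i%C ^ (- n ord0)) ('i%C ^ Z) => X Y X0.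
move: ((-1) ^+ c) (li_term _ _ _) (li_int _ _ _ _) => s T I.
transitivity (('i%C * 'i%C) * (Y * s * T * I) : R[i]); first by field.
by rewrite ii; ring.
Qed.

Lemma normc_li_int_norm m (n : 'I_m -> int) (w : 'I_m -> R[i]) e c :
  normc (li_int_norm n w e c) = normc (li_int n w e c).
Proof.
by rewrite !normcM normcXz normci exp1rz normcX normcN normc1 expr1n !mul1r.
Qed.

(** The integrals and the truncated sums satisfy the same recursion in [c], and
    the integrals tend to 0 as [c] grows: summing the recursion from [c] to [N]
    leaves [li_int_norm n w e N.-1] and, by induction on [m], small errors. *)
Lemma li_int_norm_sum m (n : 'I_m -> int) (w : 'I_m -> R[i]) e d :
  0 < e < 2^-1 -> strict w -> 0 < d -> (forall j, Re (w j) <= - (2 * d)) ->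
  exists2 C : R, 0 <= C & forall c N, (c < N)%N ->
    normc (li_int_norm n w e c - li_sum n w c N) <= C * expR (- d) ^+ N.
Proof.
move=> e02 + d0; have r01 := expRN01 d0; have /andP[r0 r1] := r01.
have rp : 0 < expR (- d) := expR_gt0 _.
set r := expR (- d) in r01 r0 r1 rp *.
have /andP[e0 e2] := e02; have e01 : 0 < e < 1 by rewrite e0; lra.
elim: m n w => [|m IH] n w ws wd.
  exists 0 => // c N _; rewrite /li_int_norm li_int0 big_ord0 subrr expr0z mul1r mulr1.
  by rewrite subrr normc0 mul0r.
have [C C0 hC] := IH (shift_fun n) (shift_fun w) (strict_shift ws) (fun j => wd _).
have [B B0 hB] := li_term_le (n ord0) d0.
have [K [L [K0 hK]]] := li_int_le n e01 ws.
have [D D0 hD] := poly_geometric L d0.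
pose q := (1 - r)^-1; have q0 : 0 < q by rewrite invr_gt0 subr_gt0.
exists (K * D / r + B * C * q) => [|c N cN].
  by rewrite addr_ge0 ?divr_ge0 ?mulr_ge0 ?invr_ge0 ?(ltW D0) ?(ltW B0) ?subr_ge0 ?(ltW r1)//.
have tele : li_int_norm n w e c = li_int_norm n w e N.-1 +
    \sum_(c.+1 <= k < N) li_term (w ord0) (n ord0) k *
      li_int_norm (shift_fun n) (shift_fun w) e k.
  have [N' NE] : exists N', N = N'.+1 by case: N cN => // N' _; exists N'.
  rewrite NE big_add1/=.
  rewrite (eq_big_nat _ _ (F2 := fun k => - (li_int_norm n w e k.+1 - li_int_norm n w e k))).
    have cN' : (c <= N')%N by rewrite -ltnS -NE.
    by rewrite sumrN telescope_sumr// opprB addrC subrK.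
  by move=> k _; rewrite -li_int_norm_rec// opprB.
rewrite tele /= -addrA -sumrB mulrDl (le_trans (ler_normcD _ _))//; apply: lerD.
  case: N cN {tele} => // N cN; rewrite normc_li_int_norm /= (le_trans (hK N))//.
  rewrite exprS mulrA divfK ?gt_eqF// -!mulrA ler_wpM2l//.
  apply: le_trans (hD N); rewrite ler_wpM2l ?exprn_ge0 ?addr_ge0//.
  rewrite ler_expR mulrC -mulNr ler_wpM2r//.
  rewrite Re_sum big_ord_recl -[leRHS]addr0 lerD//.
  by apply: sumr_le0 => j _; rewrite (le_trans (wd _))// oppr_le0 mulr_ge0// ltW.
rewrite (le_trans (normc_sum _ _ _))//.
apply: (@le_trans _ _ (\sum_(c.+1 <= k < N) B * (C * r ^+ N) * r ^+ k)).
  apply: ler_sum_nat => k /andP[ck kN]; rewrite -mulrBr normcM mulrAC.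
  apply: ler_pM; rewrite ?normc_ge0//; last exact: hC.
  by apply: hB => //; exact: leq_trans ck.
rewrite -mulr_sumr (_ : B * C * q * r ^+ N = B * (C * r ^+ N) * q); last by ring.
rewrite ler_wpM2l ?mulr_ge0 ?exprn_ge0 ?(ltW B0)//.
rewrite (le_trans (geometric_sum_le _ _ r01))// ler_piMl ?(ltW q0)//.
by rewrite exprn_ile1// ltW.
Qed.

End sum_integral.

(** * The series as an iterated sum *)

Section finite_series.
Context {R : realType}.
Implicit Types (c N : nat).

Definition chain_from m c N (k : {ffun 'I_m -> 'I_N}) : bool :=
  [forall i : 'I_m, (c < k i)%N] &&
  [forall i : 'I_m, forall j : 'I_m, (i < j)%N ==> (k i < k j)%N].

(** The lower bound [c] is what makes the recursion on the first index possible. *)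
Definition multi_li_from m (n : 'I_m -> int) (z : 'I_m -> R[i]) c N : R[i] :=
  \sum_(k : {ffun 'I_m -> 'I_N} | chain_from c k)
    \prod_(i < m) (z i ^+ k i / (k i)%:R ^ n i).

Definition cons_ffun m N (u : 'I_N * {ffun 'I_m -> 'I_N}) : {ffun 'I_m.+1 -> 'I_N} :=
  [ffun i => if unlift ord0 i is Some j then u.2 j else u.1].

Lemma cons_ffun0 m N (u : 'I_N * {ffun 'I_m -> 'I_N}) : cons_ffun u ord0 = u.1.
Proof. by rewrite ffunE unlift_none. Qed.

Lemma cons_ffunS m N (u : 'I_N * {ffun 'I_m -> 'I_N}) j :
  cons_ffun u (lift ord0 j) = u.2 j.
Proof. by rewrite ffunE liftK. Qed.

Lemma cons_ffun_bij m N : bijective (@cons_ffun m N).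
Proof.
exists (fun k : {ffun 'I_m.+1 -> 'I_N} => (k ord0, [ffun j => k (lift ord0 j)])).
  case=> k0 k'; rewrite cons_ffun0; congr pair; apply/ffunP => j.
  by rewrite ffunE cons_ffunS.
move=> k; apply/ffunP => i; case: (unliftP ord0 i) => [j ->|->].
  by rewrite cons_ffunS ffunE.
by rewrite cons_ffun0.
Qed.

Lemma chain_from_cons m c N (u : 'I_N * {ffun 'I_m -> 'I_N}) :
  chain_from c (cons_ffun u) = (c < u.1)%N && chain_from u.1 u.2.
Proof.
apply/idP/idP => [/andP[/forallP h1 /forallP h2]|].
  apply/and3P; split.
  - by have := h1 ord0; rewrite cons_ffun0.
  - apply/forallP => j; have /forallP/(_ (lift ord0 j)) := h2 ord0.
    by rewrite cons_ffun0 cons_ffunS.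
  - apply/forallP => i; apply/forallP => j.
    have /forallP/(_ (lift ord0 j)) := h2 (lift ord0 i).
    by rewrite !cons_ffunS.
move=> /and3P[cu /forallP h1 /forallP h2]; apply/andP; split.
  apply/forallP => i; case: (unliftP ord0 i) => [j ->|->].
    by rewrite cons_ffunS (ltn_trans cu).
  by rewrite cons_ffun0.
apply/forallP => i; apply/forallP => j.
case: (unliftP ord0 j) => [j' ->|->]; last by rewrite ltn0.
case: (unliftP ord0 i) => [i' ->|->].
  by rewrite !cons_ffunS; have /forallP/(_ j') := h2 i'.
by rewrite cons_ffun0 cons_ffunS h1 implybT.
Qed.

Lemma multi_li_fromS m (n : 'I_m.+1 -> int) (z : 'I_m.+1 -> R[i]) c N :
  multi_li_from n z c N = \sum_(c.+1 <= k < N)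
    (z ord0 ^+ k / k%:R ^ n ord0) * multi_li_from (shift_fun n) (shift_fun z) k N.
Proof.
rewrite big_geq_mkord /multi_li_from (reindex (@cons_ffun m N)) /=; last first.
  exact: onW_bij (cons_ffun_bij m N).
under eq_bigl do rewrite chain_from_cons.
under [RHS]eq_bigr do rewrite big_distrr.
rewrite pair_big_dep /=; apply: eq_bigr => -[k0 k'] _ /=.
rewrite big_ord_recl cons_ffun0; congr (_ * _).
by apply: eq_bigr => j _; rewrite cons_ffunS.
Qed.

Lemma multi_li_from0 (n : 'I_0 -> int) (z : 'I_0 -> R[i]) c N :
  multi_li_from n z c N = 1.
Proof.
rewrite /multi_li_from (big_pred1 [ffun i : 'I_0 => match i with Ordinal _ p =>
  False_rect _ (notF p) end]); first by rewrite big_ord0.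
move=> k; rewrite /chain_from; apply/idP/eqP => _.
  by apply/ffunP => -[].
by apply/andP; split; apply/forallP => -[].
Qed.

Lemma li_arg_shift m (w : 'I_m.+2 -> R[i]) :
  shift_fun (li_arg w) = li_arg (shift_fun w).
Proof. by apply/funext => j. Qed.

(** The sign of the last argument becomes the innermost sign of [li_sum]. *)
Lemma multi_li_from_arg m (n : 'I_m.+1 -> int) (w : 'I_m.+1 -> R[i]) c N :
  multi_li_from n (li_arg w) c N = li_sum n w c N.
Proof.
elim: m n w c => [|m IH] n w c; rewrite multi_li_fromS /=; apply: eq_bigr => k _.
  rewrite multi_li_from0 mulr1 /li_arg /= /li_term cexpMn.
  move: (cexp _) => z; rewrite (exprNn z k).
  move: ((-1) ^+ k) (z ^+ k) ((k%:R ^ _)^-1) => s x y; ring.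
by rewrite li_arg_shift IH /li_arg /= /li_term cexpMn.
Qed.

Lemma multi_li_sumE m (n : 'I_m -> int) (w : 'I_m -> R[i]) N : (0 < m)%N ->
  multi_li_sum n (li_arg w) N = li_sum n w 0 N.
Proof. by case: m n w => // m n w _; exact: multi_li_from_arg. Qed.

End finite_series.

(** * The boundary of the domain of convergence *)

Section boundary.
Context {R : realType}.
Local Notation mu := (@lebesgue_measure R).
Local Notation RR := (measurableTypeR R).
Local Notation mut := (lebesgue_tuple R).
Implicit Types (e : R) (c N : nat) (u v : nat -> R[i]) (l : R[i]).

Definition ccvg u l : Prop :=
  (Re (u k) @[k --> \oo] --> Re l) /\ (Im (u k) @[k --> \oo] --> Im l).

Lemma ccvgB u v l l' : ccvg u l -> ccvg v l' ->
  ccvg (fun k => u k - v k) (l - l').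
Proof.
move=> [ur ui] [vr vi]; split; rewrite ?ReD ?ImD ?ReN ?ImN.
  by under eq_fun do rewrite ReD ReN; exact: cvgB.
by under eq_fun do rewrite ImD ImN; exact: cvgB.
Qed.

Lemma ccvgZ a u l : ccvg u l -> ccvg (fun k => a * u k) (a * l).
Proof.
move=> [ur ui]; split; rewrite ?ReM ?ImM.
  by under eq_fun do rewrite ReM; apply: cvgB; exact: cvgMr.
by under eq_fun do rewrite ImM; apply: cvgD; exact: cvgMr.
Qed.

Lemma ccvg_normc_le u l (B : R) : ccvg u l -> (forall k, normc (u k) <= B) ->
  normc l <= B.
Proof.
move=> [ur ui] uB; have B0 : 0 <= B := le_trans (normc_ge0 _) (uB 0).
rewrite -(@ler_sqr _ _ B) ?nnegrE ?normc_ge0// sqr_normc.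
have h : Re (u k) * Re (u k) + Im (u k) * Im (u k) @[k --> \oo] -->
    Re l * Re l + Im l * Im l by apply: cvgD; exact: cvgM.
rewrite !expr2; apply: (ler_cvg_to h (cvg_cst (B * B))).
apply: nearW => k; rewrite -!expr2 -sqr_normc.
by rewrite ler_sqr ?nnegrE ?normc_ge0.
Qed.

Lemma ccvg_cderiv (f : R -> R[i]) t (d : R[i]) (s : nat -> R) : cderiv f t d ->
  s k @[k --> \oo] --> t -> ccvg (fun k => f (s k)) (f t).
Proof.
move=> hf st; split.
  exact: (cvg_comp s (fun x => Re (f x)) st (cderiv_Re_continuous hf)).
exact: (cvg_comp s (fun x => Im (f x)) st (cderiv_Im_continuous hf)).
Qed.

Lemma cderiv_sum (I : Type) (r : seq I) (P : pred I) (F : I -> R -> R[i]) t :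
  (forall i, exists d, cderiv (F i) t d) ->
  exists d, cderiv (fun s => \sum_(i <- r | P i) F i s) t d.
Proof.
move=> hF; elim: r => [|i r [d hd]].
  exists 0; apply: cderiv_ext (cderiv_cst 0 t) => s; by rewrite big_nil.
have [d' hd'] := hF i.
case Pi : (P i).
  exists (d' + d); apply: cderiv_ext (cderivD hd' hd) => s.
  by rewrite big_cons Pi.
by exists d; apply: cderiv_ext hd => s; rewrite big_cons Pi.
Qed.

Lemma cderiv_prod (I : Type) (r : seq I) (P : pred I) (F : I -> R -> R[i]) t :
  (forall i, exists d, cderiv (F i) t d) ->
  exists d, cderiv (fun s => \prod_(i <- r | P i) F i s) t d.
Proof.
move=> hF; elim: r => [|i r [d hd]].
  exists 0; apply: cderiv_ext (cderiv_cst 1 t) => s; by rewrite big_nil.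
have [d' hd'] := hF i.
case Pi : (P i).
  eexists; apply: cderiv_ext (cderivM hd' hd) => s.
  by rewrite big_cons Pi.
by exists d; apply: cderiv_ext hd => s; rewrite big_cons Pi.
Qed.

(** Scaling the imaginary parts by [t < 1] brings every rate strictly below
    [pi], while the moduli in the series do not change. *)
Definition flatten_Im m (w : 'I_m -> R[i]) (t : R) : 'I_m -> R[i] :=
  fun j => (Re (w j))%:C%C + t%:C%C * ('i%C * (Im (w j))%:C%C).

Lemma Re_flatten_Im m (w : 'I_m -> R[i]) t j : Re (flatten_Im w t j) = Re (w j).
Proof. by rewrite !ReIm; ring. Qed.

Lemma Im_flatten_Im m (w : 'I_m -> R[i]) t j :
  Im (flatten_Im w t j) = t * Im (w j).
Proof. by rewrite !ReIm; ring. Qed.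

Lemma flatten_Im1 m (w : 'I_m -> R[i]) : flatten_Im w 1 = w.
Proof.
apply/funext => j; apply: complexP; first by rewrite Re_flatten_Im.
by rewrite Im_flatten_Im mul1r.
Qed.

Lemma strict_flatten_Im m (w : 'I_m -> R[i]) t :
  (forall k, `|tail_Im w k| <= pi) -> 0 <= t < 1 -> strict (flatten_Im w t).
Proof.
move=> hw /andP[t0 t1] k.
rewrite /tail_Im (eq_bigr (fun j => t * Im (w j))) => [|j _]; last first.
  exact: Im_flatten_Im.
rewrite -mulr_sumr -/(tail_Im w k) normrM (ger0_norm t0).
apply: (@le_lt_trans _ _ (t * pi)); first by rewrite ler_wpM2l.
by rewrite gtr_pMl// pi_gt0.
Qed.

Lemma cderiv_li_sum m (n : 'I_m -> int) (w : 'I_m -> R[i]) c N t :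
  exists d, cderiv (fun s => li_sum n (flatten_Im w s) c N) t d.
Proof.
elim: m n w c => [|m IH] n w c; first by exists 0; exact: cderiv_cst.
apply: cderiv_sum => k; have [d hd] := IH (shift_fun n) (shift_fun w) k.
eexists; apply: cderivM hd; rewrite /li_term.
apply: cderivM; last exact: cderiv_cst.
by apply: cderiv_cexp; apply: cderivZ; exact: cderiv_line.
Qed.

Lemma cderiv_li_off m (n : 'I_m -> int) (w p : 'I_m -> R[i]) a t :
  exists d, cderiv (fun s => li_off n (flatten_Im w s) a p) t d.
Proof.
have [|d hd] := @cderiv_prod _ (index_enum 'I_m) predT
  (fun k s => li_factor (flatten_Im w s k) (n k) (a + partial_sum p k)) t.
  move=> k; eexists; apply: cderivM; last exact: cderiv_cst.
  by apply: cderiv_cexp; apply: cderivN; apply: cderivZ; exact: cderiv_line.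
by eexists; apply: cderivM hd (cderiv_cst _ _).
Qed.

(** Convexity of the exponential: along the path the integrand is dominated by
    its values at the two ends. *)
Lemma normc_li_off_flatten m (n : 'I_m -> int) (w p : 'I_m -> R[i]) a t :
  0 <= t <= 1 -> normc (li_off n (flatten_Im w t) a p) <=
  normc (li_off n (flatten_Im w 0) a p) + normc (li_off n w a p).
Proof.
move=> /andP[t0 t1]; pose z k := a + partial_sum p k.
pose A := \sum_(k < m) Im (z k) * Re (w k).
pose B := \sum_(k < m) Re (z k) * Im (w k).
pose Q := \prod_(k < m) normc (z k) ^ (- n k) * normc (li_den p)^-1.
have E s : normc (li_off n (flatten_Im w s) a p) = expR (A + s * B) * Q.
  rewrite /li_off normcM normc_prod.
  rewrite (eq_bigr (fun k => expR (Im (z k) * Re (w k) + s * (Re (z k) * Im (w k))) *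
    normc (z k) ^ (- n k))) => [|k _]; last first.
    rewrite normc_li_factor Re_flatten_Im Im_flatten_Im; congr (expR _ * _).
    by rewrite -/(z k); ring.
  by rewrite big_split/= -expR_sum big_split/= -mulr_sumr -mulrA.
have Q0 : 0 <= Q.
  by rewrite mulr_ge0 ?normc_ge0// prodr_ge0// => k _; rewrite exprz_ge0 ?normc_ge0.
have := E 1; rewrite flatten_Im1 => ->.
rewrite !E -mulrDl ler_wpM2r// mul0r addr0 mul1r.
have [B0|B0] := leP 0 B.
  by rewrite ler_wpDl ?expR_ge0// ler_expR lerD2l ler_piMl.
by rewrite ler_wpDr ?expR_ge0// ler_expR gerDl mulr_ge0_le0// ltW.
Qed.

(** Dominated convergence, the dominating function being supplied by
    [normc_li_off_flatten]. *)
Lemma ccvg_li_int m (n : 'I_m -> int) (w : 'I_m -> R[i]) e (s : nat -> R) :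
  0 < e < 1 -> cintegrable (mut m) (fun t => li_off n w 0 (contour_pt e t)) ->
  (forall k, 0 <= s k <= 1) -> s k @[k --> \oo] --> (1 : R) ->
  ccvg (fun k => cintegral (mut m) (fun t => li_off n (flatten_Im w (s k)) 0 (contour_pt e t)))
    (cintegral (mut m) (fun t => li_off n w 0 (contour_pt e t))).
Proof.
move=> e01 iw s01 s1.
have i0 : cintegrable (mut m) (fun t => li_off n (flatten_Im w 0) 0 (contour_pt e t)).
  apply: cintegrable_li_off; rewrite ?Im0//.
  by apply: strict_flatten_Im; [exact: tail_Im_le e01 iw|rewrite lexx ltr01].
pose g0 t := `|Re (li_off n (flatten_Im w 0) 0 (contour_pt e t))| +
  `|Im (li_off n (flatten_Im w 0) 0 (contour_pt e t))|.
pose g1 t := `|Re (li_off n w 0 (contour_pt e t))| +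
  `|Im (li_off n w 0 (contour_pt e t))|.
have ig : (mut m).-integrable setT (EFin \o (fun t => g0 t + g1 t)).
  rewrite (_ : _ \o _ = (EFin \o g0) \+ (EFin \o g1))%E.
    apply: integrableD => //; [exact: (cintegrable_abs i0)|exact: (cintegrable_abs iw)].
  by apply/funext => t /=; rewrite EFinD.
have fg k t : normc (li_off n (flatten_Im w (s k)) 0 (contour_pt e t)) <= g0 t + g1 t.
  rewrite (le_trans (normc_li_off_flatten n w _ 0 (s01 k)))//.
  by apply: lerD; exact: normc_le_ReIm.
have pt t : ccvg (fun k => li_off n (flatten_Im w (s k)) 0 (contour_pt e t))
    (li_off n w 0 (contour_pt e t)).
  have [d hd] := cderiv_li_off n w (contour_pt e t) 0 1.
  by have := ccvg_cderiv hd s1; rewrite flatten_Im1.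
have real_cvg (f : nat -> m.-tuple RR -> R) (h : m.-tuple RR -> R) :
    (forall k, measurable_fun setT (f k)) -> (mut m).-integrable setT (EFin \o h) ->
    (forall t, f k t @[k --> \oo] --> h t) ->
    (forall k t, `|f k t| <= g0 t + g1 t) ->
    (\int[mut m]_t f k t) @[k --> \oo] --> \int[mut m]_t h t.
  move=> mf ih fh fle.
  have mh : measurable_fun setT (EFin \o h) by exact: (measurable_int _ ih).
  have mf' k : measurable_fun setT (EFin \o f k) by exact/measurable_EFinP.
  have [|||_ _] := @dominated_convergence _ _ _ (mut m) setT measurableT
    (fun k => EFin \o f k) (EFin \o h) (EFin \o (fun t => g0 t + g1 t)) mf' mh.
  - by apply/aeW => t _; apply: cvg_EFin; [exact: nearW|exact: fh].
  - exact: ig.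
  - by apply/aeW => t k _; rewrite lee_fin.
  rewrite (_ : (\int[mut m]_t (EFin \o h) t)%E = (\int[mut m]_t h t)%:E); last first.
    by rewrite /Rintegral fineK// integrable_fin_num.
  by move=> /fine_cvg.
have mm (x : 'I_m -> R[i]) := cmeasurable_li_off n x 0 e.
split; apply: real_cvg.
- by move=> k; have [] := mm (flatten_Im w (s k)).
- exact: iw.1.
- by move=> t; have [] := pt t.
- by move=> k t; exact: le_trans (Re_le_normc _) (fg k t).
- by move=> k; have [] := mm (flatten_Im w (s k)).
- exact: iw.2.
- by move=> t; have [] := pt t.
- by move=> k t; exact: le_trans (Im_le_normc _) (fg k t).
Qed.

Lemma uniform_Re_bound m (w : 'I_m -> R[i]) : (forall j, Re (w j) < 0) ->
  exists2 d, 0 < d & forall j, Re (w j) <= - (2 * d).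
Proof.
elim: m w => [|m IH] w hw; first by exists 1 => // -[].
have [d d0 hd] := IH (shift_fun w) (fun j => hw _).
have h0 := hw ord0.
exists (Num.min d (- Re (w ord0) / 2)) => [|j].
  by rewrite lt_min d0 divr_gt0// oppr_gt0.
case: (unliftP ord0 j) => [k ->|->].
  rewrite (le_trans (hd k))// lerN2 ler_pM2l// ge_min lexx//.
rewrite -lerN2 opprK; apply: (@le_trans _ _ (2 * (- Re (w ord0) / 2))); last by lra.
by rewrite ler_pM2l// ge_min lexx orbT.
Qed.

Lemma geometric_cvg0 (C r : R) : 0 <= r < 1 -> C * r ^+ k @[k --> \oo] --> 0.
Proof.
move=> /andP[r0 r1]; rewrite -[X in _ --> X](mulr0 C); apply: cvgMr.
by apply: cvg_expr; rewrite ger0_norm.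
Qed.

(** For [t < 1] the comparison holds with a constant depending on [t]; letting
    the truncation grow replaces it by the uniform Cauchy constant, and then [t]
    can tend to 1. *)
Lemma li_int_sum_le m (n : 'I_m -> int) (w : 'I_m -> R[i]) e :
  0 < e < 2^-1 -> (forall j, Re (w j) < 0) ->
  cintegrable (mut m) (fun t => li_off n w 0 (contour_pt e t)) ->
  exists C r, 0 <= r < 1 /\ forall N, (0 < N)%N ->
    normc ('i%C ^ (\sum_(j < m) n j - m%:Z) *
      cintegral (mut m) (fun t => li_off n w 0 (contour_pt e t)) -
      li_sum n w 0 N) <= C * r ^+ N.
Proof.
move=> e02 wR iw; have /andP[e0 e2] := e02.
have e01 : 0 < e < 1 by rewrite e0; lra.
have [d d0 wd] := uniform_Re_bound wR.
have [C C0 hC] := li_sum_cauchy n d0.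
exists C, (expR (- d)); split; first exact: expRN01.
set r := expR (- d).
have r01 : 0 <= r < 1 by exact: expRN01.
move=> N N0.
have wtd t j : Re (flatten_Im w t j) <= - (2 * d) by rewrite Re_flatten_Im.
have off0 (x : 'I_m -> R[i]) :
    li_int n x e 0 = cintegral (mut m) (fun t => li_off n x 0 (contour_pt e t)).
  by rewrite /li_int mulr0.
have strict_le t : 0 <= t < 1 -> normc ('i%C ^ (\sum_(j < m) n j - m%:Z) *
    cintegral (mut m) (fun x => li_off n (flatten_Im w t) 0 (contour_pt e x)) -
    li_sum n (flatten_Im w t) 0 N) <= C * r ^+ N.
  move=> t01; have ws := strict_flatten_Im (tail_Im_le e01 iw) t01.
  have [D D0 hD] := li_int_norm_sum n e02 ws d0 (wtd t).
  have h : C * r ^+ N + D * r ^+ M @[M --> \oo] --> C * r ^+ N + 0.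
    by apply: cvgD; [exact: cvg_cst|exact: geometric_cvg0].
  rewrite -[leRHS]addr0; apply: (ler_cvg_to (cvg_cst _) h).
  near=> M; have NM : (N <= M)%N by near: M; exact: nbhs_infty_ge.
  have [_ /(_ M NM) h1] := hC _ (wtd t) 0 N N0.
  have h2 := hD 0 M (leq_trans N0 NM).
  rewrite /li_int_norm expr0 mulr1 off0 in h2.
  have tri (x y z : R[i]) : normc (x - z) <= normc (y - z) + normc (x - y).
    by rewrite [leRHS]addrC -[X in normc X <= _](subrKA y) ler_normcD.
  exact: le_trans (tri _ _ _) (lerD h1 h2).
(* any sequence in [[0, 1[] tending to 1 *)
pose s (k : nat) : R := 1 - k.+1%:R^-1.
have s01 k : 0 <= s k < 1.
  by rewrite /s subr_ge0 invf_le1 ?ltr0n// ler1n gtrBl invr_gt0 ltr0n.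
have s1 : s k @[k --> \oo] --> (1 : R).
  by rewrite -[X in _ --> X]subr0; apply: cvgB; [exact: cvg_cst|exact: cvg_harmonic].
have s01' k : 0 <= s k <= 1 by have /andP[-> /ltW] := s01 k.
have c1 := ccvg_li_int e01 iw s01' s1.
have [d' hd'] := cderiv_li_sum n w 0 N 1.
have c2 := ccvg_cderiv hd' s1; rewrite flatten_Im1 in c2.
apply: ccvg_normc_le (ccvgB (ccvgZ _ c1) c2) _ => k.
exact: strict_le.
Unshelve. all: by end_near. Qed.

Lemma cvg_complex (u : nat -> (R[i])^o) (l : (R[i])^o) (C r : R) : 0 <= r < 1 ->
  (forall k, (0 < k)%N -> normc ((l : R[i]) - (u k : R[i])) <= C * r ^+ k) ->
  u k @[k --> \oo] --> l.
Proof.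
move=> r01 h; apply/cvgrPdist_lt => eps eps0.
have /andP[/eqP Ie Re0'] : (Im eps == Im 0) && (Re 0 < Re eps) by rewrite -ltcE.
have epsE : eps = (Re eps)%:C%C by apply: complexP; rewrite ?ReR ?ImR ?Ie.
near=> k; rewrite epsE (normcE_norm ((l : R[i]) - (u k : R[i]))) ltcR.
have k0 : (0 < k)%N by near: k; exact: nbhs_infty_gt.
apply: le_lt_trans (h k k0) _; near: k.
exact: (cvgr_lt 0 (geometric_cvg0 C r01)).
Unshelve. all: by end_near. Qed.

End boundary.

(* For m >= 2 the hypotheses on the w_i do not make the integral over
   (R + i0)^m convergent: as Re p_k -> +oo or -oo the integrand has size
   exp (Re p_k * Im (w_k + ... + w_m) - pi * |Re p_k|), up to powers.  Hence
   absolute convergence is stated when |Im (w_k + ... + w_m)| < pi for all k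
   (automatic for m = 1), and the identity whenever there is absolute
   convergence. *)
Theorem theorem2p1 (R : realType) (m : nat) (n : 'I_m -> int)
    (w : 'I_m -> R[i]) (m_gt0 : (0 < m)%N)
    (w_Im : forall i : 'I_m, `|complex.Im (w i)| < pi)
    (w_Re : forall i : 'I_m, complex.Re (w i) < 0) :
  ((forall k : 'I_m, `|\sum_(j < m | (k <= j)%N) complex.Im (w j)| < pi) ->
    contour_integrable (li_integrand n w)) /\
  (contour_integrable (li_integrand n w) ->
    cvg (contour_integral_eps (li_integrand n w) e @[e --> 0^'+]) /\
    multi_li n (li_arg w) =
      'i%C ^ (\sum_(i < m) n i - m%:Z) * contour_integral (li_integrand n w)).
Proof.
split.
  move=> ws; rewrite /contour_integrable.
  near=> e; rewrite on_contourE; apply: cintegrable_li_off => //.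
  by apply/andP; split; near: e; [exact: nbhs_right_gt|exact: nbhs_right_lt].
move=> wi; set A := 'i%C ^ _.
have A0 : A != 0 by rewrite expfz_neq0// i_neq0.
(* the integral does not depend on the height, so the limit is trivial *)
have key : \forall e \near 0^'+,
    contour_integral_eps (li_integrand n w) e = A^-1 * multi_li n (li_arg w).
  near=> e.
  have e02 : 0 < e < 2^-1.
    by apply/andP; split; near: e; [exact: nbhs_right_gt|apply: nbhs_right_lt; rewrite invr_gt0].
  have ie : cintegrable (lebesgue_tuple R m) (on_contour (li_integrand n w) e).
    by near: e; exact: wi.
  rewrite on_contourE in ie; rewrite /contour_integral_eps on_contourE.
  have [C [r [r01 hC]]] := li_int_sum_le e02 w_Re ie.
  have cv : multi_li_sum n (li_arg w) N @[N --> \oo] -->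
      (A * cintegral (lebesgue_tuple R m)
        (fun t => li_off n w 0 (contour_pt e t)) : (R[i])^o).
    apply: (cvg_complex r01) => N N0.
    by rewrite multi_li_sumE//; exact: hC.
  rewrite /multi_li (cvg_lim (@norm_hausdorff _ _) cv).
  by rewrite mulKf.
have cv : contour_integral_eps (li_integrand n w) e @[e --> 0^'+] -->
    (A^-1 * multi_li n (li_arg w) : (R[i])^o) by exact: cvg_near_cst key.
split; first by apply/cvg_ex; exists (A^-1 * multi_li n (li_arg w)).
rewrite /contour_integral (cvg_lim (@norm_hausdorff _ _) cv).
by rewrite mulVKf.
Unshelve. all: by end_near. Qed.
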